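(* Let $n$ be fixed and assume $\Sigma,\mathcal{A},\mathcal{S}_0,m,\mathcal{CS},k,D_{max}$ and the functions next, critical, mustTick as described below. The problem of determining whether $\mathcal{A}$ is $n$-time-bounded realizable with respect to the lazy time sampling, $\mathcal{CS}$ and $\mathcal{S}_0$ is in NP with $\mathcal{S}_0$ as the input.
   Context: Timed multiset rewriting (MSR) setting. $\Sigma$ is a finite first-order typed alphabet. Configurations are multisets of ground timestamped facts $F@t$ ($t\in\mathbb{N}$) with exactly one fact $Time@t$ (global time). Rules are the Tick rule $Time@T \to Time@(T+1)$ and instantaneous rules $Time@T, \mathcal{W}, F_1@T_1', \ldots, F_n@T_n' \mid \mathcal{C} \to Time@T, \mathcal{W}, Q_1@(T+D_1), \ldots, Q_m@(T+D_m)$, with guards of constraints $T > T' \pm N$ or $T = T' \pm N$. $\mathcal{A}$ is a progressive timed MSR (PTS): balanced ($n=m$ in every instantaneous rule), each instantaneous rule creates at least one fact with $D_i\geq 1$ and only consumes facts with timestamp $\leq T$. $\mathcal{S}_0$ is an initial configuration with $m$ facts, $k$ bounds the size (number of symbols) of facts, $D_{max}$ bounds the natural numbers in $\mathcal{S}_0$, $\mathcal{A}$, $\mathcal{CS}$. A trace uses the lazy time sampling if Tick is applied to a configuration only when no instantaneous rule is applicable to it. A critical configuration specification $\mathcal{CS}$ is a set of pairs $\langle \mathcal{S}_j,\mathcal{C}_j\rangle$ of fact patterns and time constraints; a configuration is critical if some instance $\mathcal{S}_j\sigma$ is contained in it with $\mathcal{C}_j\sigma$ true; a trace is compliant if it has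 no critical configuration. $\mathcal{A}$ is $n$-time-bounded realizable w.r.t. the lazy time sampling, $\mathcal{CS}$, $\mathcal{S}_0$ if some trace starting at $\mathcal{S}_0$ using the lazy time sampling is compliant and global time advances by exactly $n$ units in it. The functions next, critical and mustTick check, respectively, whether a rule is applicable to a given (δ-)configuration, whether a configuration is critical w.r.t. $\mathcal{CS}$, and whether Tick must (1) or must not (0) be applied under the lazy time sampling; they run in time polynomial in the size of $\mathcal{S}_0$. In a PTS, traces with exactly $n$ Tick instances have length at most $(n+2)m+n$. *)

(* Defs.v *)
From Corelib Require Import BinNums.
From HB Require Import structures.
From mathcomp Require Import all_boot all_order all_algebra.

Set Implicit Arguments.
Unset Strict Implicit.
Unset Printing Implicit Defensive.

Import Order.TTheory GRing.Theory Num.Theory.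

(** * Polynomial time and NP *)

Inductive move := MoveLeft | Stay | MoveRight.

(* A deterministic multi-tape Turing machine with input alphabet [X] and at
   least two tapes.  A cell holds [None] (blank) or a symbol of
   [X + tm_extra].  The machine halts when [tm_trans] returns [None], and then
   answers [tm_accept] of its state. *)
Record turing_machine (X : finType) := TuringMachine {
  tm_extra : finType;
  tm_tapes : nat;
  tm_state : finType;
  tm_start : tm_state;
  tm_accept : pred tm_state;
  tm_trans : tm_state ->
    {ffun 'I_tm_tapes.+2 -> option (X + tm_extra)} ->
    option (tm_state * ('I_tm_tapes.+2 -> option (X + tm_extra) * move))
}.

Section Runs.
Variables (X : finType) (M : turing_machine X).

Definition tm_symbol : Type := (X + tm_extra M)%type.
Definition cell : Type := option tm_symbol.

(* Two-way infinite tape: the cells left of the head (nearest first), the cell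
   under the head, the cells right of the head; all other cells are blank. *)
Record tape := Tape { tleft : seq cell; thead : cell; tright : seq cell }.

Definition tape_of_word (w : seq tm_symbol) : tape :=
  if w is a :: w' then Tape [::] (Some a) [seq Some b | b <- w']
  else Tape [::] None [::].

Definition tape_act (t : tape) (wm : cell * move) : tape :=
  let: (c, mv) := wm in
  match mv with
  | Stay => Tape (tleft t) c (tright t)
  | MoveLeft =>
      Tape (behead (tleft t)) (head None (tleft t)) (c :: tright t)
  | MoveRight =>
      Tape (c :: tleft t) (head None (tright t)) (behead (tright t))
  end.

Definition tapes : Type := 'I_(tm_tapes M).+2 -> tape.

Definition tm_step (q : tm_state M) (ts : tapes) :
    option (tm_state M * tapes) :=
  if @tm_trans X M q [ffun i => thead (ts i)] is Some (q', act)
  then Some (q', fun i => tape_act (ts i) (act i)) else None.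

(* [Some b] if the machine halts with answer [b] after at most [fuel] steps. *)
Fixpoint tm_run (fuel : nat) (q : tm_state M) (ts : tapes) : option bool :=
  if tm_step q ts is Some (q', ts')
  then if fuel is fuel'.+1 then tm_run fuel' q' ts' else None
  else Some (tm_accept q).

(* The [i]-th word is written on the [i]-th tape. *)
Definition tm_answer (fuel : nat) (ws : seq (seq tm_symbol)) : option bool :=
  tm_run fuel (tm_start M) (fun i => tape_of_word (nth [::] ws i)).

Definition input_word (x : seq X) : seq tm_symbol := [seq inl a | a <- x].

End Runs.

(* [L] has a polynomial-time verifier: the input is on the first tape and a
   certificate of polynomial length on the second one.  The certificate is over
   the whole tape alphabet of the machine. *)
Definition in_NP (X : finType) (L : seq X -> Prop) : Prop :=
  exists (M : turing_machine X) (p q : {poly nat}),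
    (forall x (w : seq (tm_symbol M)),
        tm_answer p.[(size x + size w)%N]%R [:: input_word M x; w] <> None) /\
    (forall x, L x <->
       exists w : seq (tm_symbol M), (size w <= q.[size x]%R) /\
         tm_answer p.[(size x + size w)%N]%R [:: input_word M x; w] = Some true).

(* The boolean function [f] is computed in polynomial time on the elements of
   [D], presented through the encoding [enc]. *)
Definition poly_time_on (X : finType) (T : Type) (D : T -> Prop)
    (enc : T -> seq X) (f : T -> bool) : Prop :=
  exists (M : turing_machine X) (p : {poly nat}),
    forall s : T, D s ->
      tm_answer p.[size (enc s)]%R [:: input_word M (enc s)] = Some (f s).

(** * Finite typed first-order alphabets *)

Record signature := Signature {
  sort : finType;
  fsym : finType;
  psym : finType;
  fdom : fsym -> seq sort;
  fcod : fsym -> sort;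
  pdom : psym -> seq sort;
  time_sym : psym;
  time_dom : pdom time_sym = [::]
}.

(* Variables carry their sort; constants are nullary function symbols. *)
Inductive term (Sg : signature) : Type :=
  | Var of sort Sg & nat
  | App of fsym Sg & seq (term Sg).

Section TermEq.
Variable Sg : signature.

Fixpoint term_tree (t : term Sg) : GenTree.tree (sort Sg * nat + fsym Sg) :=
  match t with
  | Var s x => GenTree.Leaf (inl (s, x))
  | App f ts =>
      GenTree.Node 0 (GenTree.Leaf (inr f) :: [seq term_tree t' | t' <- ts])
  end.

Fixpoint tree_term (u : GenTree.tree (sort Sg * nat + fsym Sg)) :
    option (term Sg) :=
  match u with
  | GenTree.Leaf (inl (s, x)) => Some (Var s x)
  | GenTree.Node 0 (GenTree.Leaf (inr f) :: us) =>
      Some (App f (pmap tree_term us))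
  | _ => None
  end.

Lemma term_treeK : pcancel term_tree tree_term.
Proof.
rewrite /pcancel; fix IH 1; case=> [s x|f ts] //=; congr (Some (App f _)).
by elim: ts => [|t ts IHts] //=; rewrite IH /= IHts.
Qed.

HB.instance Definition _ := Equality.copy (term Sg) (pcan_type term_treeK).

End TermEq.

Section Terms.
Variable Sg : signature.
Implicit Types (t : term Sg) (s : sort Sg).

Fixpoint has_sort t s : bool :=
  match t with
  | Var s' _ => s' == s
  | App f ts => (fcod f == s) && all2 has_sort ts (fdom f)
  end.

Fixpoint ground t : bool :=
  if t is App _ ts then all ground ts else false.

Fixpoint term_size t : nat :=
  if t is App _ ts then (sumn [seq term_size t' | t' <- ts]).+1 else 1.

Fixpoint subst (sigma : sort Sg -> nat -> term Sg) t : term Sg :=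
  match t with
  | Var s x => sigma s x
  | App f ts => App f [seq subst sigma t' | t' <- ts]
  end.

Definition fact : Type := (psym Sg * seq (term Sg))%type.

Definition time_fact : fact := (time_sym Sg, [::]).

Definition wt_fact (F : fact) : bool := all2 has_sort F.2 (pdom F.1).
Definition ground_fact (F : fact) : bool := all ground F.2.
Definition fact_size (F : fact) : nat := (sumn [seq term_size t | t <- F.2]).+1.
Definition subst_fact (sigma : sort Sg -> nat -> term Sg) (F : fact) : fact :=
  (F.1, [seq subst sigma t | t <- F.2]).

End Terms.

(** * Configurations *)

Definition timed_fact (Sg : signature) : Type := (fact Sg * nat)%type.

(* A sequence stands for the multiset of its elements: all notions below are
   invariant under [perm_eq]. *)
Definition config (Sg : signature) : Type := seq (timed_fact Sg).

Section Configurations.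
Variables (Sg : signature) (k : nat).

Definition is_time (G : timed_fact Sg) : bool := G.1 == time_fact Sg.

(* Facts have at most [k] symbols; time stamps are not counted. *)
Definition configuration (S : config Sg) : bool :=
  all (fun G => [&& wt_fact G.1, ground_fact G.1 & fact_size G.1 <= k]) S
  && (count is_time S == 1).

Definition global_time (S : config Sg) : nat :=
  head 0 [seq G.2 | G <- S & is_time G].

End Configurations.

(** * Time constraints, rules and critical configurations *)

Definition tvar : Type := nat.

(* [TGt T T' z] is [T > T' + z] and [TEq T T' z] is [T = T' + z]; the integer
   [z] is the signed offset +N or -N. *)
Inductive tconstr := TGt of tvar & tvar & int | TEq of tvar & tvar & int.

Definition tconstr_repr (c : tconstr) : bool * tvar * tvar * int :=
  match c with
  | TGt T T' z => (true, T, T', z)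
  | TEq T T' z => (false, T, T', z)
  end.
Definition tconstr_of (u : bool * tvar * tvar * int) : tconstr :=
  let: (b, T, T', z) := u in if b then TGt T T' z else TEq T T' z.
Lemma tconstr_reprK : cancel tconstr_repr tconstr_of.
Proof. by case. Qed.
HB.instance Definition _ := Equality.copy tconstr (can_type tconstr_reprK).

Definition tconstr_vars (c : tconstr) : seq tvar :=
  match c with TGt T T' _ | TEq T T' _ => [:: T; T'] end.

Definition tconstr_num (c : tconstr) : nat :=
  match c with TGt _ _ z | TEq _ _ z => `|z|%N end.

Definition tconstr_holds (tau : tvar -> nat) (c : tconstr) : bool :=
  match c with
  | TGt T T' z => ((tau T')%:Z + z < (tau T)%:Z)%R
  | TEq T T' z => ((tau T)%:Z == (tau T')%:Z + z)%R
  end.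

(* The instantaneous rule
     Time@T, keep, consume | guard --> Time@T, keep, create,
   where a pair (Q, D) of [r_create] stands for Q@(T + D). *)
Record irule (Sg : signature) := IRule {
  r_time : tvar;
  r_keep : seq (fact Sg * tvar);
  r_consume : seq (fact Sg * tvar);
  r_guard : seq tconstr;
  r_create : seq (fact Sg * nat)
}.

Section RuleEq.
Variable Sg : signature.
Definition irule_repr (r : irule Sg) :=
  (r_time r, r_keep r, r_consume r, r_guard r, r_create r).
Definition irule_of (u : tvar * seq (fact Sg * tvar) * seq (fact Sg * tvar)
    * seq tconstr * seq (fact Sg * nat)) : irule Sg :=
  let: (T, W, F, C, Q) := u in IRule T W F C Q.
Lemma irule_reprK : cancel irule_repr irule_of.
Proof. by case. Qed.
HB.instance Definition _ := Equality.copy (irule Sg) (can_type irule_reprK).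
End RuleEq.

Inductive rule (Sg : signature) := Tick | Inst of irule Sg.
Arguments Tick {Sg}.

Section Systems.
Variable Sg : signature.
Implicit Types (A : seq (irule Sg)) (S : config Sg).

Definition wf_irule (r : irule Sg) : bool :=
  let lhs := r_keep r ++ r_consume r in
  [&& all (fun F : fact Sg => wt_fact F && (F.1 != time_sym Sg))
        ([seq P.1 | P <- lhs] ++ [seq Q.1 | Q <- r_create r])
    & all (fun c => all [in r_time r :: [seq P.2 | P <- lhs]] (tconstr_vars c))
        (r_guard r)].

Definition balanced (r : irule Sg) : Prop :=
  size (r_consume r) = size (r_create r).

Definition creates_future (r : irule Sg) : Prop :=
  exists2 Q, Q \in r_create r & 1 <= Q.2.

Definition consumes_past (r : irule Sg) : Prop :=
  forall tau, all (tconstr_holds tau) (r_guard r) ->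
    forall P, P \in r_consume r -> tau P.2 <= tau (r_time r).

(* The Tick rule belongs to every system, so that [A] only lists the
   instantaneous rules. *)
Definition progressive A : Prop :=
  forall r, r \in A ->
    [/\ wf_irule r, balanced r, creates_future r & consumes_past r].

Definition inst (sigma : sort Sg -> nat -> term Sg) (tau : tvar -> nat)
    (P : fact Sg * tvar) : timed_fact Sg := (subst_fact sigma P.1, tau P.2).

(* One application of a rule.  Since [S] and [S'] are configurations, the facts
   of the rule instance are ground, well-typed and of size at most [k], so that
   [sigma] is ground and respects sorts on the variables of the rule. *)
Definition step (k : nat) (r : rule Sg) S S' : Prop :=
  [/\ configuration k S, configuration k S' &
    match r with
    | Tick => exists t rest,
        perm_eq S ((time_fact Sg, t) :: rest) /\
        perm_eq S' ((time_fact Sg, t.+1) :: rest)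
    | Inst r => exists sigma tau rest,
        let now := tau (r_time r) in
        let kept := (time_fact Sg, now) :: map (inst sigma tau) (r_keep r) in
        [/\ all (tconstr_holds tau) (r_guard r),
            perm_eq S (kept ++ map (inst sigma tau) (r_consume r) ++ rest) &
            perm_eq S' (kept ++
              [seq (subst_fact sigma Q.1, now + Q.2) | Q <- r_create r]
              ++ rest)]
    end].

Definition applicable (k : nat) (r : rule Sg) S : Prop :=
  exists S', step k r S S'.

Definition no_instantaneous (k : nat) A S : Prop :=
  forall r, r \in A -> ~ applicable k (Inst r) S.

Definition in_system A (r : rule Sg) : Prop :=
  if r is Inst r' then r' \in A else True.

(* A trace from [S]: the rules applied and the configurations reached. *)
Fixpoint is_trace (k : nat) A S (tr : seq (rule Sg * config Sg)) : Prop :=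
  if tr is (r, S') :: tr'
  then [/\ in_system A r, step k r S S' & is_trace k A S' tr'] else True.

Fixpoint lazy_sampling (k : nat) A S (tr : seq (rule Sg * config Sg)) : Prop :=
  if tr is (r, S') :: tr'
  then (if r is Tick then no_instantaneous k A S else True) /\
       lazy_sampling k A S' tr'
  else True.

(* A critical configuration specification lists pairs <S_j, C_j>. *)
Definition crit_spec : Type := seq (seq (fact Sg * tvar) * seq tconstr).

Implicit Type CS : crit_spec.

Definition wf_crit_spec CS : bool :=
  all (fun SC : seq (fact Sg * tvar) * seq tconstr =>
         all (fun P : fact Sg * tvar => wt_fact P.1) SC.1 &&
         all (fun c => all [in [seq P.2 | P <- SC.1]] (tconstr_vars c)) SC.2) CS.

Definition is_critical CS S : Prop :=
  exists2 SC, SC \in CS &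
    exists sigma tau rest,
      perm_eq S (map (inst sigma tau) SC.1 ++ rest) /\
      all (tconstr_holds tau) SC.2.

Fixpoint compliant CS S (tr : seq (rule Sg * config Sg)) : Prop :=
  ~ is_critical CS S /\ (if tr is (_, S') :: tr' then compliant CS S' tr' else True).

Definition time_bounded_realizable (n k : nat) A CS (S0 : config Sg) : Prop :=
  exists tr : seq (rule Sg * config Sg),
    [/\ is_trace k A S0 tr, lazy_sampling k A S0 tr, compliant CS S0 tr &
        global_time (last S0 [seq x.2 | x <- tr]) = global_time S0 + n].

Definition numbers (A : seq (irule Sg)) CS (S0 : config Sg) : seq nat :=
  [seq G.2 | G <- S0]
  ++ flatten [seq [seq tconstr_num c | c <- r_guard r]
                  ++ [seq Q.2 | Q <- r_create r] | r <- A]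
  ++ flatten [seq [seq tconstr_num c | c <- SC.2] | SC <- CS].

(* [S0] is an initial configuration with [m] facts and [Dmax] bounds the
   numbers of [S0], [A] and [CS]. *)
Definition initial_data (k : nat) A CS (S0 : config Sg) (m Dmax : nat) : Prop :=
  [/\ configuration k S0, size S0 = m & all (leq^~ Dmax) (numbers A CS S0)].

(** * Encoding of configurations as words *)

Definition char : finType := (psym Sg + fsym Sg + bool)%type.

Fixpoint pos_bits (p : positive) : seq bool :=
  match p with
  | xH => [:: true]
  | xO p' => false :: pos_bits p'
  | xI p' => true :: pos_bits p'
  end.

(* Binary, least significant digit first, without trailing zeros. *)
Definition nat_bits (n : nat) : seq bool :=
  if bin_of_nat n is Npos p then pos_bits p else [::].

(* Ground terms in Polish notation; arities make it uniquely readable.  There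
   are no variables in configurations, so their encoding is irrelevant. *)
Fixpoint encode_term (t : term Sg) : seq char :=
  if t is App f ts
  then inl (inr f) :: flatten [seq encode_term t' | t' <- ts] else [::].

Definition encode_timed_fact (G : timed_fact Sg) : seq char :=
  inl (inl G.1.1) :: flatten [seq encode_term t | t <- G.1.2]
  ++ [seq inr b | b <- nat_bits G.2].

Definition encode (S : config Sg) : seq char :=
  flatten [seq encode_timed_fact G | G <- S].

End Systems.

(* Main.v *)
From HB Require Import structures.
From mathcomp Require Import all_boot all_order all_algebra zify.
From mathcomp Require Import boolp.
Require Import Defs.

Set Implicit Arguments.
Unset Strict Implicit.
Unset Printing Implicit Defensive.

(** Nondeterminism takes the place of most of the programming.  A verifier is a
    regular program over push and pop instructions on finitely many stacks, with
    finite control.  On a Turing machine every instruction consumes one symbol of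
    the certificate, so the machine halts within linear time on every input and
    certificate; only the accepting runs need a polynomial bound.

    For a fixed size bound [k] there are finitely many ground facts, so that a
    configuration is a word over a finite alphabet of facts and binary digits.
    To apply a rule one guesses a ground instance of it together with all the time
    stamps involved, most significant digits first: as the guards and the created
    time stamps only depend on differences truncated at a constant, the finite
    control can follow these differences while the digits are written.  The facts
    consumed are then removed one by one and the new ones added.  Compliance and
    the laziness of ticks are decided by simulating the given machines, with two
    stacks for each of their tapes.

    Finally, in a progressive system the number of facts whose time stamp is at
    most the global time decreases with every instantaneous rule, which bounds the
    length of the traces; time stamps only grow by a constant, which bounds the
    size of the configurations. *)

(** * Regular stack programs *)

(** Soundness and completeness are kept apart throughout. A program denotes a relation between
    stores with running times; soundness forgets the time, completeness exhibits one run within a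
    bound. A stack cannot be read without a guess: a pop names the symbol it expects, so reading is
    always guessing followed by verification. Whatever is a fixed finite table, even one known only
    by classical reasoning, is put into the control. The simulated machines are used as tests: the
    store must be left as it was, so that they can be repeated at every configuration of a trace. A
    configuration is a multiset but a stack holds a sequence, and applying a rule removes facts at
    guessed places and puts new ones on top. A run therefore follows a trace only up to permutation,
    and every notion involved has to be transported along [perm_eq]. Finally, the language asks for
    some configuration encoded by the input, so that the parser may guess any preimage of it. *)

Section StackPrograms.
Variables J G : finType.

Definition store : Type := {ffun J -> seq G}.
Implicit Types (s : store) (j : J) (a : G).

Definition upd s j w : store := [ffun i => if i == j then w else s i].

Definition instr : Type := (J * (G + option G))%type.

(* [(j, inl a)] pushes [a] on stack [j]; [(j, inr o)] pops stack [j] and fails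
   unless it finds [o], where [None] stands for the empty stack. *)
Definition instr_rel (i : instr) s s' : Prop :=
  match i with
  | (j, inl a) => s' = upd s j (a :: s j)
  | (j, inr o) => ohead (s j) = o /\ s' = upd s j (behead (s j))
  end.

Inductive prog :=
  | Ins of instr
  | Graph (C E : finType) of E -> C & E -> C & E -> prog & C & C.

(** The extra 2 counts the silent moves by which the compiled automaton enters and leaves the body
    of an edge. *)
Inductive chain (C E : finType) (src tgt : E -> C)
    (R : E -> store -> store -> nat -> Prop) (b : C) :
    C -> store -> store -> nat -> Prop :=
  | chain_nil s : chain src tgt R b b s s 0
  | chain_cons e s1 s2 s3 t1 t2 of R e s1 s2 t1
      & chain src tgt R b (tgt e) s2 s3 t2 :
      chain src tgt R b (src e) s1 s3 (t1 + t2 + 2).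

Fixpoint den (p : prog) : store -> store -> nat -> Prop :=
  match p with
  | Ins i => fun s s' t => instr_rel i s s' /\ t = 1
  | Graph C E src tgt body a b => chain src tgt (fun e => den (body e)) b a
  end.

Definition label_rel (l : option instr) s s' : Prop :=
  if l is Some i then instr_rel i s s' else s' = s.

Record nfa := Nfa {
  nst : finType;
  ninit : nst;
  nfin : nst;
  ndelta : nst -> option instr -> nst -> bool
}.

Inductive npath (N : nfa) : nst N -> store -> nst N -> store -> nat -> Prop :=
  | npath_nil q s : npath q s q s 0
  | npath_cons q l q1 s s1 q' s' t of ndelta q l q1 & label_rel l s s1
      & npath q1 s1 q' s' t : npath q s q' s' t.+1.

Lemma npath_cat N (q1 q2 q3 : nst N) s1 s2 s3 t1 t2 :
  npath q1 s1 q2 s2 t1 -> npath q2 s2 q3 s3 t2 -> npath q1 s1 q3 s3 (t1 + t2).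
Proof.
elim=> // q l q' s s' q'' s'' t d e _ IH /IH h.
by rewrite addSn; apply: npath_cons d e h.
Qed.

Definition ins_nfa (i : instr) : nfa :=
  @Nfa bool false true (fun x l y => [&& ~~ x, y & l == Some i]).

Section GraphNfa.
Variables (C E : finType) (src tgt : E -> C) (N : E -> nfa) (a b : C).

Definition graph_delta (x : C + {e : E & nst (N e)}) (l : option instr)
    (y : C + {e : E & nst (N e)}) : bool :=
  match x, y with
  | inl c, inr u => [&& l == None, src (tag u) == c & tagged u == ninit (N (tag u))]
  | inr u, inl c => [&& l == None, tgt (tag u) == c & tagged u == nfin (N (tag u))]
  | inr u, inr v =>
      (tag u == tag v) && ndelta (tagged u) l (tagged_as u v)
  | _, _ => false
  end.

Definition graph_nfa : nfa := @Nfa _ (inl a) (inl b) graph_delta.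

Variable R : E -> store -> store -> nat -> Prop.

Lemma graph_nfa_complete c s s' t :
  (forall e s s' t, R e s s' t ->
     npath (ninit (N e)) s (nfin (N e)) s' t) ->
  chain src tgt R b c s s' t -> @npath graph_nfa (inl c) s (inl b) s' t.
Proof.
move=> H; elim=> [s0|e s1 s2 s3 t1 t2 /H p _ IH]; first exact: npath_nil.
have lift q s0 q' s0' t0 : @npath (N e) q s0 q' s0' t0 ->
    @npath graph_nfa (inr (Tagged (fun e => nst (N e)) q)) s0
                     (inr (Tagged (fun e => nst (N e)) q')) s0' t0.
  elim=> [*|q0 l q1 s4 s5 q2 s6 t3 d lr _ IHp]; first exact: npath_nil.
  by apply: npath_cons lr IHp; rewrite /= eqxx tagged_asE.
rewrite addn2 -addSn addnC -addSn addnC.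
apply: (@npath_cons graph_nfa _ None (inr (Tagged (fun e => nst (N e)) (ninit (N e)))) s1 s1) => //.
  by rewrite /= !eqxx.
apply: npath_cat (lift _ _ _ _ _ p) _.
by apply: (@npath_cons graph_nfa _ None (inl (tgt e)) s2 s2) => //=; rewrite !eqxx.
Qed.

(** The induction on the path needs an invariant also at the states inside the automaton of an edge:
    what remains splits, at the first exit, into a run of the body from the current state and a
    chain from the target of the edge. *)
Lemma graph_nfa_sound c s s' t :
  (forall e s s' t, npath (ninit (N e)) s (nfin (N e)) s' t ->
     exists t', R e s s' t') ->
  @npath graph_nfa (inl c) s (inl b) s' t ->
  exists t', chain src tgt R b c s s' t'.
Proof.
move=> H p.
suff K (x y : nst graph_nfa) : npath x s y s' t -> y = inl b ->
  match x with
  | inl c => exists t', chain src tgt R b c s s' t'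
  | inr u => exists m t1 t2, npath (tagged u) s (nfin (N (tag u))) m t1 /\
               chain src tgt R b (tgt (tag u)) m s' t2 end.
  exact: K p erefl.
move=> {p}; elim=> {x y s s' t} [x s ->|x l x1 s s1 y s' t d lr _ IH eqy].
  by exists 0; apply: chain_nil.
move: (IH eqy) d => {IH eqy}; case: x => [c0|[e q]]; case: x1 => [c1|[e1 q1]] //=.
- move=> [m [t1 [t2 [p ch]]]] /and3P[/eqP l0 /eqP <- /eqP q0].
  rewrite /= in q0; subst l q1; move: lr => /= es; subst s1.
  by have [t4 r4] := H _ _ _ _ p; exists (t4 + t2 + 2); apply: chain_cons r4 ch.
- move=> [t1 ch] /and3P[/eqP l0 /eqP et /eqP q0]; rewrite /= in q0.
  subst l q c1; move: lr => /= es; subst s1.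
  by exists s, 0, t1; split=> //; apply: npath_nil.
- move=> [m [t1 [t2 [p ch]]]] /andP[/eqP ee d]; subst e1.
  rewrite tagged_asE in d; exists m, t1.+1, t2; split=> //.
  exact: npath_cons d lr p.
Qed.

End GraphNfa.

Fixpoint compile (p : prog) : nfa :=
  match p with
  | Ins i => ins_nfa i
  | Graph C E src tgt body a b =>
      graph_nfa src tgt (fun e => compile (body e)) a b
  end.

Lemma compile_complete p s s' t :
  den p s s' t -> npath (ninit (compile p)) s (nfin (compile p)) s' t.
Proof.
elim: p s s' t => [i|C E src tgt body IH a b] s s' t /=.
  case=> r ->; apply: (@npath_cons (ins_nfa i) _ (Some i) true s s' _ _ 0) => //=.
  exact: npath_nil.
by move=> ch; apply: graph_nfa_complete IH ch.
Qed.

(** The time may be lost here: halting is ensured by the certificate, not by the program. *)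
Lemma compile_sound p s s' t :
  npath (ninit (compile p)) s (nfin (compile p)) s' t ->
  exists t', den p s s' t'.
Proof.
elim: p s s' t => [i|C E src tgt body IH a b] s s' t /=.
  move=> p; exists 1; split=> //.
  inversion p; subst.
  move: H H0 => /= /andP[q1E /eqP ->] /= r; move: q1E r H1; case: q1 => // _ r p1.
  by inversion p1; subst.
by apply: graph_nfa_sound.
Qed.

End StackPrograms.

(** * Stack programs on Turing machines *)

Section NfaMachine.
Variables (X J G : finType) (inX : X -> G) (jI : J) (N : nfa J G).

(** A certificate symbol names the label and the target state of one transition. *)
Let choice : finType := (option (instr J G) * nst N)%type.
Let extra : finType := (G + choice)%type.
(* [None] loads the input; [Some (inl q)] is control state [q] of the automaton;
   [Some (inr (j, o, q))] has moved to the top of stack [j], which should be [o],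
   and then continues in [q]. *)
Let mstate : finType := option (nst N + J * option G * nst N).
Let mcell : Type := option (X + extra).
Let sym (a : G) : mcell := Some (inr (inl a)).

(** Tape 0 holds the input ([inl false]), tape 1 the certificate ([inl true]), the others one stack
    each. *)
Definition tape_kind (i : 'I_(#|J|).+2) : bool + J :=
  match split (i : 'I_(2 + #|J|)) with
  | inl b => inl (val b == 1)
  | inr r => inr (enum_val r)
  end.
Definition stack_tape (j : J) : 'I_(#|J|).+2 :=
  rshift 2 (enum_rank j : 'I_#|J|).
Definition input_tape : 'I_(#|J|).+2 := lshift #|J| (@Ordinal 2 0 isT).
Definition cert_tape : 'I_(#|J|).+2 := lshift #|J| (@Ordinal 2 1 isT).

Lemma tape_kind_stack j : tape_kind (stack_tape j) = inr j.
Proof.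
rewrite /tape_kind /stack_tape.
have -> : split (rshift 2 (enum_rank j : 'I_#|J|)) = inr (enum_rank j).
  exact: (unsplitK (inr (enum_rank j) : 'I_2 + 'I_#|J|)).
by rewrite enum_rankK.
Qed.

Lemma tape_kind_input : tape_kind input_tape = inl false.
Proof.
rewrite /tape_kind /input_tape.
by have -> := unsplitK (inl (@Ordinal 2 0 isT) : 'I_2 + 'I_#|J|).
Qed.

Lemma tape_kind_cert : tape_kind cert_tape = inl true.
Proof.
rewrite /tape_kind /cert_tape.
by have -> := unsplitK (inl (@Ordinal 2 1 isT) : 'I_2 + 'I_#|J|).
Qed.

(** The head of a stack tape rests on the blank cell right of the top. A push is thus one step,
    while a pop needs a second step to inspect and blank the cell it has moved to. *)
Definition nfa_trans (st : mstate) (h : {ffun 'I_(#|J|).+2 -> mcell}) :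
    option (mstate * ('I_(#|J|).+2 -> mcell * move)) :=
  match st with
  | None =>
      if h input_tape is Some (inl x)
      then Some (None, fun i => match tape_kind i with
             | inl b => (h i, if b then Stay else MoveRight)
             | inr j => if j == jI then (sym (inX x), MoveRight) else (h i, Stay)
             end)
      else Some (Some (inl (ninit N)), fun i => (h i, Stay))
  | Some (inl q) =>
      if q == nfin N then None else
      if h cert_tape is Some (inr (inr (l, q'))) then
        if ndelta q l q' then
          Some (Some (if l is Some (j, inr o) then inr (j, o, q') else inl q'),
                fun i => match tape_kind i with
                | inl b => (h i, if b then MoveRight else Stay)
                | inr j => match l with
                    | Some (j', inl a) =>
                        if j == j' then (sym a, MoveRight) else (h i, Stay)
                    | Some (j', inr _) =>
                        if j == j' then (None, MoveLeft) else (h i, Stay)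
                    | None => (h i, Stay)
                    end
                end)
        else None
      else None
  | Some (inr (j, o, q')) =>
      if h (stack_tape j) == obind sym o
      then Some (Some (inl q'), fun i =>
             (if tape_kind i == inr j then None else h i, Stay))
      else None
  end.

Definition nfa_tm : turing_machine X :=
  @TuringMachine X extra #|J| mstate None (fun st => st == Some (inl (nfin N)))
    nfa_trans.

Notation tape := (tape nfa_tm).
Notation tapes := (tapes nfa_tm).

(** Pops leave explicit blanks right of the head, whence the [nseq]. *)
Definition stack_ok (t : tape) (w : seq G) : Prop :=
  [/\ tleft t = map sym w, thead t = None &
      exists n, tright t = nseq n (None : mcell)].

Definition word_ok (t : tape) (w : seq (X + extra)) : Prop :=
  thead t = head None (map Some w) /\ tright t = behead (map Some w).

Definition tapes_ok (ts : tapes) (s : store J G) w : Prop :=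
  (forall j, stack_ok (ts (stack_tape j)) (s j)) /\ word_ok (ts cert_tape) w.

Definition popping (ts : tapes) (s : store J G) w j : Prop :=
  (forall j', j' != j -> stack_ok (ts (stack_tape j')) (s j')) /\
  [/\ word_ok (ts cert_tape) w,
      thead (ts (stack_tape j)) = head None (map sym (s j)),
      tleft (ts (stack_tape j)) = behead (map sym (s j)) &
      exists n, tright (ts (stack_tape j)) = nseq n (None : mcell)].

Let stay (t : tape) : tape_act t (thead t, Stay) = t.
Proof. by case: t. Qed.

Lemma stack_ok_push t w a : stack_ok t w ->
  stack_ok (tape_act t (sym a, MoveRight)) (a :: w).
Proof.
case: t => l h r [/= -> _ [n ->]]; split=> //=; last by exists n.-1; case: n.
by case: n.
Qed.

Lemma word_ok_next t w : word_ok t w ->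
  word_ok (tape_act t (thead t, MoveRight)) (behead w).
Proof.
by case: t w => l h r [|a [|b w]] [/= -> ->]; split.
Qed.

Lemma head_popped (s : store J G) j o :
  (head None (map sym (s j)) == obind sym o) = (ohead (s j) == o).
Proof.
by case: (s j) => [|a w]; case: o => [b|].
Qed.

Section Steps.
Variables (ts : tapes) (s : store J G) (w : seq (X + extra)).

Lemma step_push q j a q' : tapes_ok ts s w -> q != nfin N ->
  ohead w = Some (inr (inr (Some (j, inl a), q'))) ->
  ndelta q (Some (j, inl a)) q' ->
  exists2 ts', tm_step (Some (inl q) : tm_state nfa_tm) ts =
                 Some (Some (inl q') : tm_state nfa_tm, ts')
             & tapes_ok ts' (upd s j (a :: s j)) (behead w).
Proof.
move=> [okS okC] qf hw d.
rewrite /tm_step /= (negPf qf) ffunE okC.1.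
move: okC hw; case Ew: w => [|c w'] //= okC [ec]; subst c; rewrite d.
eexists; first by [].
split=> [j'|]; rewrite ?tape_kind_stack ?tape_kind_cert ?ffunE; last exact: word_ok_next okC.
case: eqVneq => [->|ne]; first exact: stack_ok_push.
by rewrite stay.
Qed.

Lemma step_nop q q' : tapes_ok ts s w -> q != nfin N ->
  ohead w = Some (inr (inr (None, q'))) -> ndelta q None q' ->
  exists2 ts', tm_step (Some (inl q) : tm_state nfa_tm) ts =
                 Some (Some (inl q') : tm_state nfa_tm, ts')
             & tapes_ok ts' s (behead w).
Proof.
move=> [okS okC] qf hw d.
rewrite /tm_step /= (negPf qf) ffunE okC.1.
move: okC hw; case Ew: w => [|c w'] //= okC [ec]; subst c; rewrite d.
eexists; first by [].
split=> [j'|]; rewrite ?tape_kind_stack ?tape_kind_cert ?ffunE; last exact: word_ok_next okC.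
by rewrite stay.
Qed.

Lemma step_pop q j o q' : tapes_ok ts s w -> q != nfin N ->
  ohead w = Some (inr (inr (Some (j, inr o), q'))) ->
  ndelta q (Some (j, inr o)) q' ->
  exists2 ts', tm_step (Some (inl q) : tm_state nfa_tm) ts =
                 Some (Some (inr (j, o, q')) : tm_state nfa_tm, ts')
             & popping ts' s (behead w) j.
Proof.
move=> [okS okC] qf hw d.
rewrite /tm_step /= (negPf qf) ffunE okC.1.
move: okC hw; case Ew: w => [|c w'] //= okC [ec]; subst c; rewrite d.
eexists; first by [].
split=> [j' ne|]; first by rewrite tape_kind_stack !ffunE (negPf ne) stay.
rewrite ?tape_kind_stack ?tape_kind_cert ?ffunE eqxx; split; first exact: word_ok_next okC.
- by have [/= -> _ _] := okS j.
- by have [/= -> _ _] := okS j.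
- by have [_ _ [n /= ->]] := okS j; exists n.+1.
Qed.

Lemma step_check j o q' : popping ts s w j ->
  if ohead (s j) == o then
  exists2 ts', tm_step (Some (inr (j, o, q')) : tm_state nfa_tm) ts =
                 Some (Some (inl q') : tm_state nfa_tm, ts')
             & tapes_ok ts' (upd s j (behead (s j))) w
  else tm_step (Some (inr (j, o, q')) : tm_state nfa_tm) ts = None.
Proof.
move=> [okS [okC hj lj rj]]; rewrite /tm_step /= ffunE hj head_popped.
case: eqP => // _; eexists; first by [].
split=> [j'|]; last by rewrite tape_kind_cert ffunE; case: eqP => // _; rewrite stay.
rewrite tape_kind_stack !ffunE (inj_eq (can_inj (g:= fun x => if x is inr j then j else jI) _)) //.
case: eqVneq => [->|ne]; last by rewrite stay; apply: okS.
by split=> //=; rewrite lj behead_map.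
Qed.

Lemma step_halt q : tapes_ok ts s w -> q != nfin N ->
  (forall l q', ohead w = Some (inr (inr (l, q'))) -> ndelta q l q' -> False) ->
  tm_step (Some (inl q) : tm_state nfa_tm) ts = None.
Proof.
move=> [okS okC] qf hw; rewrite /tm_step /= (negPf qf) ffunE okC.1.
move: hw; case: (w) => [|[x|[a|[l q']]] w'] //= hw.
by case: ifP => // d; case: (hw l q' erefl d).
Qed.

End Steps.

Lemma tm_runE fuel q (ts : tapes) : tm_run fuel q ts =
  if tm_step q ts is Some (q', ts')
  then if fuel is fuel'.+1 then tm_run fuel' q' ts' else None
  else Some (tm_accept q).
Proof. by case: fuel. Qed.

Lemma final_run fuel (ts : tapes) :
  tm_run fuel (Some (inl (nfin N)) : tm_state nfa_tm) ts = Some true.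
Proof. by rewrite tm_runE /tm_step /= eqxx /= eqxx. Qed.

(** The possible continuations from well-formed tapes; [NextPop] stands apart because it ends in the
    middle of a pop, where the tapes only satisfy [popping]. *)
Variant run_spec q (ts : tapes) s w : Prop :=
  | NextFinal of q = nfin N
  | NextHalt of q != nfin N & tm_step (Some (inl q) : tm_state nfa_tm) ts = None
  | NextMove l q' s' ts' of q != nfin N & ndelta q l q' & label_rel l s s'
      & ohead w = Some (inr (inr (l, q')))
      & tm_step (Some (inl q) : tm_state nfa_tm) ts =
                 Some (Some (inl q') : tm_state nfa_tm, ts')
      & tapes_ok ts' s' (behead w)
  | NextPop j o q' ts' of q != nfin N & ndelta q (Some (j, inr o)) q'
      & ohead w = Some (inr (inr (Some (j, inr o), q')))
      & tm_step (Some (inl q) : tm_state nfa_tm) ts =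
                 Some (Some (inr (j, o, q')) : tm_state nfa_tm, ts')
      & popping ts' s (behead w) j.

Lemma runP q ts s w : tapes_ok ts s w -> run_spec q ts s w.
Proof.
move=> ok; case: (eqVneq q (nfin N)) => [->|qf]; first exact: NextFinal.
case E: (ohead w) => [[x|[a|[l q']]]|]; try by apply: NextHalt => //;
  apply: step_halt ok qf _ => l q'; rewrite E.
case d: (ndelta q l q'); last first.
  by apply: NextHalt => //; apply: step_halt ok qf _ => l1 q1; rewrite E => -[<- <-]; rewrite d.
case: l E d => [[j [a|o]]|] E d.
- by have [ts' st ok'] := step_push ok qf E d; apply: NextMove d _ E st ok'.
- by have [ts' st ok'] := step_pop ok qf E d; apply: NextPop d E st ok'.
- by have [ts' st ok'] := step_nop ok qf E d; apply: NextMove d _ E st ok'.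
Qed.

Lemma run_sound fuel :
  (forall q ts s w, tapes_ok ts s w ->
     tm_run fuel (Some (inl q) : tm_state nfa_tm) ts = Some true ->
     exists s' t, npath q s (nfin N) s' t) /\
  (forall j o q ts s w, popping ts s w j ->
     tm_run fuel (Some (inr (j, o, q)) : tm_state nfa_tm) ts = Some true ->
     ohead (s j) = o /\
     exists s' t, npath q (upd s j (behead (s j))) (nfin N) s' t).
Proof.
elim: fuel => [|fuel [IH1 IH2]]; split=> [q ts s w ok|j o q ts s w ok].
- rewrite tm_runE; case: (runP q ok) => [-> _|qf ->|l q' s' ts' _ _ _ _ ->|j o q' ts' _ _ _ ->] //.
    by exists s, 0; apply: npath_nil.
  by rewrite /= => -[] /eqP[] qe; rewrite qe eqxx in qf.
- by rewrite tm_runE; have := step_check o q ok; case: ifP => [_ [ts' -> _]|_ ->].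
- rewrite tm_runE.
  case: (runP q ok) => [->|qf ->|l q' s' ts' _ d lr _ -> ok'|j o q' ts' _ d _ -> ok'].
  + by exists s, 0; apply: npath_nil.
  + by rewrite /= => -[] /eqP[] qe; rewrite qe eqxx in qf.
  + by move=> /(IH1 _ _ _ _ ok') [s1 [t p]]; exists s1, t.+1; apply: npath_cons d lr p.
  + move=> /(IH2 _ _ _ _ _ _ ok') [e [s1 [t p]]]; exists s1, t.+1.
    by apply: npath_cons d _ p; split.
- rewrite tm_runE; have := step_check o q ok.
  case: eqP => [e [ts' -> ok'] /(IH1 _ _ _ _ ok')|_ ->] //.
Qed.

(** A certificate symbol pays for at most two steps, the second one being the check of a pop. In the
    middle of a pop that check is still due, hence the strict inequality. *)
Lemma run_total fuel w :
  (forall q ts s, tapes_ok ts s w -> 2 * size w <= fuel ->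
     tm_run fuel (Some (inl q) : tm_state nfa_tm) ts <> None) /\
  (forall j o q ts s, popping ts s w j -> 2 * size w < fuel ->
     tm_run fuel (Some (inr (j, o, q)) : tm_state nfa_tm) ts <> None).
Proof.
have hsz w1 (c : X + extra) : ohead w1 = Some c -> size w1 = (size (behead w1)).+1.
  by case: w1.
have drop a b f : a = b.+1 -> 2 * a <= f.+1 -> 2 * b < f by lia.
elim: fuel w => [|fuel IH] w; split=> [q ts s ok le|j o q ts s ok le //].
- rewrite tm_runE; case: (runP q ok) => [->|qf ->|l q' s' ts' _ _ _ /hsz e|j o q' ts' _ _ /hsz e] //;
    try by move: le; rewrite e.
  by rewrite /tm_step /= eqxx.
- rewrite tm_runE; case: (runP q ok) => [->|qf ->|l q' s' ts' _ _ _ /hsz e -> ok'|j o q' ts' _ _ /hsz e -> ok'] //.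
  + by rewrite /tm_step /= eqxx.
  + by apply: (IH _).1 ok' _; apply: ltnW; apply: drop e le.
  + by apply: (IH _).2 ok' _; apply: drop e le.
- rewrite tm_runE; have := step_check o q ok.
  case: ifP => [_ [ts' -> ok']|_ ->] //.
  by apply: (IH _).1 ok' _; lia.
Qed.

Lemma run_complete q s s' t : npath q s (nfin N) s' t ->
  exists2 w : seq (X + extra), size w <= t & forall ts fuel, tapes_ok ts s w ->
    2 * size w <= fuel ->
    tm_run fuel (Some (inl q) : tm_state nfa_tm) ts = Some true.
Proof.
move E: (nfin N) => f p; elim: p E => {q s f s' t} [q s <-|].
  by exists [::] => // ts fuel _ _; apply: final_run.
move=> q l q1 s s1 q' s' t d lr _ IH /IH [w sw H].
exists (inr (inr (l, q1)) :: w) => // ts [|fuel] ok le; first by rewrite /= in le; lia.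
rewrite /= in le.
have {le} [le le'] : 2 * size w < fuel /\ 2 * size w <= fuel.
  by move: le; set k := size _; lia.
(* The machine accepts as soon as it meets the final state, even if the given path runs through it
   and goes on. *)
case: (eqVneq q (nfin N)) => [->|qf]; first exact: final_run.
rewrite tm_runE; case: l d lr ok => [[j [a|o]]|] d lr ok.
- by have [//|ts' -> ok'] := step_push ok qf _ d; apply: H le'; rewrite /= in lr; rewrite lr.
- have [//|ts' -> ok'] := step_pop ok qf _ d.
  case: lr => eo es1; have := step_check o q1 ok'; rewrite eo eqxx => -[ts2 e2 ok2].
  case: fuel le {le'} => // fuel le; rewrite tm_runE e2; apply: H le.
  by rewrite es1.
- by have [//|ts' -> ok'] := step_nop ok qf _ d; apply: H le'; rewrite /= in lr; rewrite lr.
Qed.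

(** Pushing the input letter by letter leaves its last letter on top; this is why the input is
    parsed from its end. The additional unit of fuel is the step that leaves the loading state. *)
Lemma run_load x (ts : tapes) s w fuel : tapes_ok ts s w ->
  word_ok (ts input_tape) (map inl x) ->
  exists2 ts', tapes_ok ts' (upd s jI (rev (map inX x) ++ s jI)) w
    & tm_run (size x + fuel.+1) (None : tm_state nfa_tm) ts =
      tm_run fuel (Some (inl (ninit N)) : tm_state nfa_tm) ts'.
Proof.
elim: x ts s => [|a x IH] ts s [okS okC] okI.
  exists (fun i => tape_act (ts i) ([ffun i => thead (ts i)] i, Stay)).
    split=> [j|]; rewrite ffunE stay //.
    have -> : upd s jI (rev (map inX [::]) ++ s jI) = s; last by [].
    by apply/ffunP=> i; rewrite ffunE; case: eqP => [->|].
  by rewrite /= /tm_step /= {1}ffunE okI.1.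
rewrite map_cons rev_cons cat_rcons.
pose s1 := upd s jI (inX a :: s jI).
pose ts1 : tapes := fun i => tape_act (ts i) match tape_kind i with
  | inl b => ([ffun i => thead (ts i)] i, if b then Stay else MoveRight)
  | inr j => if j == jI then (sym (inX a), MoveRight)
             else ([ffun i => thead (ts i)] i, Stay) end.
have [||ts2 ok2 e2] := IH ts1 s1.
- split=> [j|]; rewrite /ts1 ?tape_kind_stack ?tape_kind_cert ffunE ?stay // ffunE.
  by case: eqP => [->|_]; [apply: stack_ok_push | rewrite stay].
- by rewrite /ts1 tape_kind_input ffunE; apply: word_ok_next okI.
exists ts2.
  by move: ok2; congr tapes_ok; apply/ffunP=> j; rewrite !ffunE; case: eqP => // _; rewrite eqxx.
rewrite -e2 [LHS]/= /tm_step /= {1}ffunE okI.1 /=.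
by rewrite -/ts1.
Qed.

Definition input_store (x : seq X) : store J G :=
  [ffun j => if j == jI then rev (map inX x) else [::]].

Lemma answerE x w fuel :
  exists2 ts, tapes_ok ts (input_store x) w
    & tm_answer (size x + fuel.+1) [:: input_word nfa_tm x; w] =
      tm_run fuel (Some (inl (ninit N)) : tm_state nfa_tm) ts.
Proof.
pose ts : tapes := fun i => tape_of_word (nth [::] [:: input_word nfa_tm x; w] i).
have word_tape (v : seq (X + extra)) : word_ok (@tape_of_word X nfa_tm v) v.
  by case: v.
have [||ts' ok' e] := @run_load x ts [ffun=> [::]] w fuel.
- split=> [j|]; last exact: word_tape.
  by rewrite ffunE /ts nth_default //; split=> //; exists 0.
- exact: word_tape.
exists ts'; last by rewrite -e.
move: ok'; congr tapes_ok; apply/ffunP=> j; rewrite !ffunE.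
by case: eqP => // _; rewrite cats0.
Qed.

Lemma nfa_in_NP (L : seq X -> Prop) (q : {poly nat}) :
  (forall x s t, npath (ninit N) (input_store x) (nfin N) s t -> L x) ->
  (forall x, L x -> exists s t,
     npath (ninit N) (input_store x) (nfin N) s t /\ t <= q.[size x]%R) ->
  in_NP L.
Proof.
(* For an input of size [m] and a certificate of size [k] this allows [m] steps of loading, one step
   to start, [2 * k] steps for the certificate, and [m] to spare. *)
move=> sound complete; pose p : {poly nat} := ('X *+ 2 + 1)%R.
have pE m k : p.[m + k]%R = m + (m + 2 * k).+1.
  rewrite /p hornerD hornerMn hornerX hornerC; lia.
exists nfa_tm, p, q; split=> [x w|x].
  rewrite pE; have [ts ok ->] := answerE x w (size x + 2 * size w).
  by apply: (run_total _ _).1 ok _; apply: leq_addl.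
split=> [/complete [s [t [np le]]]|[w [_]]].
  have [w sw H] := run_complete np; exists w; split; first exact: leq_trans sw le.
  rewrite pE; have [ts ok ->] := answerE x w (size x + 2 * size w).
  by apply: H ok _; apply: leq_addl.
rewrite pE; have [ts ok ->] := answerE x w (size x + 2 * size w).
by move=> /((run_sound _).1 _ _ _ _ ok) [s [t]]; apply: sound.
Qed.

End NfaMachine.

(** Hides the verifying machine: from here on only stack programs have to be written and
    analysed. *)
Lemma prog_in_NP (X J G : finType) (inX : X -> G) (jI : J) (p : prog J G)
    (L : seq X -> Prop) (q : {poly nat}) :
  (forall x s t, den p (input_store inX jI x) s t -> L x) ->
  (forall x, L x -> exists s t,
     den p (input_store inX jI x) s t /\ t <= q.[size x]%R) ->
  in_NP L.
Proof.
move=> sound complete.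
apply: (nfa_in_NP (inX := inX) (jI := jI) (N := compile p) (q := q)).
  by move=> x s t /compile_sound [t']; apply: sound.
move=> x /complete [s [t [d le]]]; exists s, t; split=> //.
exact: compile_complete.
Qed.

(** * Program constructions *)

Section Combinators.
Variables J G : finType.
Implicit Types (s : store J G) (j : J) (w : seq G) (p : prog J G).

Lemma upd_same s j w : upd s j w j = w.
Proof. by rewrite ffunE eqxx. Qed.

Lemma upd_other s j w i : i != j -> upd s j w i = s i.
Proof. by rewrite ffunE => /negPf ->. Qed.

Lemma upd_upd s j w w' : upd (upd s j w) j w' = upd s j w'.
Proof. by apply/ffunP=> i; rewrite !ffunE; case: eqP. Qed.

Lemma upd_comm s i j w w' : i != j ->
  upd (upd s i w) j w' = upd (upd s j w') i w.
Proof.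
move=> /negPf ne; apply/ffunP=> x; rewrite !ffunE.
by case: eqP => [->|] //; rewrite eq_sym ne.
Qed.

Lemma upd_self s j w : s j = w -> upd s j w = s.
Proof. by move=> <-; apply/ffunP=> i; rewrite ffunE; case: eqP => [->|]. Qed.

(** [may] serves soundness and is taken apart by inversion; [can] serves completeness and is built
    up by composition. *)
Definition may p s s' : Prop := exists t, den p s s' t.
Definition can p s s' (T : nat) : Prop := exists2 t, t <= T & den p s s' t.

Lemma can_le p s s' T T' : can p s s' T -> T <= T' -> can p s s' T'.
Proof. by move=> [t le d] le'; exists t => //; apply: leq_trans le le'. Qed.

Section Graphs.
Variables (C E : finType) (src tgt : E -> C) (body : E -> prog J G).

(** The invariant rule: an assertion is attached to each vertex and preserved along each edge. *)
Lemma may_graph_ind (P : C -> store J G -> Prop) (a b : C) s s' :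
  (forall e s1 s2, P (src e) s1 -> may (body e) s1 s2 -> P (tgt e) s2) ->
  may (Graph src tgt body a b) s s' -> P a s -> P b s'.
Proof.
move=> H [t /=]; elim=> // e s1 s2 s3 t1 t2 d _ IH P1.
by apply: IH; apply: H P1 _; exists t1.
Qed.

Lemma may_graph_inv a b s s' : may (Graph src tgt body a b) s s' ->
  (a = b /\ s = s') \/ exists e m,
    [/\ src e = a, may (body e) s m & may (Graph src tgt body (tgt e) b) m s'].
Proof.
move=> [t /= ch]; case: ch => [s0|e s1 s2 s3 t1 t2 d ch]; first by left.
by right; exists e, s2; split=> //; [exists t1|exists t2].
Qed.

Lemma can_graph_nil a s : can (Graph src tgt body a a) s s 0.
Proof. by exists 0 => //; apply: chain_nil. Qed.

Lemma can_graph_cons e b s m s' T1 T2 : can (body e) s m T1 ->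
  can (Graph src tgt body (tgt e) b) m s' T2 ->
  can (Graph src tgt body (src e) b) s s' (T1 + T2 + 2).
Proof.
move=> [t1 le1 d1] [t2 le2 d2]; exists (t1 + t2 + 2); first by lia.
exact: chain_cons d1 d2.
Qed.

(** Adds an edge at the end of a run, for inductions on numbers, where the digit handled last is the
    least significant one. *)
Lemma can_graph_rcons e a s m s' T1 T2 :
  can (Graph src tgt body a (src e)) s m T1 -> can (body e) m s' T2 ->
  can (Graph src tgt body a (tgt e)) s s' (T1 + T2 + 2).
Proof.
move=> [t1 le1 d1] [t2 le2 d2]; exists (t1 + t2 + 2); first by lia.
elim: d1 d2 {le1 le2} => [s0 d2|e' s1 s2 s3 u1 u2 d _ IH /IH h].
  rewrite add0n -[t2 in t2 + 2]addn0; apply: chain_cons d2 _; exact: chain_nil.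
have -> : u1 + u2 + 2 + t2 + 2 = u1 + (u2 + t2 + 2) + 2 by lia.
exact: chain_cons d h.
Qed.

End Graphs.

(** All control structures are instances of [Graph]. Their overheads come from the 2 paid for each
    edge: 2 for a choice or an iteration, 4 for a composition. *)
Definition skip : prog J G :=
  @Graph J G unit void (fun _ => tt) (fun _ => tt) (of_void _) tt tt.
Definition fail : prog J G :=
  @Graph J G bool void (of_void _) (of_void _) (of_void _) false true.
Definition alt (I : finType) (f : I -> prog J G) : prog J G :=
  @Graph J G bool I (fun _ => false) (fun _ => true) f false true.
Definition star p : prog J G :=
  @Graph J G unit unit (fun _ => tt) (fun _ => tt) (fun _ => p) tt tt.
Definition seqp p1 p2 : prog J G :=
  @Graph J G (option bool) bool
    (fun e => if e then Some false else None) (fun e => Some e)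
    (fun e => if e then p2 else p1) None (Some true).

Lemma may_skip s s' : may skip s s' -> s' = s.
Proof. by case/may_graph_inv=> [[]|[[]]]. Qed.

Lemma can_skip s : can skip s s 0.
Proof. exact: can_graph_nil. Qed.

Lemma may_fail s s' : ~ may fail s s'.
Proof. by case/may_graph_inv=> [[]|[[]]]. Qed.

Lemma may_alt (I : finType) (f : I -> prog J G) s s' :
  may (alt f) s s' -> exists i, may (f i) s s'.
Proof.
case/may_graph_inv=> [[]//|[i [m [_ d]]]].
by case/may_graph_inv=> [[_ <-]|[? [? []]]] //; exists i.
Qed.

Lemma can_alt (I : finType) (f : I -> prog J G) i s s' T :
  can (f i) s s' T -> can (alt f) s s' (T + 2).
Proof.
move=> h; rewrite -(addn0 T).
apply: (@can_graph_cons bool I (fun _ => false) (fun _ => true) f i) h _.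
exact: can_graph_nil.
Qed.

Lemma may_seq p1 p2 s s' :
  may (seqp p1 p2) s s' -> exists2 m, may p1 s m & may p2 m s'.
Proof.
case/may_graph_inv=> [[]//|[[] [m []]]] // _ d1.
case/may_graph_inv=> [[]//|[[] [m' []]]] // _ d2.
case/may_graph_inv=> [[_ <-]|[[] [? []]]] //.
by exists m.
Qed.

Lemma can_seq p1 p2 s m s' T1 T2 : can p1 s m T1 -> can p2 m s' T2 ->
  can (seqp p1 p2) s s' (T1 + T2 + 4).
Proof.
move=> h1 h2.
have -> : T1 + T2 + 4 = T1 + (T2 + 0 + 2) + 2 by lia.
apply: (@can_graph_cons _ _ _ _ _ false) h1 _.
apply: (@can_graph_cons _ _ _ _ _ true) h2 _.
exact: can_graph_nil.
Qed.

Lemma may_star_ind (P : store J G -> Prop) p s s' :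
  (forall s1 s2, P s1 -> may p s1 s2 -> P s2) -> may (star p) s s' -> P s -> P s'.
Proof. by move=> H; apply: (may_graph_ind (P := fun _ => P)). Qed.

Lemma can_star_nil p s : can (star p) s s 0.
Proof. exact: can_graph_nil. Qed.

Lemma can_star_cons p s m s' T1 T2 : can p s m T1 -> can (star p) m s' T2 ->
  can (star p) s s' (T1 + T2 + 2).
Proof. exact: (@can_graph_cons _ _ _ _ _ tt). Qed.

Definition push j a : prog J G := Ins (j, inl a).
Definition pop j a : prog J G := Ins (j, inr (Some a)).
Definition empty j : prog J G := Ins (j, inr None).

Lemma may_push j a s s' : may (push j a) s s' -> s' = upd s j (a :: s j).
Proof. by case=> t []. Qed.

Lemma can_push j a s : can (push j a) s (upd s j (a :: s j)) 1.
Proof. by exists 1. Qed.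

Lemma may_pop j a s s' : may (pop j a) s s' ->
  exists2 w, s j = a :: w & s' = upd s j w.
Proof. by case=> t [[/=]]; case: (s j) => //= b w [->] -> _; exists w. Qed.

Lemma can_pop j a w s : s j = a :: w -> can (pop j a) s (upd s j w) 1.
Proof. by move=> e; exists 1 => //; split=> //=; rewrite e. Qed.

Lemma may_empty j s s' : may (empty j) s s' -> s j = [::] /\ s' = s.
Proof.
case=> t [[/=]]; case e: (s j) => //= _ -> _; split=> //.
exact: upd_self.
Qed.

Lemma can_empty j s : s j = [::] -> can (empty j) s s 1.
Proof. by move=> e; exists 1 => //; split=> //=; rewrite e upd_self. Qed.

Fixpoint pushes j w : prog J G :=
  if w is a :: w' then seqp (pushes j w') (push j a) else skip.

Lemma may_pushes j w s s' : may (pushes j w) s s' -> s' = upd s j (w ++ s j).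
Proof.
elim: w s s' => [|a w IH] s s' /=; first by move/may_skip->; rewrite upd_self.
by case/may_seq=> m /IH -> /may_push ->; rewrite upd_same upd_upd.
Qed.

Lemma can_pushes j w s : can (pushes j w) s (upd s j (w ++ s j)) (5 * size w).
Proof.
elim: w s => [|a w IH] s /=; first by rewrite upd_self //; apply: can_skip.
have := can_seq (IH s) (can_push j a _); rewrite upd_same upd_upd => h.
by apply: can_le h _; lia.
Qed.

Fixpoint pops j w : prog J G :=
  if w is a :: w' then seqp (pop j a) (pops j w') else skip.


Lemma may_pops j w s s' : may (pops j w) s s' ->
  exists2 v, s j = w ++ v & s' = upd s j v.
Proof.
elim: w s s' => [|a w IH] s s' /=.
  by move/may_skip->; exists (s j) => //; rewrite upd_self.
case/may_seq=> m /may_pop [u e ->] /IH [v]; rewrite upd_same upd_upd => eu ->.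
by exists v => //; rewrite e eu.
Qed.

Lemma can_pops j w v s : s j = w ++ v -> can (pops j w) s (upd s j v) (5 * size w).
Proof.
elim: w s => [|a w IH] s /= e; first by rewrite upd_self //; apply: can_skip.
have := can_seq (can_pop e) (IH _ (upd_same _ _ _)); rewrite upd_upd => h.
by apply: can_le h _; lia.
Qed.

(** Since the loop may stop anywhere, it guesses a position inside stack [i]; the symbols above that
    position arrive on [j] reversed. *)
Definition some_moves i j : prog J G :=
  star (alt (fun a => seqp (pop i a) (push j a))).
Definition move_all i j : prog J G := seqp (some_moves i j) (empty i).

Lemma may_some_moves i j s s' : i != j -> may (some_moves i j) s s' ->
  exists u v, s i = u ++ v /\ s' = upd (upd s i v) j (rev u ++ s j).
Proof.
move=> ne h; move: (ne); rewrite eq_sym => nE.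
apply: (may_star_ind (P := fun s' => exists u v,
  s i = u ++ v /\ s' = upd (upd s i v) j (rev u ++ s j))) h _; last first.
  by exists [::], (s i); split=> //; rewrite upd_self upd_self.
move=> s1 s2 [u [v [e ->]]] /may_alt [a] /may_seq [m] /may_pop [v'].
rewrite (upd_other _ _ ne) upd_same => ev -> /may_push ->.
exists (rcons u a), v'; split; first by rewrite cat_rcons -ev.
apply/ffunP=> x; rewrite !ffunE rev_rcons eqxx /= (negPf nE).
by case: eqP => // _; case: eqP.
Qed.

Lemma can_some_moves i j s u v : i != j -> s i = u ++ v ->
  can (some_moves i j) s (upd (upd s i v) j (rev u ++ s j)) (10 * size u).
Proof.
move=> ne; move: (ne); rewrite eq_sym => nE.
elim: u s => [|a u IH] s /= e.
  by rewrite !upd_self //; apply: can_star_nil.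
have h := can_alt (f := fun a => seqp (pop i a) (push j a))
  (can_seq (can_pop e) (can_push j a _)).
have := can_star_cons h (IH _ _).
rewrite (upd_other _ _ ne) upd_same => /(_ erefl).
rewrite upd_same (upd_other _ _ nE) => h'.
apply: (can_le (T := 1 + 1 + 4 + 2 + 10 * size u + 2)); last by lia.
move: h'; congr (can _ _ _ _).
apply/ffunP=> x; rewrite !ffunE rev_cons cat_rcons.
by case: eqP => // _; case: eqP.
Qed.

Lemma may_move_all i j s s' : i != j -> may (move_all i j) s s' ->
  s' = upd (upd s i [::]) j (rev (s i) ++ s j).
Proof.
move=> ne /may_seq [m] /(may_some_moves ne) [u [v [e ->]]] /may_empty[].
by rewrite (upd_other _ _ ne) upd_same => v0 ->; rewrite e v0 cats0.
Qed.

Lemma can_move_all i j s : i != j ->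
  can (move_all i j) s (upd (upd s i [::]) j (rev (s i) ++ s j)) (10 * size (s i) + 5).
Proof.
move=> ne; have e : s i = s i ++ [::] by rewrite cats0.
have e0 : upd (upd s i [::]) j (rev (s i) ++ s j) i = [::].
  by rewrite (upd_other _ _ ne) upd_same.
by apply: can_le (can_seq (can_some_moves ne e) (can_empty e0)) _; lia.
Qed.

Definition clear j : prog J G := seqp (star (alt (fun a => pop j a))) (empty j).

Lemma may_clear j s s' : may (clear j) s s' -> s' = upd s j [::].
Proof.
case/may_seq=> m h; suff [w ->] : exists w, m = upd s j w.
  by case/may_empty; rewrite upd_same => -> ->.
apply: (may_star_ind (P := fun m => exists w, m = upd s j w)) h _; last first.
  by exists (s j); rewrite upd_self.
by move=> s1 s2 [w ->] /may_alt [a] /may_pop [v _ ->]; exists v; rewrite upd_upd.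
Qed.

Lemma can_clear j s : can (clear j) s (upd s j [::]) (5 * size (s j) + 5).
Proof.
have h0 : can (empty j) (upd s j [::]) (upd s j [::]) 1.
  by apply: can_empty; rewrite upd_same.
suff h1 : can (star (alt (fun a => pop j a))) s (upd s j [::]) (5 * size (s j)).
  by apply: can_le (can_seq h1 h0) _; lia.
move e: (s j) => w; elim: w s e {h0} => [|a w IH] s e.
  by rewrite upd_self //; apply: can_star_nil.
have := can_star_cons (can_alt (f := fun a => pop j a) (can_pop e)) (IH _ (upd_same _ _ _)).
by rewrite upd_upd => h; apply: can_le h _; rewrite /=; lia.
Qed.

Fixpoint seqs (l : seq (prog J G)) : prog J G :=
  if l is p :: l' then seqp p (seqs l') else skip.

End Combinators.

Arguments skip {J G}.
Arguments fail {J G}.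
Arguments empty {J G} j.
Arguments some_moves {J G} i j.
Arguments move_all {J G} i j.
Arguments clear {J G} j.

(** * Simulation of a deterministic machine *)

Section Simulation.
Variables (X J G : finType) (M : turing_machine X).
Notation ntapes := (tm_tapes M).+2.
Let mcell : finType := option (X + tm_extra M).
Variables (cs : mcell -> G) (st : 'I_ntapes -> bool -> J)
  (own : J -> option ('I_ntapes * bool)).
Hypothesis cs_inj : injective cs.
Hypothesis own_st : forall i b, own (st i b) = Some (i, b).
Hypothesis st_own : forall j i b, own j = Some (i, b) -> j = st i b.

Implicit Types (s base : store J G) (ts : tapes M) (h : {ffun 'I_ntapes -> mcell}).

(* Stack [st i false] holds the cells left of the [i]-th head, [st i true] those
   right of it; the cells under the heads are part of the control. *)
Definition plug base ts : store J G :=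
  [ffun j => if own j is Some (i, b)
             then map cs (if b then tright (ts i) else tleft (ts i)) else base j].

Lemma eq_st j i b :
  (j == st i b) = if own j is Some (i', b') then (i' == i) && (b' == b) else false.
Proof.
apply/eqP/idP=> [->|]; first by rewrite own_st !eqxx.
by case o: (own j) => [[i' b']|] // /andP[/eqP <- /eqP <-]; apply: st_own.
Qed.

Lemma eq_plug base ts ts' :
  (forall i, tleft (ts i) = tleft (ts' i) /\ tright (ts i) = tright (ts' i)) ->
  plug base ts = plug base ts'.
Proof.
move=> e; apply/ffunP=> j; rewrite !ffunE; case: (own j) => // [[i b]].
by have [-> ->] := e i.
Qed.

(** The cell [x] is guessed in advance and verified here. Cells beyond the end of the stack are
    blank, so that [None] is found either as a stored blank or as the empty stack. *)
Definition popcell j (x : mcell) : prog J G :=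
  alt (fun b : bool => if b then pop j (cs x)
                       else if x == None then empty j else fail).

Lemma may_popcell j x s s' (w : seq mcell) : s j = map cs w ->
  may (popcell j x) s s' -> x = head None w /\ s' = upd s j (map cs (behead w)).
Proof.
move=> e /may_alt [[|]].
  by case/may_pop=> v; rewrite e; case: w e => //= c w _ [/cs_inj -> <-].
case: eqP => [->|_ /may_fail//] /may_empty []; rewrite e.
by case: w e => //= e _ ->; rewrite upd_self.
Qed.

Lemma can_popcell j s (w : seq mcell) : s j = map cs w ->
  can (popcell j (head None w)) s (upd s j (map cs (behead w))) 3.
Proof.
case: w => [|c w] e /=.
  by apply: (can_alt (i := false) (T := 1)); rewrite upd_self //; apply: can_empty.
by apply: (can_alt (i := true) (T := 1)); apply: can_pop.
Qed.

Definition tape_op i (cm : mcell * move) (x : mcell) : prog J G :=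
  match cm.2 with
  | Stay => if x == cm.1 then skip else fail
  | MoveLeft => seqp (push (st i true) (cs cm.1)) (popcell (st i false) x)
  | MoveRight => seqp (push (st i false) (cs cm.1)) (popcell (st i true) x)
  end.

Definition set_tape ts i t : tapes M := fun i' => if i' == i then t else ts i'.

Lemma plug_st base ts i b :
  plug base ts (st i b) = map cs (if b then tright (ts i) else tleft (ts i)).
Proof. by rewrite ffunE own_st. Qed.

Lemma plug_set base ts i (l r : seq mcell) (c : mcell) b :
  upd (upd (plug base ts) (st i b) (map cs (if b then r else l)))
      (st i (~~ b)) (map cs (if b then l else r)) =
  plug base (set_tape ts i (@Tape X M l c r)).
Proof.
apply/ffunP=> j; rewrite !ffunE !eq_st /set_tape.
case: (own j) => [[i' b']|] //.
by case: (i' == i); case: b; case: b'.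
Qed.

Lemma may_tape_op base ts i cm x s' : may (tape_op i cm x) (plug base ts) s' ->
  x = thead (tape_act (ts i) cm) /\
  s' = plug base (set_tape ts i (tape_act (ts i) cm)).
Proof.
case: cm => c []; rewrite /tape_op /=.
- case/may_seq=> m /may_push ->.
  case/(may_popcell (w := tleft (ts i))) => [|-> ->].
    by rewrite upd_other ?plug_st // eq_st own_st andbF.
  split=> //; rewrite plug_st -map_cons.
  exact: (plug_set _ _ _ _ _ _ true).
- case: eqP => [-> /may_skip ->|_ /may_fail//]; split=> //.
  by apply: eq_plug => i'; rewrite /set_tape; case: eqP => [->|].
- case/may_seq=> m /may_push ->.
  case/(may_popcell (w := tright (ts i))) => [|-> ->].
    by rewrite upd_other ?plug_st // eq_st own_st andbF.
  split=> //; rewrite plug_st -map_cons.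
  exact: (plug_set _ _ _ _ _ _ false).
Qed.

Lemma can_tape_op base ts i cm :
  can (tape_op i cm (thead (tape_act (ts i) cm))) (plug base ts)
      (plug base (set_tape ts i (tape_act (ts i) cm))) 8.
Proof.
case: cm => c []; rewrite /tape_op /=.
- apply: (can_seq (T1 := 1) (T2 := 3)); first exact: can_push.
  rewrite plug_st -map_cons -(plug_set _ _ _ _ _ _ true) /=.
  apply: can_popcell.
  by rewrite upd_other ?plug_st // eq_st own_st andbF.
- rewrite eqxx; apply: (can_le (T := 0)) => //.
  rewrite -(@eq_plug base ts); first exact: can_skip.
  by move=> i'; rewrite /set_tape; case: eqP => [->|].
- apply: (can_seq (T1 := 1) (T2 := 3)); first exact: can_push.
  rewrite plug_st -map_cons -(plug_set _ _ _ _ _ _ false) /=.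
  apply: can_popcell.
  by rewrite upd_other ?plug_st // eq_st own_st andbF.
Qed.

Definition tape_ops (l : seq 'I_ntapes) (act : 'I_ntapes -> mcell * move) h :=
  seqs [seq tape_op i (act i) (h i) | i <- l].

Lemma may_tape_ops l act h base ts s' : uniq l ->
  may (tape_ops l act h) (plug base ts) s' ->
  {in l, forall i, h i = thead (tape_act (ts i) (act i))} /\
  s' = plug base (fun i => if i \in l then tape_act (ts i) (act i) else ts i).
Proof.
elim: l ts => [|i l IH] ts /=; first by move=> _ /may_skip ->.
case/andP=> ni ul /may_seq [m] /may_tape_op [e ->] /(IH _ ul) [e' ->]; split.
  move=> i'; rewrite inE => /orP [/eqP -> //|il]; rewrite e' // /set_tape.
  by case: eqP il => // ->; rewrite (negPf ni).
apply: eq_plug => i'; rewrite inE /set_tape.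
by case: eqP => [->|]; rewrite ?(negPf ni).
Qed.

Lemma can_tape_ops l act h base ts : uniq l ->
  {in l, forall i, h i = thead (tape_act (ts i) (act i))} ->
  can (tape_ops l act h) (plug base ts)
    (plug base (fun i => if i \in l then tape_act (ts i) (act i) else ts i))
    (12 * size l).
Proof.
elim: l ts => [|i l IH] ts /=; first by move=> _ _; apply: can_skip.
case/andP=> ni ul hE.
have h1 := can_tape_op base ts i (act i).
have {}IH := IH (set_tape ts i (tape_act (ts i) (act i))) ul.
rewrite -[X in can _ _ X](@eq_plug base (fun i0 => if i0 \in l
   then tape_act (set_tape ts i (tape_act (ts i) (act i)) i0) (act i0)
   else set_tape ts i (tape_act (ts i) (act i)) i0)); last first.
  move=> i'; rewrite inE /set_tape.
  by case: eqP => [->|]; rewrite ?(negPf ni).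
rewrite /tape_ops /= hE ?mem_head //; apply: can_le (can_seq h1 (IH _)) _; last by rewrite mulnS [8 + _]addnC -addnA addnC.
move=> i' il; rewrite hE ?inE ?il ?orbT // /set_tape.
by case: eqP il => // ->; rewrite (negPf ni).
Qed.

(** * Running the machine on the current configuration with a prescribed answer *)

Section Answer.
Variable b : bool.

Let ctrl : finType := (tm_state M * {ffun 'I_ntapes -> mcell})%type.
(** Besides the control state an edge carries the guessed symbols under the heads after the step;
    [None] marks the edge taken on halting. *)
Let edge : finType := (ctrl * option {ffun 'I_ntapes -> mcell})%type.

Definition sim_tgt (e : edge) : option ctrl :=
  if e.2 is Some h' then
    if tm_trans e.1.1 e.1.2 is Some (q', _) then Some (q', h') else None
  else None.

Definition sim_body (e : edge) : prog J G :=
  if e.2 is Some h' then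
    if tm_trans e.1.1 e.1.2 is Some (_, act)
    then tape_ops (enum 'I_ntapes) act h' else fail
  else if tm_trans e.1.1 e.1.2 is None
    then if tm_accept e.1.1 == b then skip else fail
  else fail.

(* Runs [M] from the control state [c]; succeeds if it halts with answer [b]. *)
Definition sim (c : ctrl) : prog J G :=
  Graph (fun e : edge => Some e.1) sim_tgt sim_body (Some c) None.

Definition heads ts : {ffun 'I_ntapes -> mcell} := [ffun i => thead (ts i)].

(** By determinism the simulation can only follow the given halting run: along the path, the current
    control state and tapes still lead to the answer [v], which is compared with [b] on halting. *)
Lemma may_sim base q ts s' fuel v : may (sim (q, heads ts)) (plug base ts) s' ->
  tm_run fuel q ts = Some v -> v = b /\ exists ts', s' = plug base ts'.
Proof.
move=> h run.
pose P (c : option ctrl) s := exists ts', s = plug base ts' /\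
  (if c is Some (q', h') then h' = heads ts' /\
     exists fuel', tm_run fuel' q' ts' = Some v else v = b).
suff [ts' [-> e]] : P None s' by split=> //; exists ts'.
apply: (may_graph_ind (P := P)) h _; last by exists ts; split=> //; split=> //; exists fuel.
move=> [[q1 h1] o] s1 s2 [ts1 [-> [-> [f1 run1]]]] /=.
rewrite /sim_body /sim_tgt /=.
case: o => [h2|]; case Et: (tm_trans q1 (heads ts1)) => [[q' act]|]; try by move/may_fail.
  case/may_tape_ops=> [|hE ->]; first exact: enum_uniq.
  exists (fun i => tape_act (ts1 i) (act i)); split.
    by apply: eq_plug => i; rewrite mem_enum.
  split; first by apply/ffunP=> i; rewrite hE ?mem_enum // ffunE.
  move: run1; case: f1 => [|f1] /=; rewrite /tm_step -/(heads ts1) Et //.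
  by exists f1.
case: eqP => [eb /may_skip -> |_ /may_fail //]; exists ts1; split=> //.
by move: run1; case: f1 => [|f1] /=; rewrite /tm_step -/(heads ts1) Et eb => -[].
Qed.

(** A step costs 12 for each tape and 2 for the edge. It lengthens each half of a tape by at most
    one cell, which later bounds the cost of erasing the tapes. *)
Lemma can_sim base q ts fuel : tm_run fuel q ts = Some b ->
  exists2 ts', can (sim (q, heads ts)) (plug base ts) (plug base ts')
      ((12 * ntapes + 2) * fuel.+1)
    & forall i, size (tleft (ts' i)) <= size (tleft (ts i)) + fuel /\
                size (tright (ts' i)) <= size (tright (ts i)) + fuel.
Proof.
elim: fuel q ts => [|fuel IH] q ts /=; rewrite /tm_step -/(heads ts);
  case Et: (tm_trans q (heads ts)) => [[q' act]|] //; last 1 first.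
- case=> eb; exists ts; last by move=> i; split; lia.
  apply: (can_le (T := 0 + 0 + 2)); last by lia.
  apply: (@can_graph_cons _ _ _ _ _ _ _ ((q, heads ts), None)); last exact: can_graph_nil.
  by rewrite /sim_body /= Et eb eqxx; apply: can_skip.
- case=> eb; exists ts; last by move=> i; split; lia.
  apply: (can_le (T := 0 + 0 + 2)); last by lia.
  apply: (@can_graph_cons _ _ _ _ _ _ _ ((q, heads ts), None)); last exact: can_graph_nil.
  by rewrite /sim_body /= Et eb eqxx; apply: can_skip.
move=> /IH [ts' c' sz]; exists ts'; last first.
  move=> i; have [/leq_trans szl /leq_trans szr] := sz i.
  have {sz} : size (tleft (tape_act (ts i) (act i))) <= (size (tleft (ts i))).+1 /\
         size (tright (tape_act (ts i) (act i))) <= (size (tright (ts i))).+1.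
    by case: (act i) => c [] /=; rewrite ?size_behead; split; lia.
  by case=> szl' szr'; split; [apply: szl|apply: szr]; lia.
pose ts1 : tapes M := fun i => tape_act (ts i) (act i).
apply: (can_le (T := 12 * ntapes + (12 * ntapes + 2) * fuel.+1 + 2)); last by lia.
apply: (@can_graph_cons _ _ _ _ _ _ _ ((q, heads ts), Some (heads ts1)) _ _ (plug base ts1)).
  rewrite /sim_body /= Et -[in 12 * ntapes](size_enum_ord ntapes).
  rewrite (@eq_plug base ts1 (fun i => if i \in enum 'I_ntapes then tape_act (ts i) (act i) else ts i)).
    by apply: can_tape_ops => [|i _]; rewrite ?enum_uniq // ffunE.
  by move=> i; rewrite mem_enum.
by rewrite /sim_tgt /= Et.
Qed.

Definition clean (l : seq ('I_ntapes * bool)) : prog J G :=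
  seqs [seq clear (st p.1 p.2) | p <- l].

Lemma may_clean l s s' : may (clean l) s s' ->
  s' = [ffun j => if own j is Some p then if p \in l then [::] else s j else s j].
Proof.
elim: l s => [|[i c] l IH] s /=.
  by move/may_skip->; apply/ffunP=> j; rewrite ffunE; case: (own j).
case/may_seq=> m /may_clear -> /IH ->; apply/ffunP=> j; rewrite !ffunE eq_st.
by case: (own j) => // [[i' c']]; rewrite inE xpair_eqE; case: andP => //= _; case: (_ \in _).
Qed.

Lemma can_clean l s n : (forall i c, size (s (st i c)) <= n) ->
  can (clean l) s
    [ffun j => if own j is Some p then if p \in l then [::] else s j else s j]
    ((5 * n + 9) * size l).
Proof.
elim: l s => [|[i c] l IH] s le /=.
  set s1 := finfun _; have -> : s1 = s.
    by apply/ffunP=> j; rewrite ffunE; case: (own j).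
  by apply: can_le (can_skip _) _.
have h1 := can_clear (st i c) s.
have {IH} h2 := IH (upd s (st i c) [::]).
set s1 := finfun _; set s2 := finfun _ in h2.
have -> : s1 = s2.
  apply/ffunP=> j; rewrite !ffunE eq_st.
  by case: (own j) => // [[i' c']]; rewrite inE xpair_eqE; case: andP => //= _; case: (_ \in _).
apply: can_le (can_seq h1 (h2 _)) _; last by have := le i c; lia.
by move=> i' c'; rewrite ffunE; case: eqP.
Qed.

Variables (I : finType) (gi : I -> G) (enc : I -> seq X) (jC jD : J) (H : nat).
Hypothesis gi_inj : injective gi.
Hypothesis ownC : own jC = None.
Hypothesis ownD : own jD = None.
Hypothesis neCD : jC != jD.
Hypothesis encH : forall a, size (enc a) <= H.

Let jR := st ord0 true.
Let icell (x : X) : G := cs (Some (inl x)).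
Let encode u : seq X := flatten (map enc u).

Let neRC : jR != jC. Proof. by rewrite eq_sym eq_st ownC. Qed.
Let neRD : jR != jD. Proof. by rewrite eq_sym eq_st ownD. Qed.

Definition feed_loop : prog J G :=
  star (alt (fun a : I => seqp (pop jD (gi a))
         (seqp (push jC (gi a)) (pushes jR (map icell (enc a)))))).

(** Passing through [jD] and back restores the configuration on [jC]. The symbols come back from the
    last to the first, so pushing their encodings leaves the input word on [jR] in reading order. *)
Definition feed : prog J G :=
  seqp (move_all jC jD) (seqp feed_loop (empty jD)).

(** [u1] still waits on [jD], while [u2] is already restored and encoded. *)
Let feeding base u1 u2 : store J G :=
  upd (upd (upd base jD (rev (map gi u1))) jC (map gi u2)) jR
      (map icell (encode u2)).

Lemma feedingD base u1 u2 : feeding base u1 u2 jD = rev (map gi u1).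
Proof.
by rewrite /feeding upd_other 1?eq_sym // upd_other 1?eq_sym // upd_same.
Qed.

Let feeding_step base u1 a u2 :
  let s1 := upd (feeding base (rcons u1 a) u2) jD (rev (map gi u1)) in
  let s2 := upd s1 jC (gi a :: s1 jC) in
  upd s2 jR (map icell (enc a) ++ s2 jR) = feeding base u1 (a :: u2).
Proof.
apply/ffunP=> j; rewrite !ffunE !eqxx.
rewrite (negPf neRC) (negPf neRD) (negPf neCD) [jC == jR]eq_sym (negPf neRC).
case: eqP => [_|_]; first by rewrite /encode /= map_cat.
by case: eqP => // _; case: eqP.
Qed.

Let feeding_end base u : base jC = map gi u -> base jD = [::] ->
  feeding base [::] u = upd base jR (map icell (encode u)).
Proof. by move=> eC eD; rewrite /feeding [upd base jD _]upd_self // [upd base jC _]upd_self. Qed.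

Lemma may_feed base u s' : base jC = map gi u -> base jD = [::] ->
  base jR = [::] -> may feed base s' ->
  s' = upd base jR (map icell (encode u)).
Proof.
move=> eC eD eR /may_seq [m] /(may_move_all neCD) -> /may_seq [m'] h.
rewrite eC eD cats0 in h.
have : exists u1 u2, u = u1 ++ u2 /\ m' = feeding base u1 u2.
  apply: (may_star_ind (P := fun m' => exists u1 u2,
    u = u1 ++ u2 /\ m' = feeding base u1 u2)) h _; last first.
    exists u, [::]; split; first by rewrite cats0.
    rewrite /feeding /= upd_comm // [upd _ jR _]upd_self //.
    by rewrite upd_other // upd_other.
  move=> s1 s2 [u1 [u2 [e ->]]] /may_alt [a] /may_seq [m1] /may_pop [w].
  rewrite feedingD; case/lastP: u1 e => [//|u1 a'] e.
  rewrite map_rcons rev_rcons => -[/gi_inj ea <-] ->; subst a'.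
  case/may_seq=> m2 /may_push -> /may_pushes ->.
  by exists u1, (a :: u2); split; rewrite ?feeding_step // -cat_rcons.
case=> u1 [u2 [e ->]] /may_empty []; rewrite feedingD => e1 ->.
have u10 : u1 = [::] by case/lastP: u1 e1 {e} => // u1 a; rewrite map_rcons rev_rcons.
by rewrite u10 -(@feeding_end _ u) // e u10.
Qed.

Lemma can_feed base u : base jC = map gi u -> base jD = [::] ->
  base jR = [::] ->
  can feed base (upd base jR (map icell (encode u))) ((5 * H + 30) * (size u).+1).
Proof.
move=> eC eD eR; have h1 := can_move_all base neCD.
rewrite eC eD cats0 size_map in h1.
have h2 u1 u2 : can feed_loop (feeding base u1 u2) (feeding base [::] (u1 ++ u2))
    ((5 * H + 14) * size u1).
  elim/last_ind: u1 u2 => [|u1 a IH] u2; first by apply: can_le (can_star_nil _ _) _.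
  have hp : can (pop jD (gi a)) (feeding base (rcons u1 a) u2)
      (upd (feeding base (rcons u1 a) u2) jD (rev (map gi u1))) 1.
    by apply: can_pop; rewrite feedingD map_rcons rev_rcons.
  have hh := can_seq hp (can_seq (can_push jC (gi a) _) (can_pushes jR (map icell (enc a)) _)).
  rewrite feeding_step in hh.
  rewrite cat_rcons size_rcons size_map in hh *.
  have := can_star_cons (can_alt (f := fun a : I => seqp (pop jD (gi a))
         (seqp (push jC (gi a)) (pushes jR (map icell (enc a))))) hh) (IH (a :: u2)).
  by move=> h; apply: can_le h _; have := encH a; lia.
have h3 : can (empty jD) (feeding base [::] u) (feeding base [::] u) 1.
  by apply: can_empty; rewrite feedingD.
have e1 : upd (upd base jC [::]) jD (rev (map gi u)) = feeding base u [::].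
  rewrite /feeding /= upd_comm // [upd _ jR _]upd_self //.
  by rewrite upd_other // upd_other.
have e2 : feeding base [::] u = upd base jR (map icell (encode u)).
  exact: feeding_end.
rewrite e1 in h1; have {}h2 := h2 u [::]; rewrite cats0 in h2.
rewrite -e2; apply: can_le (can_seq h1 (can_seq h2 h3)) _; lia.
Qed.

Definition start_heads (x : mcell) : {ffun 'I_ntapes -> mcell} :=
  [ffun i => if i == ord0 then x else None].

(** The first letter is popped after feeding because the cells under the heads live in the
    control. *)
Definition run_machine : prog J G :=
  seqp feed (seqp
    (alt (fun x => seqp (popcell jR x) (sim (tm_start M, start_heads x))))
    (clean (enum {: 'I_ntapes * bool}))).

Let start_tapes (w : seq X) : tapes M :=
  fun i => tape_of_word (nth [::] [:: input_word M w] i).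

Let start_tapesE base w (c : seq mcell) : c = map Some (input_word M w) ->
  (forall i b, base (st i b) = [::]) ->
  upd base jR (map cs (behead c)) = plug base (start_tapes w) /\
  start_heads (head None c) = heads (start_tapes w).
Proof.
move=> -> empt; split.
  apply/ffunP=> j; rewrite !ffunE eq_st /start_tapes.
  case o: (own j) => [[i b']|] //=.
  rewrite (st_own o) empt.
  case: eqP => [->|/eqP ni] /=.
    by rewrite /input_word; case: w; case: (b').
  rewrite nth_default; first by case: (b').
  by case: i ni {o} => [[|i] ?].
apply/ffunP=> i; rewrite !ffunE /start_tapes.
case: eqP => [->|/eqP ni]; first by rewrite /input_word; case: w.
by rewrite nth_default //; case: i ni => [[|i] ?].
Qed.

Let clean_plug base ts : (forall i b, base (st i b) = [::]) ->
  [ffun j => if own j is Some p then if p \in enum {: 'I_ntapes * bool} then [::]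
             else plug base ts j else plug base ts j] = base.
Proof.
move=> empt; apply/ffunP=> j; rewrite !ffunE.
by case o: (own j) => [[i b']|] //; rewrite mem_enum (st_own o) empt.
Qed.

(** As the tapes are erased at the end, a run of the machine is a mere test: it gives back the store
    [base]. *)
Lemma may_run_machine base u s' fuel v : base jC = map gi u -> base jD = [::] ->
  (forall i b, base (st i b) = [::]) ->
  tm_answer fuel [:: input_word M (encode u)] = Some v ->
  may run_machine base s' -> s' = base /\ v = b.
Proof.
move=> eC eD empt ans /may_seq [m] /(may_feed eC eD (empt _ _)) ->.
case/may_seq=> m' /may_alt [x] /may_seq [m1].
have [e1 e2] := start_tapesE (w := encode u) erefl empt.
case/(may_popcell (w := map Some (input_word M (encode u)))).
  by rewrite upd_same -map_comp -map_comp; apply: eq_map.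
move=> -> ->; rewrite e2 upd_upd e1 => /may_sim /(_ ans) [-> [ts' ->]] /may_clean ->.
by rewrite clean_plug.
Qed.

Let run_cost a b' e f n :
  a * n.+1 + (3 + b' * f.+1 + 4 + 2 + (5 * (H * n + f) + 9) * e + 4) + 4
  <= (a + b' + (5 * H + 9) * e + 20) * (f + n).+1.
Proof.
have h1 : a * n.+1 <= a * (f + n).+1 by rewrite leq_mul2l; lia.
have h2 : b' * f.+1 <= b' * (f + n).+1 by rewrite leq_mul2l; lia.
have h3 : (5 * (H * n + f) + 9) * e <= (5 * H + 9) * e * (f + n).+1.
  by rewrite mulnAC leq_mul2r; apply/orP; right; lia.
rewrite !mulnDl; lia.
Qed.

Lemma can_run_machine : exists K, forall base u fuel,
  base jC = map gi u -> base jD = [::] -> (forall i b, base (st i b) = [::]) ->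
  tm_answer fuel [:: input_word M (encode u)] = Some b ->
  can run_machine base base (K * (fuel + size u).+1).
Proof.
(* The summands pay for feeding, for the simulated steps, for erasing the tape halves, whose length
   is at most [H * size u + fuel], and for the first pop and the compositions. *)
exists ((5 * H + 30) + (12 * ntapes + 2) + (5 * H + 9) * size (enum {: 'I_ntapes * bool}) + 20).
move=> base u fuel eC eD empt ans.
have h1 := can_feed eC eD (empt _ _).
have [e1 e2] := start_tapesE (w := encode u) erefl empt.
have h2 : can (popcell jR (head None (map Some (input_word M (encode u)))))
    (upd base jR (map icell (encode u))) (plug base (start_tapes (encode u))) 3.
  rewrite -e1 -[X in can _ _ X](upd_upd base jR (map icell (encode u))); apply: can_popcell.
  by rewrite upd_same -map_comp -map_comp; apply: eq_map.
have [ts' h3 sz] := can_sim base ans; rewrite -e2 in h3.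
have h4 := can_alt (f := fun x => seqp (popcell jR x) (sim (tm_start M, start_heads x))) (can_seq h2 h3).
have szE : size (encode u) <= H * size u.
  rewrite /encode; elim: (u) => //= a u' IH.
  by rewrite size_cat mulnS; apply: leq_add (encH a) IH.
have h5 := @can_clean (enum {: 'I_ntapes * bool}) (plug base ts') (H * size u + fuel).
rewrite clean_plug // in h5.
apply: can_le (can_seq h1 (can_seq h4 (h5 _))) _; last exact: run_cost.
move=> i c; rewrite plug_st size_map.
have [sl sr] := sz i.
have wsz (w : seq (tm_symbol M)) : size (tleft (tape_of_word w)) = 0 /\ size (tright (tape_of_word w)) <= size w.
  by case: w => //= a w; rewrite size_map; lia.
have [l0 r0] := wsz (nth [::] [:: input_word M (encode u)] i).
have : size (nth [::] [:: input_word M (encode u)] i) <= size (encode u).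
  case: (nat_of_ord i) => [|i'] /=; first by rewrite size_map.
  by rewrite nth_nil.
move=> szn; case: c.
  apply: leq_trans sr _; rewrite leq_add2r.
  exact: leq_trans r0 (leq_trans szn szE).
apply: leq_trans sl _; rewrite leq_add2r.
by have -> : size _ = 0 := l0.
Qed.

End Answer.
End Simulation.

(** * Binary numbers in registers *)

(** The exceptional case is a zero digit in front of the number zero, which is not written. *)
Lemma nat_bits_step v (b : bool) :
  nat_bits (2 * v + b) = if (0 < v) || b then b :: nat_bits v else [::].
Proof.
case: v => [|v]; first by case: b.
set p := pos_of_nat v v.
have vE : nat_of_pos p = v.+1 by have := bin_of_natK v.+1.
have -> : nat_bits (2 * v.+1 + b) = pos_bits (if b then BinNums.xI p else BinNums.xO p).
  rewrite /nat_bits; suff -> : bin_of_nat (2 * v.+1 + b) =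
    BinNums.Npos (if b then BinNums.xI p else BinNums.xO p) by [].
  rewrite -[RHS]nat_of_binK; congr bin_of_nat.
  by case: b => /=; rewrite vE NatTrec.doubleE; lia.
by case: b.
Qed.

Lemma nat_bits_gt0 v : 0 < v -> nat_bits v = odd v :: nat_bits v./2.
Proof.
move=> v0; have := nat_bits_step v./2 (odd v).
rewrite mul2n addnC odd_double_half => ->.
by case: ifP => //; case: v v0 => [|[|v]].
Qed.

Definition bits_val : seq bool -> nat := foldr (fun (b : bool) v => 2 * v + b) 0.

Lemma nat_bitsK : cancel nat_bits bits_val.
Proof.
move=> v; elim/ltn_ind: v => -[//|v] IH.
rewrite nat_bits_gt0 //= IH; last by lia.
by rewrite mul2n addnC -[RHS](odd_double_half v.+1).
Qed.

Lemma size_nat_bits_half v : size (nat_bits v./2) = (size (nat_bits v)).-1.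
Proof. by case: v => // v; rewrite [in RHS]nat_bits_gt0. Qed.

Lemma size_nat_bitsS v : size (nat_bits v.+1) <= (size (nat_bits v)).+1.
Proof.
elim/ltn_ind: v => -[//|v] IH.
rewrite nat_bits_gt0 // [in leqRHS]nat_bits_gt0 //= !ltnS.
case o: (odd v).
  have -> : v./2.+1 = uphalf v by rewrite uphalf_half o.
  exact: leqnSn.
rewrite uphalf_half o add0n; apply: IH; lia.
Qed.

(** Crude, but it is applied only to numbers [c] bounded independently of the input. *)
Lemma size_nat_bitsD v c : size (nat_bits (v + c)) <= size (nat_bits v) + c.
Proof.
elim: c => [|c IH]; first by rewrite !addn0.
by rewrite !addnS; apply: leq_trans (size_nat_bitsS _) _; rewrite ltnS.
Qed.

Section Registers.
Variables (J G V : finType) (gb : bool -> G) (r : V -> J) (rown : J -> option V).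
Hypothesis rown_r : forall w, rown (r w) = Some w.
Hypothesis r_rown : forall j w, rown j = Some w -> j = r w.

Implicit Types (s base : store J G) (val : V -> nat) (col : {ffun V -> bool}).

Definition regs base val : store J G :=
  [ffun j => if rown j is Some w then map gb (nat_bits (val w)) else base j].

Definition set_val val w v : V -> nat := fun w' => if w' == w then v else val w'.

Lemma eq_r j w : (j == r w) = (rown j == Some w).
Proof. by apply/eqP/eqP=> [->|/r_rown]. Qed.

Lemma eq_regs base val val' : val =1 val' -> regs base val = regs base val'.
Proof.
by move=> e; apply/ffunP=> j; rewrite !ffunE; case: (rown j) => // w; rewrite e.
Qed.

Lemma regs_r base val w : regs base val (r w) = map gb (nat_bits (val w)).
Proof. by rewrite ffunE rown_r. Qed.

Lemma regs_set base val w v :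
  upd (regs base val) (r w) (map gb (nat_bits v)) = regs base (set_val val w v).
Proof.
apply/ffunP=> j; rewrite !ffunE eq_r /set_val.
by case: (rown j) => // w'; rewrite -[Some _ == _]/(w' == w); case: eqP.
Qed.

Definition shift_in val col : V -> nat := fun w => 2 * val w + col w.

(** A register has its least significant digit on top, so pushing a digit doubles the number and
    adds that digit. Leading zeros must not be written, whence the test [nz] that the register is
    nonzero, which the control has to supply. *)
Definition push_bits (l : seq V) (nz : pred V) col : prog J G :=
  seqs [seq if nz w || col w then push (r w) (gb (col w)) else skip | w <- l].

Lemma push_bit base val w (b : bool) :
  (if (0 < val w) || b
   then upd (regs base val) (r w) (gb b :: regs base val (r w))
   else regs base val) = regs base (set_val val w (2 * val w + b)).
Proof.
have := regs_set base val w (2 * val w + b); rewrite nat_bits_step.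
case: ifP => [_ <- //=|e]; first by rewrite regs_r.
move: e; case: b => //; rewrite ?orbT ?orbF //.
by case e: (val w) => // _ <-; rewrite upd_self // regs_r e.
Qed.

Lemma may_push_bits l nz col base val s' : uniq l ->
  {in l, forall w, nz w = (0 < val w)} ->
  may (push_bits l nz col) (regs base val) s' ->
  s' = regs base (fun w => if w \in l then shift_in val col w else val w).
Proof.
elim: l val => [|w l IH] val /=; first by move=> _ _ /may_skip ->.
case/andP=> nw ul nzE /may_seq [m] h.
have {h} -> : m = regs base (set_val val w (2 * val w + col w)).
  rewrite -push_bit -nzE ?mem_head //; case: ifP h => _; first by move/may_push.
  by move/may_skip.
move=> h; rewrite (IH _ ul _ h) => [|w' wl]; last first.
  rewrite /set_val; case: eqP wl => [->|_ wl]; first by rewrite (negPf nw).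
  by apply: nzE; rewrite inE wl orbT.
apply: eq_regs => w'; rewrite inE /set_val /shift_in.
by case: eqP => [->|] //=; rewrite (negPf nw).
Qed.

Lemma can_push_bits l nz col base val : uniq l ->
  {in l, forall w, nz w = (0 < val w)} ->
  can (push_bits l nz col) (regs base val)
    (regs base (fun w => if w \in l then shift_in val col w else val w))
    (5 * size l).
Proof.
elim: l val => [|w l IH] val /=; first by move=> _ _; apply: can_skip.
case/andP=> nw ul nzE.
have h : can (if nz w || col w then push (r w) (gb (col w)) else skip)
  (regs base val) (regs base (set_val val w (2 * val w + col w))) 1.
  rewrite -push_bit -nzE ?mem_head //; case: ifP => _; first exact: can_push.
  exact: can_le (can_skip _) _.
have {IH} h' := IH (set_val val w (2 * val w + col w)) ul.
have -> : regs base (fun w0 => if w0 \in w :: l then shift_in val col w0 else val w0) =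
  regs base (fun w0 => if w0 \in l then shift_in (set_val val w (2 * val w + col w)) col w0
       else set_val val w (2 * val w + col w) w0).
  apply: eq_regs => w'; rewrite inE /set_val /shift_in.
  by case: eqP => [->|] //=; rewrite (negPf nw).
apply: can_le (can_seq h (h' _)) _; last by rewrite mulnS [1 + _]addnC -addnA addnC.
move=> w' wl; rewrite /set_val; case: eqP wl => [->|_ wl]; first by rewrite (negPf nw).
by apply: nzE; rewrite inE wl orbT.
Qed.

(** * Guessing numbers with prescribed truncated differences *)

Section Guess.
Variable B : nat.
Hypothesis B_gt0 : 0 < B.

Let vx val (o : option V) := if o is Some w then val w else 0.
Let diff : finType := {ffun option V * option V -> 'I_B.+1}.

(* Differences truncated at [B] in both directions; [None] stands for zero. *)
Definition diffs val : diff :=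
  [ffun p => inord (minn B (vx val p.1 - vx val p.2))].

Definition next_diffs (d : diff) col : diff :=
  let cx o := if o is Some w then nat_of_bool (col w) else 0 in
  [ffun p => if 0 < d (p.2, p.1) then ord0
             else inord (minn B (2 * d p + cx p.1 - cx p.2))].

Lemma diffsE val o o' : diffs val (o, o') = minn B (vx val o - vx val o') :> nat.
Proof. by rewrite ffunE inordK // ltnS geq_minl. Qed.

(** Appending a digit doubles a difference and changes it by at most one. A saturated difference
    stays saturated because [2 * B - 1] is at least [B], and if the opposite difference is positive
    it remains so, since 2 minus 1 is still positive; then the truncated difference is 0. *)
Lemma diffs_shift_in val col : diffs (shift_in val col) = next_diffs (diffs val) col.
Proof.
have nextE (d : diff) o o' : next_diffs d col (o, o') =
    minn B (if 0 < d (o', o) then 0 else 2 * d (o, o') +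
      (if o is Some w then nat_of_bool (col w) else 0) -
      (if o' is Some w then nat_of_bool (col w) else 0)) :> nat.
  by rewrite ffunE /=; case: ifP; rewrite ?minn0 // inordK // ltnS geq_minl.
apply/ffunP=> -[o o']; apply: val_inj; rewrite /= nextE !diffsE.
have cE (o1 : option V) : vx (shift_in val col) o1 =
    2 * vx val o1 + (if o1 is Some w then nat_of_bool (col w) else 0).
  by case: o1.
rewrite !cE.
have c1 (o1 : option V) : (if o1 is Some w then nat_of_bool (col w) else 0) <= 1.
  by case: o1 => // w; case: (col w).
move: (c1 o) (c1 o'); move: (if o is Some w then _ else _) (if o' is Some w then _ else _).
move: (vx val o) (vx val o') => v v' c c' hc hc'.
case: ifP => e; lia.
Qed.

Variable Phi : (V -> nat) -> Prop.
Hypothesis Phi_diffs : forall val val', diffs val = diffs val' -> Phi val -> Phi val'.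

Definition guess_tgt (e : diff * option {ffun V -> bool}) : option diff :=
  if e.2 is Some col then Some (next_diffs e.1 col) else None.

(** [Phi] matters only through the finite set of difference tables that it allows. This set is wired
    into the control by a classical truth value, so no algorithm deciding [Phi] is called for. *)
Definition guess_body (e : diff * option {ffun V -> bool}) : prog J G :=
  if e.2 is Some col
  then push_bits (enum V) (fun w => 0 < e.1 (Some w, None)) col
  else if `[< exists2 val, diffs val = e.1 & Phi val >] then skip else fail.

(* Writes numbers satisfying [Phi] into the registers, most significant digits
   first, so that the truncated differences can be maintained by the control. *)
Definition guess : prog J G :=
  Graph (fun e : diff * option {ffun V -> bool} => Some e.1) guess_tgt guess_body
    (Some (diffs (fun _ => 0))) None.

(** The difference with [None] tells the control whether a register is nonzero; as [B] is positive,
    truncation does not hide this. *)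
Let nzE val : {in enum V, forall w,
  (0 < diffs val (Some w, None)) = (0 < val w)}.
Proof. by move=> w _; rewrite diffsE /=; lia. Qed.

Lemma may_guess base s' : may guess (regs base (fun _ => 0)) s' ->
  exists2 val, Phi val & s' = regs base val.
Proof.
pose P (c : option diff) s := exists2 val, s = regs base val &
  if c is Some d then d = diffs val else Phi val.
move=> h; suff [val -> ?] : P None s' by exists val.
apply: (may_graph_ind (P := P)) h _; last by exists (fun _ => 0).
move=> [d [col|]] s1 s2 [val -> /= e]; subst d; rewrite /guess_body /=.
  move/(may_push_bits (enum_uniq V) (@nzE val)) => ->.
  exists (shift_in val col); last by rewrite diffs_shift_in.
  by apply: eq_regs => w; rewrite mem_enum.
case: ifP => [/asboolP [val' e Ph] /may_skip ->|_ /may_fail //].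
by exists val => //; apply: Phi_diffs Ph.
Qed.

(** The registers are filled in parallel, one column of digits at a time, so [n] is the length of
    the longest number; shorter ones are padded with leading zeros, which leave no trace on the
    stacks. *)
Lemma can_guess base val n : Phi val -> (forall w, size (nat_bits (val w)) <= n) ->
  can guess (regs base (fun _ => 0)) (regs base val) ((5 * #|V| + 2) * n.+1).
Proof.
move=> Ph le.
suff h : can (Graph (fun e : diff * option {ffun V -> bool} => Some e.1) guess_tgt guess_body
    (Some (diffs (fun _ => 0))) (Some (diffs val))) (regs base (fun _ => 0)) (regs base val)
    ((5 * #|V| + 2) * n).
  have hb : can (guess_body (diffs val, None)) (regs base val) (regs base val) 0.
    rewrite /guess_body /=; case: asboolP => [_|[]]; first exact: can_skip.
    by exists val.
  apply: can_le (can_graph_rcons (e := (diffs val, None)) h hb) _.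
  by rewrite mulnS addnC addn0 leq_add2r leq_addl.
elim: n val {Ph} le => [|n IH] val le.
  have v0 w : val w = 0.
    by have := le w; case: (val w) => // v; rewrite nat_bits_gt0.
  have -> : diffs val = diffs (fun _ => 0).
    by apply/ffunP=> -[[w|] [w'|]]; rewrite !ffunE /= ?v0.
  rewrite (@eq_regs base val (fun _ => 0)) //.
  by apply: can_le (can_graph_nil _ _ _ _ _) _.
pose val' w := (val w)./2; pose col := [ffun w => odd (val w)].
have vE w : shift_in val' col w = val w.
  by rewrite /shift_in /val' /col ffunE mul2n addnC odd_double_half.
have {}IH := IH val' _.
have hb : can (guess_body (diffs val', Some col)) (regs base val') (regs base val) (5 * #|V|).
  rewrite /guess_body /= -[X in can _ _ X](@eq_regs base (fun w => if w \in enum V then shift_in val' col w else val' w)).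
    by rewrite cardE; apply: can_push_bits (enum_uniq V) (@nzE val').
  by move=> w; rewrite mem_enum -vE.
have := can_graph_rcons (e := (diffs val', Some col)) (IH _) hb.
rewrite /guess_tgt /= -diffs_shift_in.
have -> : diffs (shift_in val' col) = diffs val.
  by apply/ffunP=> -[[w|] [w'|]]; rewrite !ffunE /= ?vE.
move=> h; apply: can_le (h _) _.
  by move=> w; rewrite /val' size_nat_bits_half; have := le w; lia.
by rewrite mulnSr addnA.
Qed.

End Guess.
End Registers.

(** * Rewriting configurations *)

Lemma map_eq_cat (T U : Type) (f : T -> U) x a b : map f x = a ++ b ->
  exists x1 x2, [/\ x = x1 ++ x2, a = map f x1 & b = map f x2].
Proof.
elim: a x => [|c a IH] x /=; first by exists [::], x.
case: x => // t x [<- /IH [x1 [x2 [-> -> ->]]]].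
by exists (t :: x1), x2.
Qed.

Section Words.
Variable F : Type.

(* [None] terminates a timed fact. *)
Definition isym : Type := option (F + bool).
Definition ibit (b : bool) : isym := Some (inr b).
Definition repr1 (g : F * nat) : seq isym :=
  Some (inl g.1) :: map ibit (nat_bits g.2) ++ [:: None].
Definition repr (S : seq (F * nat)) : seq isym := flatten (map repr1 S).

Lemma repr_cat S1 S2 : repr (S1 ++ S2) = repr S1 ++ repr S2.
Proof. by rewrite /repr map_cat flatten_cat. Qed.

Lemma repr_cons g S : repr (g :: S) =
  Some (inl g.1) :: map ibit (nat_bits g.2) ++ None :: repr S.
Proof. by rewrite /repr /= -catA. Qed.

Lemma bits_term_inj bs bs' (v v' : seq isym) :
  map ibit bs ++ None :: v = map ibit bs' ++ None :: v' -> bs = bs' /\ v = v'.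
Proof.
elim: bs bs' => [|b bs IH] [|b' bs'] //=; first by case.
by case=> -> /IH [-> ->].
Qed.

(** Thanks to the terminator, a fact symbol with the digits up to the next [None] is always one
    whole timed fact, so that cutting the word at a guessed place splits the configuration. *)
Lemma repr_split S u f bs v :
  repr S = u ++ Some (inl f) :: map ibit bs ++ None :: v ->
  exists S1 t S2, [/\ S = S1 ++ (f, t) :: S2, u = repr S1, bs = nat_bits t
                    & v = repr S2].
Proof.
elim: S u => [|[f0 t0] S IH] u; first by case: u.
rewrite repr_cons /=; case: u => [|c u] /=.
  by case=> -> /bits_term_inj [<- <-]; exists [::], t0, S.
case=> <- e; have [u' eu er] : exists2 u', u = map ibit (nat_bits t0) ++ None :: u' &
    repr S = u' ++ Some (inl f) :: map ibit bs ++ None :: v.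
  move: (nat_bits t0) e => b0; elim: b0 u => [|b b0 IHb] [|c' u] //=.
    by case=> <- e; exists u.
  by case=> <- /IHb [u' -> e]; exists u'.
have [S1 [t [S2 [-> e1 -> ->]]]] := IH _ er.
by exists ((f0, t0) :: S1), t, S2; split=> //; rewrite repr_cons eu e1.
Qed.

End Words.

Section Facts.
Variables (J G F : finType) (gi : isym F -> G) (jC jD : J).
Hypothesis gi_inj : injective gi.
Hypothesis neCD : jC != jD.

Implicit Types (s : store J G) (S : seq (F * nat)).
Let gb b := gi (ibit F b).
Let neDC : jD != jC. Proof. by rewrite eq_sym. Qed.

Section OneFact.
Variable j : J.
Hypotheses (neC : jC != j) (neD : jD != j).
Let neC' : j != jC. Proof. by rewrite eq_sym. Qed.
Let neD' : j != jD. Proof. by rewrite eq_sym. Qed.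

Definition match_bits : prog J G :=
  star (alt (fun b : bool => seqp (pop jC (gb b)) (pop j (gb b)))).

Lemma may_match_bits s s' : may match_bits s s' -> exists bs v w,
  [/\ s jC = map gb bs ++ v, s j = map gb bs ++ w & s' = upd (upd s jC v) j w].
Proof.
move=> h; apply: (may_star_ind (P := fun s' => exists bs v w,
  [/\ s jC = map gb bs ++ v, s j = map gb bs ++ w & s' = upd (upd s jC v) j w])) h _; last first.
  by exists [::], (s jC), (s j); split=> //; rewrite !upd_self.
move=> s1 s2 [bs [v [w [e1 e2 ->]]]] /may_alt [b] /may_seq [m] /may_pop [v'].
rewrite upd_other // upd_same => ev -> /may_pop [w'].
rewrite upd_other // upd_same => ew ->.
exists (rcons bs b), v', w'; split.
- by rewrite map_rcons cat_rcons -ev.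
- by rewrite map_rcons cat_rcons -ew.
- apply/ffunP=> x; rewrite !ffunE.
  by case: eqP => // _; case: eqP.
Qed.

Lemma can_match_bits s bs v w : s jC = map gb bs ++ v -> s j = map gb bs ++ w ->
  can match_bits s (upd (upd s jC v) j w) (10 * size bs).
Proof.
elim: bs s => [|b bs IH] s /= e1 e2.
  by rewrite !upd_self //; apply: can_star_nil.
have h1 := can_pop e1.
have h2 : can (pop j (gb b)) (upd s jC (map gb bs ++ v))
   (upd (upd s jC (map gb bs ++ v)) j (map gb bs ++ w)) 1.
  by apply: can_pop; rewrite upd_other.
set s2 := upd _ j _ in h2.
have e2C : s2 jC = map gb bs ++ v by rewrite upd_other // upd_same.
have e2j : s2 j = map gb bs ++ w by rewrite upd_same.
have -> : upd (upd s jC v) j w = upd (upd s2 jC v) j w.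
  by apply/ffunP=> x; rewrite !ffunE; case: eqP => // _; case: eqP.
have hb := can_alt (f := fun b : bool => seqp (pop jC (gb b)) (pop j (gb b)))
  (can_seq h1 h2).
by apply: can_le (can_star_cons hb (IH _ e2C e2j)) _; lia.
Qed.

(** After the common digits are removed, both ends are checked, the empty register and the
    terminator on [jC]; the stamps thus agree entirely and not just on a prefix. *)
Definition extract (f : F) : prog J G :=
  seqp (some_moves jC jD) (seqp (pop jC (gi (Some (inl f)))) (seqp match_bits
    (seqp (empty j) (seqp (pop jC (gi None)) (move_all jD jC))))).

Lemma may_extract s s' S f : s jC = map gi (repr S) -> s jD = [::] ->
  may (extract f) s s' -> exists S1 t S2,
  [/\ S = S1 ++ (f, t) :: S2, s j = map gb (nat_bits t) &
      s' = upd (upd s j [::]) jC (map gi (repr (S1 ++ S2)))].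
Proof.
move=> eC eD /may_seq [m1] /(may_some_moves neCD) [u [v [e ->]]].
rewrite eD cats0; case/may_seq=> m2 /may_pop [v2].
rewrite upd_other // upd_same => ev -> /may_seq [m3] /may_match_bits [bs [v3 [w]]].
rewrite upd_same !upd_other // => -[ev2 ej ->].
case/may_seq=> m4 /may_empty [].
rewrite upd_same => ew -> /may_seq [m5] /may_pop [v4].
rewrite upd_other // upd_same => ev3 -> /(may_move_all neDC) ->.
(* The decomposition of the stack is pulled back along the injection [gi] to one of the word
   [repr S], to which [repr_split] applies. *)
move: e; rewrite eC ev ev2 ev3 => /map_eq_cat [u1 [r1 [eS eu]]].
case: r1 eS => [//|c r1] eS /= [/gi_inj ec].
rewrite -/gb => e; have /esym/map_eq_cat [r2 [r3 [er1 eb]]] := e.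
case: r3 er1 => [//|c3 r3] er1 /= [/gi_inj ec3 ev4].
have {eb} eb : r2 = map (@ibit F) bs.
  apply: (inj_map gi_inj); rewrite -eb -map_comp; exact: eq_map.
rewrite eb -ec3 -ec in er1 eS; rewrite er1 in eS.
have [S1 [t [S2 [-> e1 e2 e3]]]] := repr_split eS.
exists S1, t, S2; split=> //; first by rewrite ej ew cats0 e2.
apply/ffunP=> x; rewrite !ffunE !eqxx ?(negPf neDC) ?(negPf neCD) ?(negPf neD) ?(negPf neC).
case: eqP => _; first by rewrite revK repr_cat map_cat eu ev4 e1 e3.
by case: eqP => [->|_]; [rewrite (negPf neD) eD | case: eqP => // _; rewrite ew].
Qed.

Lemma can_extract s S1 t S2 f : s jC = map gi (repr (S1 ++ (f, t) :: S2)) ->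
  s jD = [::] -> s j = map gb (nat_bits t) ->
  can (extract f) s (upd (upd s j [::]) jC (map gi (repr (S1 ++ S2))))
    (20 * size (repr (S1 ++ (f, t) :: S2)) + 40).
Proof.
move=> eC eD ej.
rewrite repr_cat repr_cons map_cat /= map_cat /= -map_comp in eC.
have h1 := can_some_moves neCD eC; rewrite eD cats0 size_map in h1.
set s1 := upd _ _ _ in h1.
have e1 : s1 jC = gi (Some (inl f)) :: map gb (nat_bits t) ++ gi None :: map gi (repr S2).
  by rewrite /s1 upd_other // upd_same.
have h2 := can_pop e1; set s2 := upd _ _ _ in h2.
have e2C : s2 jC = map gb (nat_bits t) ++ gi None :: map gi (repr S2) by rewrite upd_same.
have e2j : s2 j = map gb (nat_bits t) ++ [::].
  by rewrite /s2 upd_other // /s1 !upd_other // ej cats0.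
have h3 := can_match_bits e2C e2j; set s3 := upd _ _ _ in h3.
have h4 : can (empty j) s3 s3 1 by apply: can_empty; rewrite upd_same.
have e3 : s3 jC = gi None :: map gi (repr S2) by rewrite /s3 upd_other // upd_same.
have h5 := can_pop e3; set s4 := upd _ _ _ in h5.
have h6 := can_move_all s4 neDC.
have e4 : s4 jD = rev (map gi (repr S1)).
  by rewrite !ffunE eqxx (negPf neDC) (negPf neD).
rewrite e4 revK size_rev size_map in h6; set s5 := upd _ _ _ in h6.
have -> : upd (upd s j [::]) jC (map gi (repr (S1 ++ S2))) = s5.
  apply/ffunP=> x; rewrite !ffunE !eqxx ?(negPf neDC) ?(negPf neCD) ?(negPf neD) ?(negPf neC).
  case: eqP => _; first by rewrite repr_cat map_cat.
  by case: (eqVneq x jD) => [->|_]; [rewrite (negPf neD) eD | case: eqP].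
apply: can_le (can_seq h1 (can_seq h2 (can_seq h3 (can_seq h4 (can_seq h5 h6))))) _.
rewrite repr_cat repr_cons size_cat /= size_cat /= size_map.
move: (size (repr S1)) (size (repr S2)) (size (nat_bits t)) => a b c.
lia.
Qed.

(** The digits travel through [jD], so that two reversals preserve their order. *)
Definition emit (f : F) : prog J G :=
  seqp (push jC (gi None)) (seqp (move_all j jD) (seqp (move_all jD jC)
    (push jC (gi (Some (inl f)))))).

Let emitted s t S f :
  upd (upd s j [::]) jC (map gi (repr ((f, t) :: S))) =
  upd (upd s j [::]) jC (gi (Some (inl f)) :: map gb (nat_bits t) ++ gi None :: map gi (repr S)).
Proof. by rewrite repr_cons /= map_cat -map_comp. Qed.

Let emit_store s t S f : s jC = map gi (repr S) -> s jD = [::] ->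
  s j = map gb (nat_bits t) ->
  let s1 := upd s jC (gi None :: s jC) in
  let s2 := upd (upd s1 j [::]) jD (rev (s1 j) ++ s1 jD) in
  let s3 := upd (upd s2 jD [::]) jC (rev (s2 jD) ++ s2 jC) in
  upd s3 jC (gi (Some (inl f)) :: s3 jC) =
  upd (upd s j [::]) jC (map gi (repr ((f, t) :: S))).
Proof.
move=> eC eD ej; rewrite emitted; apply/ffunP=> x.
rewrite !ffunE !eqxx ?(negPf neDC) ?(negPf neCD) ?(negPf neD) ?(negPf neC) ?(negPf neC') ?(negPf neD').
rewrite eD ej eC cats0 revK.
case: eqP => // _; case: eqP => [->|_]; last by case: eqP.
by rewrite (negPf neD) eD.
Qed.

Lemma may_emit s s' S t f : s jC = map gi (repr S) -> s jD = [::] ->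
  s j = map gb (nat_bits t) -> may (emit f) s s' ->
  s' = upd (upd s j [::]) jC (map gi (repr ((f, t) :: S))).
Proof.
move=> eC eD ej /may_seq [s1] /may_push -> /may_seq [s2] /(may_move_all neD') ->.
case/may_seq=> s3 /(may_move_all neDC) -> /may_push ->.
exact: emit_store.
Qed.

Lemma can_emit s S t f : s jC = map gi (repr S) -> s jD = [::] ->
  s j = map gb (nat_bits t) ->
  can (emit f) s (upd (upd s j [::]) jC (map gi (repr ((f, t) :: S))))
    (20 * size (nat_bits t) + 40).
Proof.
move=> eC eD ej; rewrite -(emit_store f eC eD ej) /=.
set s1 := upd s jC _; set s2 := upd (upd s1 j _) jD _.
have h1 : can (push jC (gi None)) s s1 1 by apply: can_push.
have h2 : can (move_all j jD) s1 s2 _ := can_move_all s1 neD'.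
have h3 := can_move_all s2 neDC.
have := can_seq h1 (can_seq h2 (can_seq h3 (can_push jC (gi (Some (inl f))) _))).
have -> : size (s1 j) = size (nat_bits t) by rewrite upd_other // ej size_map.
have -> : size (s2 jD) = size (nat_bits t).
  by rewrite upd_same upd_other // ej upd_other // eD cats0 size_rev size_map.
by move=> h; apply: can_le h _; lia.
Qed.

End OneFact.

Definition conf S : store J G := [ffun j => if j == jC then map gi (repr S) else [::]].

(** * Rewriting with the time stamps held in registers *)

Section Schema.
Variables (V : finType) (r : V -> J) (rown : J -> option V).
Hypothesis rown_r : forall w, rown (r w) = Some w.
Hypothesis r_rown : forall j w, rown j = Some w -> j = r w.
Hypothesis rownC : rown jC = None.
Hypothesis rownD : rown jD = None.

Implicit Types (val : V -> nat) (l : seq (F * V)).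

Let neCr w : jC != r w. Proof. by rewrite (eq_r rown_r r_rown) rownC. Qed.
Let neDr w : jD != r w. Proof. by rewrite (eq_r rown_r r_rown) rownD. Qed.

Definition state S val := regs gb rown (conf S) val.

Lemma stateC S val : state S val jC = map gi (repr S).
Proof. by rewrite !ffunE rownC eqxx. Qed.

Lemma stateD S val : state S val jD = [::].
Proof. by rewrite !ffunE rownD (negPf neDC). Qed.

Lemma state_r S val w : state S val (r w) = map gb (nat_bits (val w)).
Proof. exact: regs_r. Qed.

Lemma state_upd S val w S' :
  upd (upd (state S val) (r w) [::]) jC (map gi (repr S')) =
  state S' (set_val val w 0).
Proof.
rewrite -[[::]]/(map gb (nat_bits 0)) /state (regs_set _ rown_r r_rown).
apply/ffunP=> j; rewrite !ffunE.
by case: eqP => [->|]; rewrite ?rownC.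
Qed.

Definition stamped l val : seq (F * nat) := [seq (p.1, val p.2) | p <- l].

Lemma eq_state S val val' : val =1 val' -> state S val = state S val'.
Proof. exact: eq_regs. Qed.

Definition extract_all l : prog J G := seqs [seq extract (r p.2) p.1 | p <- l].

Lemma stamped_set l val w v : w \notin map snd l ->
  stamped l (set_val val w v) = stamped l val.
Proof.
move=> nw; apply/eq_in_map => p pl; rewrite /set_val.
by case: eqP nw => // <-; rewrite map_f.
Qed.

Let zeroed l val : V -> nat := fun w => if w \in map snd l then 0 else val w.

Let zeroed_cons p l val : p.2 \notin map snd l ->
  zeroed l (set_val val p.2 0) =1 zeroed (p :: l) val.
Proof.
by move=> n w; rewrite /zeroed /set_val /= inE; case: eqP => //= _; case: ifP.
Qed.

Lemma may_extract_all l S val s' : uniq (map snd l) ->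
  may (extract_all l) (state S val) s' ->
  exists2 rest, perm_eq S (stamped l val ++ rest) & s' = state rest (zeroed l val).
Proof.
elim: l S val => [|p l IH] S val /=; first by move=> _ /may_skip ->; exists S.
case/andP=> np ul /may_seq [m].
case/(may_extract (neCr _) (neDr _) (stateC _ _) (stateD _ _)).
move=> S1 [t [S2 [eS]]]; rewrite state_r => /(inj_map _) et.
rewrite state_upd => ->; have {}et : val p.2 = t.
  by apply: (can_inj nat_bitsK); apply: et => b b' /gi_inj [].
case/(IH _ _ ul) => rest; rewrite stamped_set // => pe ->.
exists rest; last by apply: eq_state; apply: zeroed_cons.
by rewrite eS perm_catC /= et perm_cons perm_catC.
Qed.

(** The facts may sit anywhere in the sequence, so the remainder is determined only up to order. *)
Lemma can_extract_all l S val rest n : uniq (map snd l) ->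
  perm_eq S (stamped l val ++ rest) -> size (repr S) <= n ->
  exists2 rest', perm_eq rest rest' &
    can (extract_all l) (state S val) (state rest' (zeroed l val))
        ((20 * n + 44) * size l).
Proof.
elim: l S val => [|p l IH] S val /=.
  move=> _ pe _; exists S; first by rewrite perm_sym.
  by apply: can_le (can_skip _) _.
case/andP=> np ul pe le.
have : (p.1, val p.2) \in S by rewrite (perm_mem pe) mem_head.
move=> pS; have [S1 [S2 eS]] : exists S1 S2, S = S1 ++ (p.1, val p.2) :: S2.
  by move: pS => /splitPr [S1 S2]; exists S1, S2.
have h1 := can_extract (neCr p.2) (neDr p.2) (f := p.1) (S1 := S1) (t := val p.2) (S2 := S2) (s := state S val).
rewrite -eS state_upd in h1; have {}h1 := h1 (stateC _ _) (stateD _ _) (state_r _ _ _).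
have [||rest' pr h2] := IH (S1 ++ S2) (set_val val p.2 0) ul.
- rewrite stamped_set // -(perm_cons (p.1, val p.2)); apply: perm_trans pe.
  by rewrite eS -[_ :: S2]cat1s perm_sym perm_catCA.
- apply: leq_trans le; rewrite eS (repr_cat S1 S2) (repr_cat S1 (_ :: S2)) repr_cons !size_cat /= size_cat /=.
  by move: (size (repr S1)) (size (repr S2)) => *; lia.
exists rest' => //.
rewrite -(eq_state _ (zeroed_cons _ np)).
apply: can_le (can_seq h1 h2) _; rewrite mulnS; move: (size l) le => k; move: (size (repr S)) => z.
by move=> *; lia.
Qed.

Definition emit_all l : prog J G := seqs [seq emit (r p.2) p.1 | p <- l].

Lemma may_emit_all l S val s' : uniq (map snd l) ->
  may (emit_all l) (state S val) s' ->
  s' = state (rev (stamped l val) ++ S) (zeroed l val).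
Proof.
elim: l S val => [|p l IH] S val /=; first by move=> _ /may_skip ->.
case/andP=> np ul /may_seq [m].
move/(may_emit (neCr _) (neDr _) (stateC _ _) (stateD _ _) (state_r _ _ _)).
rewrite state_upd => -> /(IH _ _ ul) ->.
rewrite stamped_set // rev_cons cat_rcons.
by apply: eq_state; apply: zeroed_cons.
Qed.

Lemma can_emit_all l S val n : uniq (map snd l) ->
  (forall w, size (nat_bits (val w)) <= n) ->
  can (emit_all l) (state S val) (state (rev (stamped l val) ++ S) (zeroed l val))
    ((20 * n + 44) * size l).
Proof.
elim: l S val => [|p l IH] S val /=.
  by move=> _ _; apply: can_le (can_skip _) _.
case/andP=> np ul le.
have h1 := can_emit (neCr p.2) (neDr p.2) p.1 (stateC S val) (stateD _ _) (state_r _ _ _).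
rewrite state_upd in h1.
have h2 := IH ((p.1, val p.2) :: S) (set_val val p.2 0) ul.
rewrite stamped_set // (eq_state _ (zeroed_cons _ np)) -cat_rcons -rev_cons in h2.
apply: can_le (can_seq h1 (h2 _)) _.
  by move=> w; rewrite /set_val; case: eqP.
rewrite mulnS; move: (size l) (le p.2) => k; move: (size (nat_bits (val p.2))) => z.
by move=> *; lia.
Qed.

Variables (B : nat) (Phi : (V -> nat) -> Prop) (ins outs : seq (F * V)).
Hypothesis B_gt0 : 0 < B.
Hypothesis Phi_diffs :
  forall val val', diffs B val = diffs B val' -> Phi val -> Phi val'.
Hypothesis uniq_io : uniq (map snd (ins ++ outs)).
Hypothesis all_io : forall w, w \in map snd (ins ++ outs).

(** Each register occurs exactly once in [ins ++ outs]. Extracting or emitting its fact empties it,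
    so all registers are empty again at the end. *)
Definition rewriting : prog J G :=
  seqp (guess gb r B Phi) (seqp (extract_all ins) (emit_all outs)).

Let state0 S : state S (fun _ => 0) = conf S.
Proof.
apply/ffunP=> j; rewrite !ffunE; case e: (rown j) => [w|] //.
by rewrite (r_rown e) eq_sym (negPf (neCr w)).
Qed.

Let u_ins : uniq (map snd ins).
Proof. by move: uniq_io; rewrite map_cat cat_uniq => /and3P[]. Qed.

Let u_outs : uniq (map snd outs).
Proof. by move: uniq_io; rewrite map_cat cat_uniq => /and3P[]. Qed.

Let stamped_outs val : stamped outs (zeroed ins val) = stamped outs val.
Proof.
apply/eq_in_map => p po; rewrite /zeroed; case: ifP => // pi.
move: uniq_io; rewrite map_cat cat_uniq => /and3P[_ /hasPn /(_ p.2) + _].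
by rewrite map_f // => /(_ isT) /=; rewrite pi.
Qed.

Let zeroed_all val : zeroed outs (zeroed ins val) =1 fun _ => 0.
Proof.
move=> w; rewrite /zeroed; have := all_io w; rewrite map_cat mem_cat.
by case: ifP => //; case: ifP.
Qed.

Lemma may_rewriting S s' : may rewriting (conf S) s' -> exists val rest,
  [/\ Phi val, perm_eq S (stamped ins val ++ rest) &
      s' = conf (rev (stamped outs val) ++ rest)].
Proof.
case/may_seq=> m; rewrite -state0.
case/(may_guess rown_r r_rown B_gt0 Phi_diffs) => val Ph ->.
case/may_seq=> m' /(may_extract_all u_ins) [rest pe ->] /(may_emit_all u_outs) ->.
exists val, rest; split=> //.
by rewrite stamped_outs (eq_state _ (zeroed_all val)) state0.
Qed.

Lemma can_rewriting S val rest n : Phi val ->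
  perm_eq S (stamped ins val ++ rest) -> size (repr S) <= n ->
  (forall w, size (nat_bits (val w)) <= n) ->
  exists2 rest', perm_eq rest rest' &
    can rewriting (conf S) (conf (rev (stamped outs val) ++ rest'))
      ((5 * #|V| + 44 * size ins + 44 * size outs + 10) * n.+1).
Proof.
move=> Ph pe le1 le2.
have h1 := @can_guess _ _ _ gb _ _ rown_r r_rown _ B_gt0 Phi (conf S) _ _ Ph le2.
have [rest' pr h2] := can_extract_all u_ins pe le1.
have h3 := can_emit_all rest' u_outs (val := zeroed ins val) (n := n).
rewrite stamped_outs (eq_state _ (zeroed_all val)) state0 in h3.
exists rest' => //; rewrite -state0.
apply: can_le (can_seq h1 (can_seq h2 (h3 _))) _.
  by move=> w; rewrite /zeroed; case: ifP.
move: (size ins) (size outs) #|V| => a b c.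
rewrite !mulnDl; lia.
Qed.

End Schema.
End Facts.

(** * Reading the input *)

Section Parsing.
Variables (J G F X : finType) (gi : isym F -> G) (inX : X -> G) (jC jI : J).
Variables (enc : isym F -> seq X) (H : nat).
Hypothesis inX_inj : injective inX.
Hypothesis neCI : jC != jI.
Hypothesis encH : forall a, size (enc a) <= H.

Implicit Types (u v : seq (isym F)) (x : seq X) (S : seq (F * nat)).
Let encode u : seq X := flatten (map enc u).
Let neIC : jI != jC. Proof. by rewrite eq_sym. Qed.

Let encode_cat u v : encode (u ++ v) = encode u ++ encode v.
Proof. by rewrite /encode map_cat flatten_cat. Qed.

(* [u] has been parsed, [x] is the part of the input still to be parsed; parsing
   proceeds from the end of the input. *)
Definition parsing u x : store J G :=
  [ffun j => if j == jC then map gi u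
             else if j == jI then rev (map inX x) else [::]].

Definition accept_sym (a : isym F) : prog J G :=
  seqp (pops jI (rev (map inX (enc a)))) (push jC (gi a)).

Lemma may_accept_sym a u x s' : may (accept_sym a) (parsing u x) s' ->
  exists2 x', x = x' ++ enc a & s' = parsing (a :: u) x'.
Proof.
case/may_seq=> m /may_pops [v e ->] /may_push ->.
move: e; rewrite ffunE (negPf neIC) eqxx => /(congr1 rev).
rewrite revK rev_cat revK => /map_eq_cat [x1 [x2 [ex ev /(inj_map inX_inj) e2]]].
exists x1; first by rewrite ex e2.
apply/ffunP=> j; rewrite !ffunE eqxx (negPf neCI).
by case: eqP => // _; case: eqP => // _; rewrite -ev revK.
Qed.

Lemma can_accept_sym a u x :
  can (accept_sym a) (parsing u (x ++ enc a)) (parsing (a :: u) x) (5 * H + 5).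
Proof.
have e : parsing u (x ++ enc a) jI = rev (map inX (enc a)) ++ rev (map inX x).
  by rewrite ffunE (negPf neIC) eqxx map_cat rev_cat.
have := can_seq (can_pops e) (can_push jC (gi a) _).
set s1 := upd _ jC _; have -> : s1 = parsing (a :: u) x.
  apply/ffunP=> j; rewrite !ffunE eqxx (negPf neCI).
  by case: eqP => // _; case: eqP.
move=> h; apply: can_le h _; rewrite size_rev size_map.
by have := encH a; lia.
Qed.

Definition accept_bits : prog J G := star (alt (fun b => accept_sym (ibit F b))).

(* The most significant digit comes first and must be one. *)
Definition accept_num : prog J G :=
  alt (fun b : bool => if b then skip
       else seqp (accept_sym (ibit F true)) accept_bits).

Let bits t : seq (isym F) := map (@ibit F) (nat_bits t).

Let bits_step t (b : bool) : 0 < t -> bits (2 * t + b) = ibit F b :: bits t.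
Proof. by move=> t0; rewrite /bits nat_bits_step t0. Qed.

Lemma may_accept_num u x s' : may accept_num (parsing u x) s' ->
  exists t x', x = x' ++ encode (bits t) /\ s' = parsing (bits t ++ u) x'.
Proof.
case/may_alt=> -[/may_skip ->|]; first by exists 0, x; rewrite cats0.
case/may_seq=> m /may_accept_sym [x' -> ->] h.
suff [t [x1 [_ -> ->]]] : exists t x1, [/\ 0 < t, x' ++ enc (ibit F true) = x1 ++ encode (bits t)
    & s' = parsing (bits t ++ u) x1] by exists t, x1.
apply: (may_star_ind (P := fun s => exists t x1, [/\ 0 < t,
    x' ++ enc (ibit F true) = x1 ++ encode (bits t)
    & s = parsing (bits t ++ u) x1])) h _; last first.
  by exists 1, x'; split=> //; rewrite /encode /= cats0.
move=> s1 s2 [t [x1 [t0 e ->]]] /may_alt [b] /may_accept_sym [x2 ex ->].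
exists (2 * t + b), x2; rewrite bits_step //; split=> //; first by lia.
by rewrite e ex -catA.
Qed.

(** The leading one is read first and the least significant digit last. The induction removes the
    latter, which does not affect the store [m] reached after the leading one. *)
Lemma can_accept_num t u x :
  can accept_num (parsing u (x ++ encode (bits t))) (parsing (bits t ++ u) x)
    ((5 * H + 10) * size (nat_bits t) + 10).
Proof.
case: (posnP t) => [->|t0].
  apply: (can_le (T := 0 + 2)); last by lia.
  by apply: (can_alt (i := true)); rewrite cats0; apply: can_skip.
suff h : can (seqp (accept_sym (ibit F true)) accept_bits)
   (parsing u (x ++ encode (bits t))) (parsing (bits t ++ u) x)
   ((5 * H + 10) * size (nat_bits t) + 4).
  by apply: can_le (can_alt (i := false) (f := fun b : bool => if b then skip
       else seqp (accept_sym (ibit F true)) accept_bits) h) _; lia.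
suff [m h1 h2] : exists2 m, can (accept_sym (ibit F true)) (parsing u (x ++ encode (bits t))) m (5 * H + 5)
   & can accept_bits m (parsing (bits t ++ u) x) ((5 * H + 10) * (size (nat_bits t)).-1).
  apply: can_le (can_seq h1 h2) _.
  by rewrite (nat_bits_gt0 t0) /=; move: (size _) => k; lia.
elim/ltn_ind: t t0 x => t IH t0 x.
have bE : bits t = ibit F (odd t) :: bits t./2 by rewrite /bits nat_bits_gt0.
case: (posnP t./2) => [t20|t20].
  have t1 : t = 1 by lia.
  exists (parsing (bits t ++ u) x); last by rewrite t1 /=; apply: can_le (can_star_nil _ _) _.
  by rewrite t1 /encode /= cats0; apply: can_accept_sym.
have [|m h1 h2] := IH t./2 _ t20 (x ++ enc (ibit F (odd t))); first by lia.
exists m; first by rewrite bE /encode /= catA.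
rewrite bE /=.
have h3 := can_alt (f := fun b => accept_sym (ibit F b)) (can_accept_sym (ibit F (odd t)) (bits t./2 ++ u) x).
apply: can_le (can_graph_rcons (e := tt) h2 h3) _.
rewrite size_nat_bits_half (nat_bits_gt0 t0) (nat_bits_gt0 t20) /=; move: (size _) => k; lia.
Qed.

Definition accept_fact (P : pred F) : prog J G :=
  seqp (accept_sym None) (seqp accept_num
    (alt (fun f => if P f then accept_sym (Some (inl f)) else fail))).

Lemma may_accept_fact P u x s' : may (accept_fact P) (parsing u x) s' ->
  exists g x', [/\ P g.1, x = x' ++ encode (repr1 g) & s' = parsing (repr1 g ++ u) x'].
Proof.
case/may_seq=> m /may_accept_sym [x1 -> ->].
case/may_seq=> m1 /may_accept_num [t [x2 [-> ->]]] /may_alt [f].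
case: ifP => [Pf|_ /may_fail //] /may_accept_sym [x3 -> ->].
exists (f, t), x3; split=> //=; last by rewrite -catA.
by rewrite /repr1 -cat1s !encode_cat -!catA /encode /= !cats0.
Qed.

Lemma can_accept_fact (P : pred F) g u x : P g.1 ->
  can (accept_fact P) (parsing u (x ++ encode (repr1 g))) (parsing (repr1 g ++ u) x)
    ((5 * H + 20) * size (repr1 g)).
Proof.
case: g => f t /= Pf.
have -> : encode (repr1 (f, t)) = enc (Some (inl f)) ++ encode (bits t) ++ enc None.
  by rewrite /repr1 -cat1s !encode_cat /encode /= !cats0.
have h1 := can_accept_sym None u (x ++ enc (Some (inl f)) ++ encode (bits t)).
have h2 := can_accept_num t (None :: u) (x ++ enc (Some (inl f))).
have h3 : can (if P f then accept_sym (Some (inl f)) else fail)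
  (parsing (bits t ++ None :: u) (x ++ enc (Some (inl f))))
  (parsing (Some (inl f) :: bits t ++ None :: u) x) (5 * H + 5).
  by rewrite Pf; apply: can_accept_sym.
rewrite -!catA in h1 h2 *.
have := can_seq h1 (can_seq h2 (can_alt (f := fun f => if P f then accept_sym (Some (inl f)) else fail) h3)).
rewrite /repr1 /= => h; apply: can_le h _.
rewrite size_cat size_map /=; move: (size _) => k; lia.
Qed.

Lemma may_accept_facts P u x s' : may (star (accept_fact P)) (parsing u x) s' ->
  exists S x', [/\ all (fun g => P g.1) S, x = x' ++ encode (repr S)
                 & s' = parsing (repr S ++ u) x'].
Proof.
move=> h; apply: (may_star_ind (P := fun s => exists S x',
  [/\ all (fun g => P g.1) S, x = x' ++ encode (repr S)
                 & s = parsing (repr S ++ u) x'])) h _; last first.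
  by exists [::], x; rewrite cats0.
move=> s1 s2 [S [x1 [Ps -> ->]]] /may_accept_fact [g [x2 [Pg -> ->]]].
have rE : repr (g :: S) = repr1 g ++ repr S by [].
exists (g :: S), x2; rewrite rE; split; first by rewrite /= Pg.
  by rewrite encode_cat catA.
by rewrite catA.
Qed.

Lemma can_accept_facts (P : pred F) S u x : all (fun g => P g.1) S ->
  can (star (accept_fact P)) (parsing u (x ++ encode (repr S)))
    (parsing (repr S ++ u) x) ((5 * H + 22) * size (repr S)).
Proof.
elim/last_ind: S u x => [|S g IH] u x.
  by move=> _; rewrite cats0; apply: can_le (can_star_nil _ _) _.
rewrite all_rcons => /andP[Pg /IH {}IH].
have rE : repr (rcons S g) = repr S ++ repr1 g.
  by rewrite -cats1 repr_cat {2}/repr /= cats0.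
have h1 := can_accept_fact (P := P) u (x ++ encode (repr S)) Pg.
have := can_star_cons h1 (IH (repr1 g ++ u) x).
rewrite rE encode_cat !catA => h; apply: can_le h _.
rewrite size_cat; have : 0 < size (repr1 g) by [].
move: (size (repr S)) (size (repr1 g)) => a b; lia.
Qed.

Variable is_t : pred F.

(** Being well-typed, ground and of size at most [k] is built into the alphabet of facts; what is
    left to check is that there is exactly one time fact and that the whole input is consumed. *)
Definition parse : prog J G :=
  seqp (star (accept_fact (predC is_t))) (seqp (accept_fact is_t)
    (seqp (star (accept_fact (predC is_t))) (empty jI))).

Lemma parsing_conf S : parsing (repr S) [::] = conf gi jC S.
Proof. by apply/ffunP=> j; rewrite !ffunE; do 2!case: eqP => //. Qed.

Lemma parsing_input x : parsing [::] x = input_store inX jI x.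
Proof.
apply/ffunP=> j; rewrite !ffunE; case: (eqVneq j jC) => [->|//].
by rewrite (negPf neCI).
Qed.

Lemma may_parse x s' : may parse (input_store inX jI x) s' ->
  exists S, [/\ count (fun g => is_t g.1) S = 1, x = encode (repr S)
              & s' = conf gi jC S].
Proof.
rewrite -parsing_input; case/may_seq=> m /may_accept_facts [S1 [x1 [P1 -> ->]]].
case/may_seq=> m1 /may_accept_fact [g [x2 [Pg -> ->]]].
case/may_seq=> m2 /may_accept_facts [S2 [x3 [P2 -> ->]]] /may_empty [].
rewrite ffunE (negPf neIC) eqxx => e ->.
have -> : x3 = [::] by case: x3 e => // a x3 /(congr1 size); rewrite size_rev.
have c0 S : all (fun g => predC is_t g.1) S -> count (fun g => is_t g.1) S = 0.
  by move=> aS; apply/eqP; rewrite eqn0Ngt -has_count -all_predC.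
have rE : repr (S2 ++ g :: S1) = repr S2 ++ repr1 g ++ repr S1.
  by rewrite repr_cat /repr.
exists (S2 ++ g :: S1); split.
- by rewrite count_cat /= !c0 // Pg.
- by rewrite rE !encode_cat -!catA.
- by rewrite cats0 -parsing_conf rE.
Qed.

Lemma can_parse S : count (fun g => is_t g.1) S = 1 ->
  can parse (input_store inX jI (encode (repr S))) (conf gi jC S)
    ((5 * H + 22) * (size (repr S)).+1).
Proof.
move=> c1.
have [g gS Pg] : exists2 g, g \in S & is_t g.1 by apply/hasP; rewrite has_count c1.
move: c1; case/splitPr: gS => S2 S1; rewrite count_cat /= Pg => c1.
have c0 S' : count (fun g => is_t g.1) S' = 0 -> all (fun g => predC is_t g.1) S'.
  by move=> cS; rewrite (eq_all (a2 := predC (fun g : F * nat => is_t g.1))) // all_predC has_count cS.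
have h1 := can_accept_facts [::] (encode (repr S2) ++ encode (repr1 g)) (c0 S1 _).
have h2 := can_accept_fact (P := is_t) (repr S1) (encode (repr S2)) Pg.
have h3 := can_accept_facts (repr1 g ++ repr S1) [::] (c0 S2 _).
have h4 : can (empty jI) (parsing (repr S2 ++ repr1 g ++ repr S1) [::])
   (parsing (repr S2 ++ repr1 g ++ repr S1) [::]) 1.
  by apply: can_empty; rewrite ffunE (negPf neIC) eqxx.
have e : repr (S2 ++ g :: S1) = repr S2 ++ repr1 g ++ repr S1.
  by rewrite repr_cat /repr.
rewrite -parsing_conf -parsing_input e !encode_cat catA.
rewrite cats0 in h1.
apply: can_le (can_seq (h1 _) (can_seq h2 (can_seq (h3 _) h4))) _; try lia.
rewrite !size_cat; have : 0 < size (repr1 g) by [].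
move: (size (repr S1)) (size (repr S2)) (size (repr1 g)) => a b c; lia.
Qed.

End Parsing.

(** * Ground facts and rule instances *)

HB.instance Definition _ (Sg : signature) :=
  Choice.copy (term Sg) (pcan_type (@term_treeK Sg)).

Fixpoint lists (T : Type) (l : seq T) (n : nat) : seq (seq T) :=
  if n is n'.+1 then [seq a :: r | a <- l, r <- lists l n'] else [:: [::]].

Lemma mem_lists (T : eqType) (l ts : seq T) :
  {subset ts <= l} -> ts \in lists l (size ts).
Proof.
elim: ts => [|t ts IH] //= sub; apply: allpairs_f; first by apply: sub; rewrite mem_head.
by apply: IH => x xts; apply: sub; rewrite inE xts orbT.
Qed.

Section FiniteFacts.
Variables (Sg : signature) (k : nat).

Fixpoint ground_terms (d : nat) : seq (term Sg) :=
  if d is d'.+1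
  then [seq App f ts | f <- enum (fsym Sg), ts <- lists (ground_terms d') (size (fdom f))]
  else [::].

Lemma mem_sumn (T : eqType) (f : T -> nat) (s : seq T) x :
  x \in s -> f x <= sumn (map f s).
Proof.
elim: s => //= y s IH; rewrite inE => /orP[/eqP ->|/IH le]; first exact: leq_addr.
exact: leq_trans le (leq_addl _ _).
Qed.

Lemma all2_sorts (ts : seq (term Sg)) ss : all2 (@has_sort Sg) ts ss ->
  size ts = size ss /\ {in ts, forall t, exists s, has_sort t s}.
Proof.
elim: ts ss => [|t ts IH] [|s ss] //= /andP[ht /IH [-> h]]; split=> // t'.
by rewrite inE => /orP[/eqP ->|/h //]; exists s.
Qed.

(** The size bounds the depth, and well-sortedness forces the number of arguments that the
    enumeration uses. *)
Lemma ground_termsP d t s :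
  ground t -> has_sort t s -> term_size t <= d -> t \in ground_terms d.
Proof.
elim: d t s => [|d IH] [//|f ts] s //= /allP gr /andP[_ /all2_sorts [sz so]].
rewrite ltnS => le; apply: allpairs_f_dep; first by rewrite mem_enum.
rewrite -sz; apply: mem_lists => t tts; have [s' hs] := so _ tts.
apply: IH hs _; first exact: gr.
exact: leq_trans (mem_sumn _ tts) le.
Qed.

Definition good_fact (F : fact Sg) : bool :=
  [&& wt_fact F, ground_fact F & fact_size F <= k].

Definition good_facts : seq (fact Sg) := [seq F <-
  [seq (P, ts) | P <- enum (psym Sg), ts <- lists (ground_terms k) (size (pdom P))]
  | good_fact F].

Lemma mem_good_facts F : (F \in good_facts) = good_fact F.
Proof.
rewrite mem_filter; case g: (good_fact F) => //=; case/and3P: g.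
case: F => P ts /all2_sorts [/= sz so] /allP gr le.
apply: allpairs_f_dep; first by rewrite mem_enum.
rewrite -sz; apply: mem_lists => t tts; have [s hs] := so _ tts.
apply: ground_termsP hs _; first exact: gr.
exact: leq_trans (mem_sumn _ tts) (ltnW le).
Qed.

Definition gfact : finType := seq_sub good_facts.
Implicit Types (s : seq (gfact * nat)).

Definition gval (f : gfact) : fact Sg := ssval f.

Definition ext s : config Sg := [seq (gval g.1, g.2) | g <- s].

Definition is_tick_fact (f : gfact) : bool := gval f == time_fact Sg.

Lemma gfact_good (f : gfact) : good_fact (gval f).
Proof. by rewrite -mem_good_facts; apply: (valP f). Qed.

Lemma good_gfact F : good_fact F -> exists f : gfact, gval f = F.
Proof.
by rewrite -mem_good_facts => Fg; exists (SeqSub Fg).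
Qed.

Lemma configuration_ext s :
  configuration k (ext s) = (count (fun g => is_tick_fact g.1) s == 1).
Proof.
rewrite /configuration count_map andb_idl // => _.
by apply/allP=> G /mapP [g _ ->]; apply: gfact_good.
Qed.

Lemma all_good_ext (S : config Sg) : all (fun G => good_fact G.1) S ->
  exists s, S = ext s.
Proof.
elim: S => [|[F t] S IH] /=; first by exists [::].
case/andP=> /good_gfact [f fE] /IH [s ->].
by exists ((f, t) :: s); rewrite /= fE.
Qed.

Lemma configuration_exP (S : config Sg) : configuration k S -> exists s, S = ext s.
Proof. by case/andP=> al _; apply: all_good_ext. Qed.

Lemma ext_inj : injective (fun g : gfact * nat => (gval g.1, g.2)).
Proof. by move=> [f t] [f' t'] [/val_inj -> ->]. Qed.

Lemma ext_cat s1 s2 : ext (s1 ++ s2) = ext s1 ++ ext s2.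
Proof. exact: map_cat. Qed.

Lemma perm_ext s1 s2 : perm_eq (ext s1) (ext s2) = perm_eq s1 s2.
Proof.
by apply/idP/idP; [apply: perm_map_inj; apply: ext_inj | apply: perm_map].
Qed.

(** The official encoding has no terminators, so [None] is erased: the parser inserts it by
    guessing. The same map feeds the simulated machines. *)
Definition enc_sym (a : isym gfact) : seq (char Sg) :=
  match a with
  | None => [::]
  | Some (inl f) =>
      inl (inl (gval f).1) :: flatten [seq encode_term t | t <- (gval f).2]
  | Some (inr b) => [:: inr b]
  end.

Lemma encode_repr s : flatten (map enc_sym (repr s)) = encode (ext s).
Proof.
elim: s => [//|[f t] s IH].
rewrite repr_cons /encode /= map_cat flatten_cat /= IH -catA.
congr (_ :: _ ++ _); congr (_ ++ _).
by rewrite -map_comp; elim: (nat_bits t) => //= b bs ->.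
Qed.

(** The two extra units are the fact symbol and the terminator, so that [weight] is the length of
    [repr]. *)
Definition fact_weight (G : timed_fact Sg) : nat := (size (nat_bits G.2)).+2.

Definition weight (S : config Sg) : nat := sumn (map fact_weight S).

Lemma size_repr s : size (repr s) = weight (ext s).
Proof.
elim: s => [//|[f t] s IH]; rewrite repr_cons /= size_cat /= IH size_map /weight /=.
by rewrite /fact_weight /=; lia.
Qed.

Lemma perm_weight (S S' : config Sg) : perm_eq S S' -> weight S = weight S'.
Proof. by move=> p; apply: perm_sumn; apply: perm_map. Qed.

Lemma weight_le (S : config Sg) L : (forall G, G \in S -> size (nat_bits G.2) <= L) ->
  weight S <= size S * L.+2.
Proof.
elim: S => //= G S IH h; rewrite mulSn; apply: leq_add.
  by rewrite !ltnS; apply: h; rewrite mem_head.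
by apply: IH => G' G'S; apply: h; rewrite inE G'S orbT.
Qed.

Lemma size_encode_ge (S : config Sg) : size S <= size (encode S).
Proof.
elim: S => //= G S IH; rewrite /encode /= size_cat -/(encode S).
by move: (size S) (size (encode S)) IH; rewrite size_cat => a b; lia.
Qed.

Lemma bits_encode (S : config Sg) G : G \in S ->
  size (nat_bits G.2) <= size (encode S).
Proof.
have encE G' S' : encode (G' :: S') = encode_timed_fact G' ++ encode S' by [].
elim: S => // G' S IH; rewrite inE encE size_cat.
case/orP=> [/eqP <-|/IH le]; last exact: leq_trans le (leq_addl _ _).
apply: leq_trans (leq_addr _ _); rewrite /= size_cat size_map.
by apply: leqW; apply: leq_addl.
Qed.

End FiniteFacts.

Arguments gval {Sg k} f.

(** * Ticks and instantaneous rules as instances of one rewriting schema *)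

Section Schemas.
Variables (Sg : signature) (k : nat).
Implicit Types (r : rule Sg) (sigma : sort Sg -> nat -> term Sg) (tau : tvar -> nat).

Definition lhs_vars r : seq tvar :=
  if r is Inst r then r_time r :: map snd (r_keep r) ++ map snd (r_consume r)
  else [:: 0].

(** Each stamp on the right is a variable of the left plus an offset. Kept facts are removed and put
    back with offset 0; Tick is the schema with one variable and offset 1. *)
Definition rhs_vars r : seq (tvar * nat) :=
  if r is Inst r then
    (r_time r, 0) :: [seq (P.2, 0) | P <- r_keep r] ++
      [seq (r_time r, Q.2) | Q <- r_create r]
  else [:: (0, 1)].

Definition lhs_facts sigma r : seq (fact Sg) :=
  if r is Inst r then
    time_fact Sg :: [seq subst_fact sigma P.1 | P <- r_keep r] ++
      [seq subst_fact sigma P.1 | P <- r_consume r]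
  else [:: time_fact Sg].

Definition rhs_facts sigma r : seq (fact Sg) :=
  if r is Inst r then
    time_fact Sg :: [seq subst_fact sigma P.1 | P <- r_keep r] ++
      [seq subst_fact sigma Q.1 | Q <- r_create r]
  else [:: time_fact Sg].

Definition guard r : seq tconstr := if r is Inst r then r_guard r else [::].

Lemma size_lhs_facts sigma r : size (lhs_facts sigma r) = size (lhs_vars r).
Proof. by case: r => //= r; rewrite !size_cat !size_map. Qed.

Lemma size_rhs_facts sigma r : size (rhs_facts sigma r) = size (rhs_vars r).
Proof. by case: r => //= r; rewrite !size_cat !size_map. Qed.

Lemma stepE r (S S' : config Sg) : step k r S S' <->
  [/\ configuration k S, configuration k S' & exists sigma tau rest,
    [/\ all (tconstr_holds tau) (guard r),
        perm_eq S (zip (lhs_facts sigma r) (map tau (lhs_vars r)) ++ rest) &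
        perm_eq S' (zip (rhs_facts sigma r)
          [seq tau p.1 + p.2 | p <- rhs_vars r] ++ rest)]].
Proof.
have zipm (T U V : Type) (f : T -> U) (g : T -> V) (l : seq T) :
    zip (map f l) (map g l) = [seq (f x, g x) | x <- l].
  by elim: l => //= x l ->.
case: r => [|r]; rewrite /step.
  split=> -[cS cS' h]; split=> //.
    case: h => t [rest [p p']].
    exists (fun s x => Var s x), (fun _ => t), rest; split=> //.
    by rewrite /= addn1.
  case: h => sigma [tau [rest [_ p p']]].
  by exists (tau 0), rest; split=> //; rewrite -addn1; apply: p'.
have eL sigma tau : zip (lhs_facts sigma (Inst r)) (map tau (lhs_vars (Inst r))) =
   (time_fact Sg, tau (r_time r)) :: map (inst sigma tau) (r_keep r) ++ map (inst sigma tau) (r_consume r).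
  by rewrite /= map_cat zip_cat ?size_map // -!map_comp !zipm.
have eR sigma tau : zip (rhs_facts sigma (Inst r)) [seq tau p.1 + p.2 | p <- rhs_vars (Inst r)] =
   (time_fact Sg, tau (r_time r)) :: map (inst sigma tau) (r_keep r) ++
   [seq (subst_fact sigma Q.1, tau (r_time r) + Q.2) | Q <- r_create r].
  rewrite /= map_cat zip_cat ?size_map // -!map_comp !zipm addn0.
  by congr (_ :: _ ++ _); apply: eq_map => P /=; rewrite addn0.
split=> -[cS cS' [sigma [tau [rest [g p p']]]]]; split=> //; exists sigma, tau, rest; split=> //.
- by rewrite eL /= -catA.
- by rewrite eR /= -catA.
- by move: p; rewrite eL /= -catA.
- by move: p'; rewrite eR /= -catA.
Qed.

(** Exceeds every constant of the guard and every delay, so that differences truncated here decide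
    all constraints and offsets. *)
Definition bound_num r : nat :=
  (sumn (map tconstr_num (guard r)) + sumn (map snd (rhs_vars r))).+2.

Definition wf_rule r : bool :=
  all (fun c => all [in lhs_vars r] (tconstr_vars c)) (guard r).

Lemma rhs_vars_sub r p : p \in rhs_vars r -> p.1 \in lhs_vars r.
Proof.
case: r => [|r] /=; first by rewrite inE => /eqP ->.
rewrite inE mem_cat => /or3P[/eqP ->|/mapP [P Pr ->]|/mapP [Q Qr ->]] /=.
- exact: mem_head.
- by rewrite inE mem_cat map_f ?orbT.
- exact: mem_head.
Qed.

Section Instance.
Variables (r : rule Sg).
Hypothesis wf : wf_rule r.
Let nin := size (lhs_vars r).
Let nout := size (rhs_vars r).
Let V : finType := ('I_nin + 'I_nout)%type.
Variables (fi : nin.-tuple (gfact Sg k)) (fo : nout.-tuple (gfact Sg k)).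

(** There is one register for each occurrence of a time variable, not for each variable; that
    occurrences of the same variable agree is part of the condition. *)
Definition matches (val : V -> nat) : Prop := exists sigma tau,
  [/\ all (tconstr_holds tau) (guard r),
      map gval fi = lhs_facts sigma r, map gval fo = rhs_facts sigma r,
      forall i : 'I_nin, val (inl i) = tau (nth 0 (lhs_vars r) i) &
      forall i : 'I_nout, val (inr i) = tau (nth (0, 0) (rhs_vars r) i).1 +
                                        (nth (0, 0) (rhs_vars r) i).2].

(** A truncated difference below [B] is the exact one. *)
Lemma diffs_shift B (val val' : V -> nat) w w' c : c < B ->
  diffs B val = diffs B val' -> val w = val w' + c -> val' w = val' w' + c.
Proof.
move=> lt e ev.
have e1 := congr1 (fun d : {ffun _ -> 'I_B.+1} => nat_of_ord (d (Some w, Some w'))) e.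
have e2 := congr1 (fun d : {ffun _ -> 'I_B.+1} => nat_of_ord (d (Some w', Some w))) e.
move: e1 e2; rewrite /= !diffsE /=; lia.
Qed.

Lemma diffs_constr B (val val' : V -> nat) w w' (z : int) : `|z|%N < B ->
  diffs B val = diffs B val' ->
  (((val w')%:Z + z < (val w)%:Z)%R -> ((val' w')%:Z + z < (val' w)%:Z)%R) /\
  (((val w)%:Z == (val w')%:Z + z)%R -> ((val' w)%:Z == (val' w')%:Z + z)%R).
Proof.
move=> lt e.
have e1 := congr1 (fun d : {ffun _ -> 'I_B.+1} => nat_of_ord (d (Some w, Some w'))) e.
have e2 := congr1 (fun d : {ffun _ -> 'I_B.+1} => nat_of_ord (d (Some w', Some w))) e.
by move: e1 e2; rewrite /= !diffsE /=; lia.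
Qed.

(** The substitution is kept and the valuation is rebuilt from the new registers. Repeated
    occurrences agree because a difference 0 is preserved; guards and offsets survive because their
    constants lie below the truncation. *)
Lemma matches_diffs val val' : diffs (bound_num r) val = diffs (bound_num r) val' ->
  matches val -> matches val'.
Proof.
move=> e [sigma [tau [gu eli elo ei eo]]].
(* A variable takes the value of the register of its first occurrence. The default 0 concerns only
   variables absent from the left-hand side, which neither the guard nor the right-hand side
   mentions. *)
pose tau' T := if insub (index T (lhs_vars r)) is Some i then val' (inl (i : 'I_nin)) else 0.
have tauE T : T \in lhs_vars r -> exists i : 'I_nin, val (inl i) = tau T /\ val' (inl i) = tau' T.
  move=> TV; have lt : index T (lhs_vars r) < nin by rewrite index_mem.
  exists (Ordinal lt); split; last by rewrite /tau' insubT.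
  by rewrite ei /= nth_index.
have eq0 w w' : val w = val w' -> val' w = val' w'.
  by move=> ev; have := @diffs_shift _ val val' w w' 0 _ e; rewrite !addn0 => ->.
exists sigma, tau'; split=> //.
- apply/allP=> c cg; have /allP/(_ c cg) hv := wf; have /allP/(_ c cg) ht := gu.
  have lt : tconstr_num c < bound_num r.
    by rewrite /bound_num !ltnS; apply: leqW; apply: leq_trans (mem_sumn _ cg) (leq_addr _ _).
  case: c {cg} hv ht lt => T T' z /= /and3P[/tauE [i [e1 e1']] /tauE [i' [e2 e2']] _] ht lt;
    rewrite -e1' -e2'; rewrite -e1 -e2 in ht;
    by have [h1 h2] := diffs_constr (inl i) (inl i') lt e; [apply: h1 || apply: h2].
- move=> i; have [i' [e1 e2]] := tauE _ (mem_nth 0 (ltn_ord i)).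
  by rewrite -e2; apply: eq0; rewrite e1 ei.
- move=> o; have om := mem_nth (0, 0) (ltn_ord o).
  have [i [e1 e2]] := tauE _ (rhs_vars_sub om).
  rewrite -e2; apply: diffs_shift e _; last by rewrite eo e1.
  by rewrite /bound_num !ltnS; apply: leqW; apply: leq_trans (mem_sumn _ om) (leq_addl _ _).
Qed.

Definition ins : seq (gfact Sg k * V) := zip fi [seq inl i | i <- enum 'I_nin].
Definition outs : seq (gfact Sg k * V) := zip fo [seq inr i | i <- enum 'I_nout].

Lemma snd_ins_outs : map snd (ins ++ outs) =
  [seq inl i | i <- enum 'I_nin] ++ [seq inr i | i <- enum 'I_nout].
Proof.
by rewrite map_cat; congr (_ ++ _); apply: unzip2_zip;
  rewrite size_map size_enum_ord size_tuple.
Qed.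

Lemma uniq_ins_outs : uniq (map snd (ins ++ outs)).
Proof.
rewrite snd_ins_outs cat_uniq; apply/and3P; split.
- by rewrite map_inj_uniq ?enum_uniq // => ? ? [].
- by apply/hasPn=> _ /mapP [i _ ->]; apply/mapP=> -[].
- by rewrite map_inj_uniq ?enum_uniq // => ? ? [].
Qed.

Lemma mem_ins_outs w : w \in map snd (ins ++ outs).
Proof.
rewrite snd_ins_outs mem_cat; case: w => i; rewrite map_f ?mem_enum ?orbT //.
Qed.

Lemma ext_stamped n (f : n.-tuple (gfact Sg k)) (h : 'I_n -> V) (val : V -> nat) :
  ext (stamped (zip f [seq h i | i <- enum 'I_n]) val) =
  zip (map gval f) [seq val (h i) | i <- enum 'I_n].
Proof.
rewrite /ext /stamped -map_comp; have : size f = size [seq h i | i <- enum 'I_n].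
  by rewrite size_map size_enum_ord size_tuple.
have -> : [seq val (h i) | i <- enum 'I_n] = map val [seq h i | i <- enum 'I_n].
  by rewrite -map_comp.
by elim: (tval f) [seq h i | i <- enum 'I_n] => [|a l IH] [|b l'] //= [/IH ->].
Qed.

Lemma map_nth_ord (T U : Type) (x0 : T) (f : T -> U) (l : seq T) :
  [seq f (nth x0 l i) | i : 'I_(size l) <- enum 'I_(size l)] = map f l.
Proof.
rewrite -[in RHS](mkseq_nth x0 l) /mkseq -map_comp -val_enum_ord -map_comp.
by apply: eq_map.
Qed.

Lemma matches_step val : matches val -> exists sigma tau,
  [/\ all (tconstr_holds tau) (guard r),
      ext (stamped ins val) = zip (lhs_facts sigma r) (map tau (lhs_vars r)) &
      ext (stamped outs val) = zip (rhs_facts sigma r) [seq tau p.1 + p.2 | p <- rhs_vars r]].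
Proof.
case=> sigma [tau [gu eli elo ei eo]]; exists sigma, tau; split=> //.
- rewrite ext_stamped eli; congr zip.
  by rewrite (eq_map ei) (map_nth_ord 0 tau).
- rewrite ext_stamped elo; congr zip.
  by rewrite (eq_map eo) (map_nth_ord (0, 0) (fun p => tau p.1 + p.2)).
Qed.

End Instance.

Lemma step_matches r sigma tau :
  all (tconstr_holds tau) (guard r) ->
  all (@good_fact Sg k) (lhs_facts sigma r) -> all (@good_fact Sg k) (rhs_facts sigma r) ->
  exists (fi : (size (lhs_vars r)).-tuple (gfact Sg k))
         (fo : (size (rhs_vars r)).-tuple (gfact Sg k)) val,
  [/\ matches fi fo val,
      ext (stamped (ins fi) val) = zip (lhs_facts sigma r) (map tau (lhs_vars r)) &
      ext (stamped (outs fo) val) = zip (rhs_facts sigma r) [seq tau p.1 + p.2 | p <- rhs_vars r]].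
Proof.
have lift (l : seq (fact Sg)) n : size l = n -> all (@good_fact Sg k) l ->
    exists f : n.-tuple (gfact Sg k), map gval f = l.
  elim: l n => [|F l IH] [|n] //=; first by exists [tuple].
  move=> [/IH {}IH] /andP[/good_gfact [f fE] /IH [t tE]].
  by exists [tuple of f :: t]; rewrite /= fE tE.
move=> gu /(lift _ _ (size_lhs_facts _ _)) [fi fiE] /(lift _ _ (size_rhs_facts _ _)) [fo foE].
pose val (w : 'I_(size (lhs_vars r)) + 'I_(size (rhs_vars r))) := match w with
  | inl i => tau (nth 0 (lhs_vars r) i)
  | inr i => tau (nth (0, 0) (rhs_vars r) i).1 + (nth (0, 0) (rhs_vars r) i).2 end.
exists fi, fo, val; split.
- by exists sigma, tau; split.
- by rewrite ext_stamped fiE /= (map_nth_ord 0 tau).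
- by rewrite ext_stamped foE /= (map_nth_ord (0, 0) (fun p => tau p.1 + p.2)).
Qed.

End Schemas.

(** * Traces of progressive systems *)

Section Traces.
Variables (Sg : signature) (k : nat) (A : seq (irule Sg)).
Hypothesis HA : progressive A.
Implicit Types (S : config Sg) (tr : seq (rule Sg * config Sg)).

(** A configuration has a single time fact, so the head of the filtered list does not depend on the
    order. *)
Lemma global_time_perm S t rest : configuration k S ->
  perm_eq S ((time_fact Sg, t) :: rest) -> global_time S = t.
Proof.
case/andP=> _ /eqP c1 pe.
have it : is_time (time_fact Sg, t) by rewrite /is_time.
have := perm_filter (@is_time Sg) pe; rewrite /= it => pf.
have e0 : filter (@is_time Sg) rest = [::].
  apply/nilP; rewrite /nilp; have := perm_size pf.
  by rewrite /= size_filter c1 => -[<-].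
rewrite e0 in pf; rewrite /global_time.
by have -> := perm_small_eq _ pf.
Qed.

Definition is_tick (r : rule Sg) : bool := if r is Tick then true else false.

Lemma step_global_time r S S' : step k r S S' ->
  global_time S' = global_time S + is_tick r.
Proof.
case=> cS cS'; case: r => [|r] /=.
  move=> [t [rest [p p']]].
  by rewrite (global_time_perm cS p) (global_time_perm cS' p') addn1.
move=> [sigma [tau [rest [_ p p']]]].
by rewrite (global_time_perm cS p) (global_time_perm cS' p') addn0.
Qed.

Lemma step_size r S S' : in_system A r -> step k r S S' -> size S' = size S.
Proof.
case: r => [|r] /= hr [_ _].
  by move=> [t [rest [/perm_size -> /perm_size ->]]].
move=> [sigma [tau [rest [_ /perm_size -> /perm_size ->]]]].
have [_ bal _ _] := HA hr.
by rewrite /= !size_cat !size_map bal.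
Qed.

Definition due S : nat := count (fun G : timed_fact Sg => G.2 <= global_time S) S.

(* The consumed facts are due, and as many facts are created, one of them in the
   future. *)
Lemma step_due (r : irule Sg) S S' : r \in A -> step k (Inst r) S S' -> due S' < due S.
Proof.
move=> hr st; have gt := step_global_time st.
case: st => cS cS' /= [sigma [tau [rest [gu p p']]]].
have nowE := global_time_perm cS p.
have [_ bal [Q Qr Q1] past] := HA hr.
rewrite /due gt addn0 (permP p) (permP p') /= !count_cat.
rewrite !ltn_add2l ltn_add2r nowE.
have -> : count (fun G : timed_fact Sg => G.2 <= tau (r_time r))
    (map (inst sigma tau) (r_consume r)) = size (r_consume r).
  apply/eqP; rewrite -(size_map (inst sigma tau)) -all_count.
  by apply/allP=> _ /mapP [P Pr ->]; apply: past.
rewrite bal -(size_map (fun Q => (subst_fact sigma Q.1, tau (r_time r) + Q.2))).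
rewrite ltn_neqAle count_size andbT -all_count; apply/allPn.
exists (subst_fact sigma Q.1, tau (r_time r) + Q.2).
  exact: (map_f (fun Q => (subst_fact sigma Q.1, tau (r_time r) + Q.2))).
by rewrite -ltnNge /= -addn1 leq_add2l.
Qed.

Definition final S tr : config Sg := last S [seq x.2 | x <- tr].

Lemma trace_time S tr : is_trace k A S tr -> global_time S <= global_time (final S tr).
Proof.
elim: tr S => [|[r S'] tr IH] S //= [_ st /IH].
by rewrite (step_global_time st) => le; apply: leq_trans le; apply: leq_addr.
Qed.

(** An instantaneous step lowers [due], and a tick can raise it to at most the number of facts. Each
    tick thus accounts for itself and for at most [size S] further steps. *)
Lemma trace_length S tr : is_trace k A S tr ->
  size tr <= due S + (global_time (final S tr) - global_time S) * (size S).+1.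
Proof.
elim: tr S => [|[r S'] tr IH] S //= [hr st it].
have gt := step_global_time st; have le := trace_time it.
have {IH} := IH _ it; rewrite (step_size hr st) gt.
rewrite gt /final /= -/(final S' tr) in le *.
case: r hr st gt le => [|r] hr st gt le /= h; last first.
  by move: h (step_due hr st); rewrite addn0; lia.
have : due S' <= size S by rewrite -(step_size hr st); apply: count_size.
have -> : global_time (final S' tr) - global_time S =
  (global_time (final S' tr) - (global_time S + 1)).+1 by rewrite /= in le; lia.
by move: h; rewrite mulSn; lia.
Qed.

Definition max_delay : nat :=
  sumn [seq sumn [seq Q.2 | Q <- r_create r] | r <- A].

Definition stamps_bounded L S : bool :=
  all (fun G : timed_fact Sg => size (nat_bits G.2) <= L) S.

Lemma step_stamps L r S S' : in_system A r -> step k r S S' ->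
  stamps_bounded L S ->
  (forall c, c <= max_delay + is_tick r ->
     size (nat_bits (global_time S + c)) <= L) ->
  stamps_bounded L S'.
Proof.
move=> hr [cS cS']; case: r hr => [|r] /= hr.
  move=> [t [rest [p p']]]; rewrite /stamps_bounded (perm_all _ p) (perm_all _ p') /=.
  case/andP=> _ -> /(_ 1); rewrite (global_time_perm cS p) => h.
  by rewrite -[t.+1]addn1 h // addn1.
move=> [sigma [tau [rest [_ p p']]]].
rewrite /stamps_bounded (perm_all _ p) (perm_all _ p') /= !all_cat.
case/and4P=> -> -> _ -> h; rewrite andbT /=; apply/allP=> _ /mapP [Q Qr ->] /=.
rewrite -(global_time_perm cS p); apply: h; rewrite addn0.
apply: leq_trans (mem_sumn (fun Q : fact Sg * nat => Q.2) Qr) _.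
exact: (mem_sumn (fun r => sumn [seq Q.2 | Q <- r_create r]) hr).
Qed.

(** Stamps are created relative to the global time and not to the consumed stamps. Delays therefore
    do not accumulate: every new stamp is at most [t0 + n + max_delay], however long the trace
    is. *)
Lemma trace_stamps L t0 n S tr : is_trace k A S tr -> stamps_bounded L S ->
  t0 <= global_time S -> global_time (final S tr) <= t0 + n ->
  (forall c, c <= n + max_delay -> size (nat_bits (t0 + c)) <= L) ->
  all (stamps_bounded L) (S :: [seq x.2 | x <- tr]).
Proof.
elim: tr S => [|[r S'] tr IH] S /=; first by move=> _ ->.
move=> [hr st it] bS t0S; rewrite /final /= -/(final S' tr) => fin h; rewrite bS /=.
have gt := step_global_time st; have le := trace_time it.
apply: (IH _ it) => //; last by rewrite gt; apply: leq_trans t0S (leq_addr _ _).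
apply: step_stamps hr st bS _ => c cle.
have -> : global_time S + c = t0 + (global_time S - t0 + c) by lia.
by apply: h; rewrite gt in le; lia.
Qed.

Lemma trace_sizes S tr : is_trace k A S tr ->
  all (fun S' => size S' == size S) (S :: [seq x.2 | x <- tr]).
Proof.
elim: tr S => [|[r S'] tr IH] S /=; first by rewrite eqxx.
by move=> [hr st /IH]; rewrite /= (step_size hr st) eqxx.
Qed.

(** The number of facts is constant and at most the length of the encoding, which also bounds the
    digits of every initial stamp, in particular of the initial global time; adding up to
    [n + max_delay] costs at most as many further digits. *)
Lemma trace_weight n S tr : is_trace k A S tr ->
  configuration k S ->
  global_time (final S tr) = global_time S + n ->
  all (fun S' => weight S' <=
         size (encode S) * (size (encode S) + n + max_delay).+2)
      (S :: [seq x.2 | x <- tr]).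
Proof.
move=> it cS fin; set L := size (encode S) + n + max_delay.
have : all (stamps_bounded L) (S :: [seq x.2 | x <- tr]).
  apply: (trace_stamps it (t0 := global_time S) (n := n)) => //; last first.
  - move=> c cle; apply: leq_trans (size_nat_bitsD _ _) _.
    rewrite /L -addnA; apply: leq_add cle.
    have : has (@is_time Sg) S by rewrite has_count; case/andP: cS => _ /eqP ->.
    case/hasP=> -[F t] GS /eqP /= FE.
    have -> : global_time S = t.
      by apply: (global_time_perm (rest := rem (F, t) S)) => //; rewrite -FE; apply: perm_to_rem.
    exact: bits_encode GS.
  - by rewrite fin.
  - apply/allP=> G /bits_encode le; apply: leq_trans le _.
    by rewrite /L -addnA leq_addr.
have /allP szs := trace_sizes it.
move/allP=> bnd; apply/allP=> S' S'in.
apply: leq_trans (weight_le (L := L) _) _.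
  by move=> G GS; have /allP := bnd _ S'in; apply.
by rewrite (eqP (szs _ S'in)) leq_mul2r size_encode_ge orbT.
Qed.

End Traces.

(** * Applying the rules *)

(** The coefficients are natural numbers, so every such polynomial is monotone. *)
Lemma horner_nat_mono (p : {poly nat}) (a b : nat) :
  a <= b -> p.[a]%R <= p.[b]%R.
Proof.
move=> ab; elim/poly_ind: p => [|p c IH]; first by rewrite !horner0.
by rewrite !hornerMXaddC; apply: leq_add => //; apply: leq_mul.
Qed.

(** Closure under the operations spares writing out the final bound as a polynomial. *)
Definition polynomial (f : nat -> nat) : Prop :=
  exists q : {poly nat}, forall x, f x = q.[x]%R.

Lemma polynomial_const c : polynomial (fun=> c).
Proof. by exists c%:P%R => x; rewrite hornerC. Qed.

Lemma polynomial_id : polynomial id.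
Proof. by exists 'X%R => x; rewrite hornerX. Qed.

Lemma polynomial_add f g : polynomial f -> polynomial g ->
  polynomial (fun x => f x + g x).
Proof. by move=> [p pE] [q qE]; exists (p + q)%R => x; rewrite hornerD -pE -qE. Qed.

Lemma polynomial_mul f g : polynomial f -> polynomial g ->
  polynomial (fun x => f x * g x).
Proof. by move=> [p pE] [q qE]; exists (p * q)%R => x; rewrite hornerM -pE -qE. Qed.

Lemma polynomial_succ f : polynomial f -> polynomial (fun x => (f x).+1).
Proof.
move=> pf; have [q qE] := polynomial_add (polynomial_const 1) pf.
by exists q => x; rewrite -qE add1n.
Qed.

Lemma polynomial_comp (p : {poly nat}) f : polynomial f ->
  polynomial (fun x => p.[f x]%R).
Proof. by move=> [q qE]; exists (p \Po q)%R => x; rewrite horner_comp -qE. Qed.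

(** Provides the partial inverse [rown] of the naming of registers, by search in a finite type. *)
Lemma pick_inverse (V J : finType) (r : V -> J) : injective r ->
  (forall w, [pick w' | r w' == r w] = Some w) /\
  (forall j w, [pick w' | r w' == j] = Some w -> j = r w).
Proof.
move=> inj; split=> [w|j w]; first by case: pickP => [w' /eqP /inj -> //|/(_ w)]; rewrite eqxx.
by case: pickP => // w' /eqP <- [<-].
Qed.

Lemma pick_none (V J : finType) (r : V -> J) j : (forall w, r w != j) ->
  [pick w' | r w' == j] = None.
Proof. by move=> ne; case: pickP => // w; rewrite (negPf (ne w)). Qed.

(** * Ground instances of the rules as programs *)

Section Rules.
Variables (Sg : signature) (k : nat) (A : seq (irule Sg)).
Hypothesis HA : progressive A.

Lemma in_system_wf r : in_system A r -> wf_rule r.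
Proof.
case: r => [//|r] /= /HA [/andP[_ wf] _ _ _].
apply/allP=> c cg; have /allP/(_ c cg)/allP h := wf.
by apply/allP=> T /h; rewrite /= map_cat.
Qed.

Lemma count_time_zip (l : seq (fact Sg)) (ts : seq nat) : size l = size ts ->
  count (@is_time Sg) (zip l ts) = count (pred1 (time_fact Sg)) l.
Proof. by move=> e; rewrite -{2}(@unzip1_zip _ _ l ts) ?e // count_map. Qed.

(** Well-formed rules use the time predicate nowhere else. Hence rewriting keeps the time fact
    unique, and the result is again a configuration. *)
Lemma count_time_facts r sigma : in_system A r ->
  count (pred1 (time_fact Sg)) (lhs_facts sigma r) = 1 /\
  count (pred1 (time_fact Sg)) (rhs_facts sigma r) = 1.
Proof.
case: r => [|r] /=; first by rewrite !eqxx.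
move=> /HA [/andP[/allP wf _] _ _ _].
have nt (T : Type) (l : seq (fact Sg * T)) :
    (forall P, P \in map fst l -> P.1 != time_sym Sg) ->
    count (pred1 (time_fact Sg)) [seq subst_fact sigma P.1 | P <- l] = 0.
  elim: l => //= P l IH h; rewrite IH ?addn0 => [|P' P'l]; last first.
    by apply: h; rewrite inE P'l orbT.
  have := h P.1; rewrite mem_head => /(_ isT) ne.
  by apply/eqP; rewrite eqb0; apply: contra ne => /eqP [->].
by rewrite !eqxx !count_cat !nt // => P Pl;
  have /wf/andP[] : P \in map fst (r_keep r ++ r_consume r) ++ map fst (r_create r)
  by rewrite map_cat !mem_cat Pl ?orbT.
Qed.

Section RuleProg.
Variables (J G : finType) (gi : isym (gfact Sg k) -> G) (jC jD : J).
Hypothesis gi_inj : injective gi.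
Hypothesis neCD : jC != jD.
Variables (r : rule Sg).
Hypothesis rA : in_system A r.
Let V : finType := ('I_(size (lhs_vars r)) + 'I_(size (rhs_vars r)))%type.
Variable reg : V -> J.
Hypothesis reg_inj : injective reg.
Hypothesis regC : forall w, reg w != jC.
Hypothesis regD : forall w, reg w != jD.
Let rown j := [pick w | reg w == j].
Let reg_r : forall w, rown (reg w) = Some w := proj1 (pick_inverse reg_inj).
Let r_reg : forall j w, rown j = Some w -> j = reg w := proj2 (pick_inverse reg_inj).

(** The choice ranges over all tuples of ground facts of the right lengths; [matches], tested while
    the stamps are guessed, discards those that do not come from one common substitution. *)
Definition rule_prog : prog J G :=
  alt (fun f : (size (lhs_vars r)).-tuple (gfact Sg k) *
               (size (rhs_vars r)).-tuple (gfact Sg k) =>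
    rewriting gi jC jD reg (bound_num r) (matches f.1 f.2) (ins f.1) (outs f.2)).

Lemma may_rule_prog s m : configuration k (ext s) ->
  may rule_prog (conf gi jC s) m ->
  exists2 s', m = conf gi jC s' & step k r (ext s) (ext s').
Proof.
move=> cs /may_alt [[fi fo]] /=.
case/(may_rewriting gi_inj neCD (rown := rown) reg_r r_reg (pick_none regC) (pick_none regD)
  (ltn0Sn _) (@matches_diffs _ _ _ (in_system_wf rA) fi fo) (uniq_ins_outs fi fo) (mem_ins_outs fi fo)).
move=> val [rest [ma pe ->]]; exists (rev (stamped (outs fo) val) ++ rest) => //.
have [sigma [tau [gu eI eO]]] := matches_step ma.
have pe1 : perm_eq (ext s) (zip (lhs_facts sigma r) (map tau (lhs_vars r)) ++ ext rest).
  by rewrite -eI -ext_cat perm_ext.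
have pe2 : perm_eq (ext (rev (stamped (outs fo) val) ++ rest))
    (zip (rhs_facts sigma r) [seq tau p.1 + p.2 | p <- rhs_vars r] ++ ext rest).
  by rewrite -eO -ext_cat perm_ext perm_cat2r perm_rev.
apply/stepE; split=> //; last by exists sigma, tau, (ext rest).
have [cl cr] := count_time_facts sigma rA.
have c0 : count (@is_time Sg) (ext rest) = 0.
  case/andP: cs => _ /eqP; rewrite (permP pe1) count_cat.
  by rewrite (count_time_zip (l := lhs_facts sigma r)) ?size_lhs_facts ?size_map // cl => -[].
have := permP pe2 (@is_time Sg); rewrite count_cat c0.
rewrite (count_time_zip (l := rhs_facts sigma r)) ?size_rhs_facts ?size_map // cr.
by rewrite configuration_ext /ext count_map addn0 => e; apply/eqP.
Qed.

Lemma bits_weight (S : config Sg) g : g \in S -> size (nat_bits g.2) <= weight S.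
Proof.
by move=> gS; apply: leq_trans (mem_sumn (@fact_weight Sg) gS); apply: leqW; apply: leqnSn.
Qed.

Lemma can_rule_prog s S' N : step k r (ext s) S' ->
  weight (ext s) <= N -> weight S' <= N ->
  exists2 s', perm_eq S' (ext s') &
    can rule_prog (conf gi jC s) (conf gi jC s')
      ((5 * #|V| + 44 * size (lhs_vars r) + 44 * size (rhs_vars r) + 12) * N.+1).
Proof.
case/stepE=> cS cS' [sigma [tau [rest [gu pe1 pe2]]]] w1 w2.
have good (S : config Sg) : configuration k S -> all (fun g => good_fact k g.1) S.
  by case/andP.
have zipg (l : seq (fact Sg)) (ts : seq nat) : size l = size ts ->
    all (fun g => good_fact k g.1) (zip l ts) -> all (@good_fact Sg k) l.
  by move=> e; rewrite -{2}(@unzip1_zip _ _ l ts) ?e // all_map.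
have := good _ cS; rewrite (perm_all _ pe1) all_cat => /andP[/zipg g1 gr].
have := good _ cS'; rewrite (perm_all _ pe2) all_cat => /andP[/zipg g2 _].
rewrite size_lhs_facts size_map in g1; rewrite size_rhs_facts size_map in g2.
have [fi [fo [val [ma eI eO]]]] := step_matches gu (g1 erefl) (g2 erefl).
have [resti eR] := all_good_ext gr.
rewrite -eI eR -ext_cat perm_ext in pe1; rewrite -eO eR -ext_cat in pe2.
have [||rest' pr c] := can_rewriting (n := N) gi neCD (rown := rown) reg_r r_reg (pick_none regC) (pick_none regD)
  (ltn0Sn _ : 0 < bound_num r) (uniq_ins_outs fi fo) (mem_ins_outs fi fo) ma pe1.
- by rewrite size_repr.
(* Every register holds the stamp of a fact of the configuration before or after the step, so its
   length is bounded by one of the two weights. *)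
- move=> w; have := mem_ins_outs fi fo w; rewrite map_cat mem_cat.
  case/orP=> /mapP [p pin ->].
    apply: leq_trans w1; apply: (bits_weight (g := (gval p.1, val p.2))).
    have : (p.1, val p.2) \in s.
      by rewrite (perm_mem pe1) mem_cat (map_f (fun p => (p.1, val p.2)) pin).
    by move/(map_f (fun g => (gval g.1, g.2))).
  apply: leq_trans w2; apply: (bits_weight (g := (gval p.1, val p.2))).
  rewrite (perm_mem pe2); apply: (map_f (fun g => (gval g.1, g.2)) (x := (p.1, val p.2))).
  by rewrite mem_cat (map_f (fun p => (p.1, val p.2)) pin).
exists (rev (stamped (outs fo) val) ++ rest').
  rewrite (permPl pe2) perm_ext.
  by apply: perm_cat => //; rewrite perm_sym perm_rev.
apply: can_le (can_alt (i := (fi, fo)) c) _.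
have -> : size (ins fi) = size (lhs_vars r).
  by rewrite size_zip size_map size_enum_ord size_tuple minnn.
have -> : size (outs fo) = size (rhs_vars r).
  by rewrite size_zip size_map size_enum_ord size_tuple minnn.
set z := 5 * _ + _ + _; rewrite (mulnDl z 10) (mulnDl z 12) -addnA leq_add2l; lia.
Qed.

End RuleProg.
End Rules.

(** * Realizability along a trace and invariance under permutation *)

Section Realizable.
Variables (Sg : signature) (k : nat) (A : seq (irule Sg)) (CS : crit_spec Sg).
Implicit Type S : config Sg.
Notation tbr n S := (time_bounded_realizable n k A CS S).

Lemma realizable_nil S : ~ is_critical CS S -> tbr 0 S.
Proof. by move=> nc; exists [::]; split=> //=; rewrite addn0. Qed.

Lemma realizable_cons n r S S' : in_system A r -> step k r S S' ->
  ~ is_critical CS S -> (is_tick r -> no_instantaneous k A S) ->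
  tbr n S' -> tbr (n + is_tick r) S.
Proof.
move=> rA st nc lz [tr [it la co gt]]; exists ((r, S') :: tr); split=> //=.
- by split=> //; case: r rA st lz => //= _ _ /(_ isT).
- by rewrite gt (step_global_time st) -addnA; congr (_ + _); rewrite addnC.
Qed.

Lemma is_critical_perm S S' : perm_eq S S' -> is_critical CS S -> is_critical CS S'.
Proof.
move=> pe [SC SCin [sigma [tau [rest [p h]]]]]; exists SC => //.
by exists sigma, tau, rest; split=> //; rewrite -(permPl pe).
Qed.

Lemma configuration_perm S S' : perm_eq S S' -> configuration k S = configuration k S'.
Proof. by move=> pe; rewrite /configuration (perm_all _ pe) (permP pe). Qed.

Lemma step_perm r S S' S1 : perm_eq S S1 -> step k r S S' -> step k r S1 S'.
Proof.
move=> pe /stepE [cS cS' [sigma [tau [rest [g p p']]]]]; apply/stepE.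
split=> //; first by rewrite -(configuration_perm pe).
by exists sigma, tau, rest; split=> //; rewrite -(permPl pe).
Qed.

Lemma no_instantaneous_perm S S' : perm_eq S S' ->
  no_instantaneous k A S -> no_instantaneous k A S'.
Proof.
move=> pe h r rA [S2 st]; apply: (h r rA); exists S2.
by apply: step_perm st; rewrite perm_sym.
Qed.

Lemma compliant_head S tr : compliant CS S tr -> ~ is_critical CS S.
Proof. by case: tr => [|[r S'] tr] []. Qed.

End Realizable.

(** * The verifier *)

Section Verifier.
Variables (n : nat) (Sg : signature) (A : seq (irule Sg)) (CS : crit_spec Sg) (k : nat).
Hypothesis HA : progressive A.
Variables (critical must_tick : config Sg -> bool).
Hypothesis critical_spec : forall S, configuration k S ->
  (critical S <-> is_critical CS S).
Hypothesis must_tick_spec : forall S, configuration k S ->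
  (must_tick S <-> no_instantaneous k A S).
Variables (Mc Mt : turing_machine (char Sg)) (pc pt : {poly nat}).
Hypothesis Mc_spec : forall S, configuration k S ->
  tm_answer pc.[size (encode S)]%R [:: input_word Mc (encode S)] = Some (critical S).
Hypothesis Mt_spec : forall S, configuration k S ->
  tm_answer pt.[size (encode S)]%R [:: input_word Mt (encode S)] = Some (must_tick S).

Let F := gfact Sg k.
Let rule_of (o : option 'I_(size A)) : rule Sg :=
  if o is Some i then Inst (tnth (in_tuple A) i) else @Tick Sg.
Let V (o : option 'I_(size A)) : finType :=
  ('I_(size (lhs_vars (rule_of o))) + 'I_(size (rhs_vars (rule_of o))))%type.
(** The stacks: configuration, scratch and input, the registers of every rule, and two for each tape
    of the two machines. *)
Let J : finType := ((option bool + {o : option 'I_(size A) & V o}) +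
  (('I_(tm_tapes Mc).+2 * bool) + ('I_(tm_tapes Mt).+2 * bool)))%type.
Let G : finType := ((option (F + bool) + char Sg) +
  (option (char Sg + tm_extra Mc) + option (char Sg + tm_extra Mt)))%type.

Let jC : J := inl (inl None).
Let jD : J := inl (inl (Some false)).
Let jI : J := inl (inl (Some true)).
Let reg o (w : V o) : J := inl (inr (Tagged V w)).
Let stc i b : J := inr (inl (i, b)).
Let stt i b : J := inr (inr (i, b)).
Let gi (a : isym F) : G := inl (inl a).
Let inX (x : char Sg) : G := inl (inr x).
Let csc c : G := inr (inl c).
Let cst c : G := inr (inr c).

Let gi_inj : injective gi. Proof. by move=> a b []. Qed.
Let inX_inj : injective inX. Proof. by move=> a b []. Qed.
Let csc_inj : injective csc. Proof. by move=> a b []. Qed.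
Let cst_inj : injective cst. Proof. by move=> a b []. Qed.
Let reg_inj o : injective (@reg o).
Proof. by move=> a b [] /eqP; rewrite eq_Tagged => /eqP. Qed.

Let ownc (j : J) := if j is inr (inl p) then Some p else None.
Let ownt (j : J) := if j is inr (inr p) then Some p else None.
Let own_stc i b : ownc (stc i b) = Some (i, b). Proof. by []. Qed.
Let own_stt i b : ownt (stt i b) = Some (i, b). Proof. by []. Qed.
Let st_ownc j i b : ownc j = Some (i, b) -> j = stc i b.
Proof. by case: j => [|[p|]] //= [->]. Qed.
Let st_ownt j i b : ownt j = Some (i, b) -> j = stt i b.
Proof. by case: j => [|[|p]] //= [->]. Qed.

Let enc : isym F -> seq (char Sg) := @enc_sym Sg k.
Let H := \max_(a : option (F + bool)) size (enc a).
Let encH (a : isym F) : size (enc a) <= H.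
Proof. exact: (leq_bigmax (F := fun a => size (enc a))). Qed.

Notation cfg s := (conf gi jC s).

(** The required answer is [false] here, the configuration not being critical, and [true] for
    [must], a tick being due. *)
Let check := run_machine csc stc false gi enc jC jD.
Let must := run_machine cst stt true gi enc jC jD.
Let apply_rule o := rule_prog gi jC jD (@reg o).

Let cfgC s : cfg s jC = map gi (repr s). Proof. by rewrite ffunE eqxx. Qed.
Let cfgD s : cfg s jD = [::]. Proof. by rewrite ffunE. Qed.

Let cfg_stc s i b : cfg s (stc i b) = [::]. Proof. by rewrite ffunE. Qed.
Let cfg_stt s i b : cfg s (stt i b) = [::]. Proof. by rewrite ffunE. Qed.

Let Mc_enc (s : seq (F * nat)) : configuration k (ext s) ->
  tm_answer pc.[size (encode (ext s))]%R [:: input_word Mc (flatten (map enc (repr s)))]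
  = Some (critical (ext s)).
Proof. by move=> cs; rewrite encode_repr; apply: Mc_spec. Qed.

Let Mt_enc (s : seq (F * nat)) : configuration k (ext s) ->
  tm_answer pt.[size (encode (ext s))]%R [:: input_word Mt (flatten (map enc (repr s)))]
  = Some (must_tick (ext s)).
Proof. by move=> cs; rewrite encode_repr; apply: Mt_spec. Qed.

Let may_check (s : seq (F * nat)) m : configuration k (ext s) ->
  may check (cfg s) m -> m = cfg s /\ ~ is_critical CS (ext s).
Proof.
move=> cs /(may_run_machine csc_inj own_stc st_ownc gi_inj
  (erefl : ownc jC = None) (erefl : ownc jD = None) isT (cfgC s) (cfgD s) (cfg_stc s) (Mc_enc cs)).
case=> -> nc.
by split=> // /critical_spec; rewrite nc => /(_ cs).
Qed.

Let may_must (s : seq (F * nat)) m : configuration k (ext s) ->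
  may must (cfg s) m -> m = cfg s /\ no_instantaneous k A (ext s).
Proof.
move=> cs /(may_run_machine cst_inj own_stt st_ownt gi_inj
  (erefl : ownt jC = None) (erefl : ownt jD = None) isT (cfgC s) (cfgD s) (cfg_stt s) (Mt_enc cs)).
case=> -> nc.
by split=> //; apply/must_tick_spec.
Qed.

(** The edge [inl i] is the tick leading from [i] to [i + 1], and [inr i] a loop for the
    instantaneous rules. As [n] is fixed, the ticks are counted by the control. *)
Let edge : finType := ('I_n + 'I_n.+1)%type.
Let src (e : edge) : 'I_n.+1 :=
  match e with inl i => widen_ord (leqnSn n) i | inr i => i end.
Let tgt (e : edge) : 'I_n.+1 :=
  match e with inl i => lift ord0 i | inr i => i end.
Let body (e : edge) : prog J G :=
  if e is inl _ then seqp must (seqp (apply_rule None) check)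
  else seqp (alt (fun i => apply_rule (Some i))) check.

(* State [i] of the graph: [i] ticks have been performed. *)
Let search i := Graph src tgt body i ord_max.
Let verifier :=
  seqp (parse gi inX jC jI enc (@is_tick_fact Sg k)) (seqp check (search ord0)).

Let rule_of_in o : in_system A (rule_of o).
Proof. by case: o => //= i; apply: mem_tnth. Qed.

Let may_apply o (s : seq (F * nat)) m : configuration k (ext s) ->
  may (apply_rule o) (cfg s) m ->
  exists2 s', m = cfg s' & step k (rule_of o) (ext s) (ext s').
Proof.
move=> cs; exact: (may_rule_prog HA gi_inj _ (rule_of_in o) (@reg_inj o)).
Qed.

Notation tbr n S := (time_bounded_realizable n k A CS S).

Let may_verifier x m : may verifier (input_store inX jI x) m ->
  exists s : seq (F * nat), [/\ x = encode (ext s), configuration k (ext s) &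
    tbr n (ext s)].
Proof.
case/may_seq=> m1 /(may_parse inX_inj) [//|s0 [c1 xE ->]].
have cs0 : configuration k (ext s0) by rewrite configuration_ext; apply/eqP.
case/may_seq=> m2 /(may_check cs0) [-> nc0] h.
exists s0; split=> //; first by rewrite xE encode_repr.
(* The run extends the trace at its end, whereas [realizable_cons] adds a step in front. The
   invariant therefore says that every continuation from [s] yields a trace from [s0]. *)
pose P (i : 'I_n.+1) m := exists s : seq (F * nat), [/\ m = cfg s,
  configuration k (ext s), ~ is_critical CS (ext s) &
  forall n', tbr n' (ext s) -> tbr (n' + i) (ext s0)].
have [s [_ _ nc]] : P ord_max m.
  apply: (may_graph_ind (P := P)) h _; last by exists s0; split=> // n'; rewrite addn0.
  case=> [i|i] s1 s2 [s [-> cs nc tb]] /=.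
    case/may_seq=> m3 /(may_must cs) [-> ni] /may_seq [m4] /(may_apply cs) [s' -> st].
    have cs' : configuration k (ext s') by case: st.
    move/(may_check cs') => [-> nc']; exists s'; split=> // n' tb'.
    rewrite lift0 -addSnnS -addn1; apply: tb.
    exact: (@realizable_cons _ _ _ _ _ (@Tick Sg) _ (ext s')) tb'.
  case/may_seq=> m3 /may_alt [o] /(may_apply cs) [s' -> st].
  have cs' : configuration k (ext s') by case: st.
  move/(may_check cs') => [-> nc']; exists s'; split=> // n' tb'.
  apply: tb; rewrite -[n']addn0.
  by apply: (@realizable_cons _ _ _ _ _ (rule_of (Some o)) _ (ext s')) tb' => //; apply: rule_of_in.
by move=> /(_ 0 (realizable_nil _ _ nc)).
Qed.

Let rule_cost := \max_(o : option 'I_(size A))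
  (5 * #|V o| + 44 * size (lhs_vars (rule_of o)) + 44 * size (rhs_vars (rule_of o)) + 12).

Let can_apply o (s : seq (F * nat)) S' N : step k (rule_of o) (ext s) S' ->
  weight (ext s) <= N -> weight S' <= N ->
  exists2 s', perm_eq S' (ext s') &
    can (apply_rule o) (cfg s) (cfg s') (rule_cost * N.+1).
Proof.
move=> st w1 w2.
have [s' pe c] := can_rule_prog gi (isT : jC != jD) (@reg_inj o)
  (fun w => isT : reg w != jC) (fun w => isT : reg w != jD) st w1 w2.
exists s' => //; apply: can_le c _; rewrite leq_mul2r; apply/orP; right.
exact: (leq_bigmax (F := fun o => 5 * #|V o| + 44 * size (lhs_vars (rule_of o)) +
  44 * size (rhs_vars (rule_of o)) + 12) o).
Qed.

Let encode_le (s : seq (F * nat)) N : weight (ext s) <= N ->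
  size (encode (ext s)) <= H * N.
Proof.
move=> le; rewrite -encode_repr; apply: (@leq_trans (H * size (repr s))).
  elim: (repr s) => //= a u IH; rewrite size_cat mulnS.
  exact: leq_add (encH a) IH.
by rewrite leq_mul2l size_repr le orbT.
Qed.

Let can_check : exists K, forall (s : seq (F * nat)) N, configuration k (ext s) ->
  ~ is_critical CS (ext s) -> weight (ext s) <= N ->
  can check (cfg s) (cfg s) (K * (pc.[H * N]%R + N).+1).
Proof.
have [K HK] := can_run_machine csc own_stc st_ownc false gi
  (erefl : ownc jC = None) (erefl : ownc jD = None) isT encH.
exists K => s N cs nc le.
have ans := Mc_enc cs.
have ncr : critical (ext s) = false by apply/negP=> /(critical_spec cs) /nc.
rewrite ncr in ans.
apply: can_le (HK _ _ _ (cfgC s) (cfgD s) (cfg_stc s) ans) _.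
rewrite leq_mul2l ltnS; apply/orP; right; apply: leq_add; last by rewrite size_repr.
exact: horner_nat_mono (encode_le le).
Qed.

Let can_must : exists K, forall (s : seq (F * nat)) N, configuration k (ext s) ->
  no_instantaneous k A (ext s) -> weight (ext s) <= N ->
  can must (cfg s) (cfg s) (K * (pt.[H * N]%R + N).+1).
Proof.
have [K HK] := can_run_machine cst own_stt st_ownt true gi
  (erefl : ownt jC = None) (erefl : ownt jD = None) isT encH.
exists K => s N cs ni le.
have ans := Mt_enc cs; rewrite (introT idP (proj2 (must_tick_spec cs) ni)) in ans.
apply: can_le (HK _ _ _ (cfgC s) (cfgD s) (cfg_stt s) ans) _.
rewrite leq_mul2l ltnS; apply/orP; right; apply: leq_add; last by rewrite size_repr.
exact: horner_nat_mono (encode_le le).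
Qed.

(** The run follows the trace up to permutation, the vertex [i] recording the [n - i] ticks to come.
    A tick edge is the dearest: three programs of cost [T], two compositions and the edge make
    [3 * T + 10]. *)
Let can_search T (N : nat) :
  (forall s : seq (F * nat), configuration k (ext s) ->
     ~ is_critical CS (ext s) -> weight (ext s) <= N -> can check (cfg s) (cfg s) T) ->
  (forall s : seq (F * nat), configuration k (ext s) ->
     no_instantaneous k A (ext s) -> weight (ext s) <= N -> can must (cfg s) (cfg s) T) ->
  (rule_cost * N.+1 <= T) ->
  forall tr S s (i : 'I_n.+1), perm_eq S (ext s) -> is_trace k A S tr ->
  lazy_sampling k A S tr -> compliant CS S tr ->
  all (fun S' => weight S' <= N) (S :: [seq x.2 | x <- tr]) ->
  global_time (final S tr) = global_time S + (n - i) ->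
  exists m, can (search i) (cfg s) m ((3 * T + 12) * size tr).
Proof.
move=> hc hm hr; elim=> [|[r S'] tr IH] S s i pe /=.
  rewrite /final /= => _ _ _ _ gt.
  (* With no step left the global time does not advance, so [n - i] is 0. *)
  have -> : i = ord_max by apply: val_inj => /=; have := ltn_ord i; lia.
  by exists (cfg s); apply: can_le (can_graph_nil _ _ _ _ _) _.
move=> [rA st it] [lz la] [nc co] /andP[wS wS']; rewrite /final /= -/(final S' tr) => gt.
have {}wS' : all (fun S' => weight S' <= N) (S' :: [seq x.2 | x <- tr]) by [].
have wS1 : weight S' <= N by case/andP: wS'.
have ws : weight (ext s) <= N by rewrite -(perm_weight pe).
have st1 := step_perm pe st.
have cs : configuration k (ext s) by case: st1.
have cS' : configuration k S' by case: st.
have gt1 := step_global_time st; have gt2 := trace_time it.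
have next_check s' : perm_eq S' (ext s') -> can check (cfg s') (cfg s') T.
  move=> pe'; apply: hc; rewrite -?(perm_weight pe') -?(configuration_perm _ pe') //.
  by move=> cr; apply: (compliant_head co); apply: is_critical_perm cr; rewrite perm_sym.
case: r rA st lz st1 gt1 => [|r] rA st lz st1 /= gt1.
  have lt : i < n by rewrite gt1 in gt2; move: (ltn_ord i) => ?; lia.
  have [s' pe' h2] := can_apply (o := None) st1 ws wS1.
  have h1 := hm s cs (no_instantaneous_perm pe lz) ws.
  have [|m h] := IH S' s' (lift ord0 (Ordinal lt)) pe' it la co wS'.
    by rewrite gt gt1 lift0 /=; lia.
  exists m; have eqi : i = src (inl (Ordinal lt)) by apply: val_inj.
  rewrite [i]eqi.
  have hb := can_seq h1 (can_seq (can_le h2 hr) (next_check s' pe')).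
  apply: can_le (can_graph_cons (e := inl (Ordinal lt)) hb h) _.
  by rewrite mulnS; lia.
have /tnthP [j rE] : r \in in_tuple A := rA.
rewrite rE in st1.
have [s' pe' h2] := can_apply (o := Some j) st1 ws wS1.
have [|m h] := IH S' s' i pe' it la co wS'.
  by rewrite gt gt1 addn0.
exists m.
have hb := can_seq (can_alt (f := fun i => apply_rule (Some i)) (can_le h2 hr)) (next_check s' pe').
apply: can_le (can_graph_cons (e := inr i) hb h) _.
by rewrite mulnS; lia.
Qed.

Lemma realizability_in_NP : in_NP (fun x : seq (char Sg) =>
    exists (S0 : config Sg) (m Dmax : nat),
      [/\ x = encode S0, initial_data k A CS S0 m Dmax & tbr n S0]).
Proof.
have [Kc hc] := can_check; have [Kt ht] := can_must.
(* [N] is the bound of [trace_weight]. [T] adds up the costs of both tests and of a rule, so it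
   bounds each of them. In [B] come parsing, the initial test and the search, whose number of steps
   [x + n * x.+1] is that of [trace_length]. *)
pose N x := x * (x + n + max_delay A).+2.
pose T x := Kc * (pc.[H * N x]%R + N x).+1 + Kt * (pt.[H * N x]%R + N x).+1 +
  rule_cost * (N x).+1.
pose B x := (5 * H + 22) * (N x).+1 + (T x + (3 * T x + 12) * (x + n * x.+1) + 4) + 4.
have pK c : polynomial (fun=> c) by apply: polynomial_const.
have pX := polynomial_id.
have pN : polynomial N.
  apply: (polynomial_mul pX); do 2!apply: polynomial_succ.
  exact: (polynomial_add (polynomial_add pX (pK n)) (pK (max_delay A))).
have pHN := polynomial_mul (pK H) pN.
have pT : polynomial T.
  apply: (polynomial_add (polynomial_add _ _) (polynomial_mul (pK rule_cost) (polynomial_succ pN))).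
    exact: (polynomial_mul (pK Kc) (polynomial_succ (polynomial_add (polynomial_comp pc pHN) pN))).
  exact: (polynomial_mul (pK Kt) (polynomial_succ (polynomial_add (polynomial_comp pt pHN) pN))).
have [q qE] : polynomial B.
  apply: (polynomial_add (polynomial_add (polynomial_mul (pK (5 * H + 22)) (polynomial_succ pN)) _) (pK 4)).
  apply: (polynomial_add (polynomial_add pT (polynomial_mul _ _)) (pK 4)).
    exact: (polynomial_add (polynomial_mul (pK 3) pT) (pK 12)).
  exact: (polynomial_add pX (polynomial_mul (pK n) (polynomial_succ pX))).
apply: (prog_in_NP (inX := inX) (jI := jI) (p := verifier) (q := q)).
  move=> x m t d; have [|s [-> cs tb]] := @may_verifier x m; first by exists t.
  (* The sum of all the numbers serves as [Dmax]. *)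
  exists (ext s), (size (ext s)), (sumn (numbers A CS (ext s))); split=> //; split=> //.
  by apply/allP=> d' d'in; rewrite -[d']/(id d') -[numbers _ _ _]map_id mem_sumn.
move=> x [S0 [m [D [xE [cS0 _ _] [tr [it la co gt]]]]]].
have [s sE] := configuration_exP cS0; subst S0.
set X := size x.
have wt := trace_weight HA it cS0 gt; rewrite -xE -/X -/(N X) in wt.
have ws : weight (ext s) <= N X by case/andP: wt.
have h1 := can_parse gi inX (jC := jC) (jI := jI) (is_t := @is_tick_fact Sg k) (S := s) isT encH.
have {}h1 := h1 _; rewrite configuration_ext in cS0.
have {}h1 := h1 (eqP cS0); rewrite encode_repr -xE in h1.
rewrite -configuration_ext in cS0.
have h2 := hc s (N X) cS0 (compliant_head co) ws.
have gt0 : global_time (final (ext s) tr) = global_time (ext s) + (n - @ord0 n).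
  by rewrite subn0.
have [|||m' h3] := @can_search (T X) (N X) _ _ _ tr (ext s) s ord0 (perm_refl _) it la co wt gt0.
- by move=> s' c1 c2 c3; apply: can_le (hc _ _ c1 c2 c3) _; rewrite /T; lia.
- by move=> s' c1 c2 c3; apply: can_le (ht _ _ c1 c2 c3) _; rewrite /T; lia.
- by rewrite /T; lia.
have [t le d] := can_seq h1 (can_seq h2 h3).
exists m', t; split=> //; apply: leq_trans le _; rewrite -qE /B.
rewrite leq_add2r; apply: leq_add; first by rewrite leq_mul2l ltnS size_repr ws orbT.
rewrite leq_add2r; apply: leq_add; first by rewrite /T -addnA leq_addr.
rewrite leq_mul2l; apply/orP; right.
apply: leq_trans (trace_length HA it) _; rewrite gt addKn.
have sz : size (ext s) <= X by rewrite /X xE; apply: size_encode_ge.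
apply: leq_add; first exact: leq_trans (count_size _ _) sz.
by rewrite leq_mul2l ltnS sz orbT.
Qed.

End Verifier.

Theorem theorem3 (n : nat) (Sg : signature) (A : seq (irule Sg))
    (CS : crit_spec Sg) (k : nat)
    (HA : progressive A)
    (HCS : wf_crit_spec CS)
    (next : rule Sg -> config Sg -> bool)
    (critical mustTick : config Sg -> bool)
    (next_spec : forall r S, in_system A r -> configuration k S ->
       (next r S <-> applicable k r S))
    (critical_spec : forall S, configuration k S ->
       (critical S <-> is_critical CS S))
    (mustTick_spec : forall S, configuration k S ->
       (mustTick S <-> no_instantaneous k A S))
    (next_poly : forall r, in_system A r ->
       poly_time_on (configuration k) (@encode Sg) (next r))
    (critical_poly : poly_time_on (configuration k) (@encode Sg) critical)
    (mustTick_poly : poly_time_on (configuration k) (@encode Sg) mustTick) :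
  in_NP (fun x : seq (char Sg) =>
    exists (S0 : config Sg) (m Dmax : nat),
      [/\ x = encode S0, initial_data k A CS S0 m Dmax &
          time_bounded_realizable n k A CS S0]).
Proof.
have [Mc [pc Mc_spec]] := critical_poly.
have [Mt [pt Mt_spec]] := mustTick_poly.
exact: (realizability_in_NP n HA critical_spec mustTick_spec Mc_spec Mt_spec).
Qed.
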